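(* Let $f:E\to X$ be a fibrewise pointed map over $B$ between pointed fibrant and cofibrant spaces over $B$. Suppose that $B$ is a CW-complex, $X$ is a paracompact Hausdorff space, and: (i) $f:E\to X$ is a $k$-equivalence for some $k\ge0$; (ii) $\dim(B)<(\mathrm{secat}_B(f)+1)(k+1)-1$. Then $\mathrm{secat}_B(f)=\mathrm{secat}^B_B(f)$.
   Context: Fibrewise space over $B$: a space $X$ with a map $p_X:X\to B$; fibrewise pointed space: with a section $s_X:B\to X$ of $p_X$; fibrewise pointed map: $p_Yf=p_X$ and $fs_X=s_Y$. A pointed fibrant and cofibrant space over $B$ is a fibrewise pointed space with $p_X$ a Hurewicz fibration and $s_X$ a closed cofibration (in the ordinary sense). A fibrewise homotopy is a homotopy $H$ with $p_Y(H(x,t))=p_X(x)$ for all $t$ ($\simeq_B$); it is fibrewise pointed if moreover $H(s_X(b),t)=s_Y(b)$ ($\simeq^B_B$). A $k$-equivalence is a map inducing bijections on $\pi_i$ for $i<k$ and a surjection on $\pi_k$ for all basepoints. $\mathrm{secat}_B(f)$: least $n$ such that $X$ is covered by $n+1$ open sets $U$ each with a fibrewise map $s:U\to E$, $fs\simeq_B$ the inclusion $U\hookrightarrow X$. $\mathrm{secat}^B_B(f)$: least $n$ such that $X$ is covered by $n+1$ open sets $U\supseteq s_X(B)$ each with a fibrewise pointed map $s:U\to E$, $fs\simeq^B_B$ the inclusion. Both are $\infty$ if no such $n$ exists. *)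

(* Defs.v *)
From HB Require Import structures.
From mathcomp Require Import all_boot all_order all_algebra.
From mathcomp Require Import all_classical all_reals all_analysis.
From mathcomp Require Import Rstruct Rstruct_topology.
From Stdlib Require Import Rdefinitions.

Set Implicit Arguments.
Unset Strict Implicit.
Unset Printing Implicit Defensive.

Import Order.TTheory GRing.Theory Num.Theory.
Local Open Scope classical_set_scope.
Local Open Scope ring_scope.

Definition unitI : set R := `[0%R, 1%R].

(** ** Extended natural numbers: [None] stands for infinity. *)
Definition least_opt (P : nat -> Prop) : option nat :=
  if `[< exists n, P n >]
  then Some (xget 0%N [set n : nat | P n /\ forall m, P m -> leq n m])
  else None.

Definition lt_enat (a b : option nat) : Prop :=
  match a, b with
  | Some m, Some n => ltn m n
  | Some _, None => True
  | None, _ => False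
  end.

Definition secat_bound (s : option nat) (k : nat) : option nat :=
  match s with
  | Some n => Some (muln n.+1 k.+1).-1
  | None => None
  end.

Definition cube (n : nat) : set 'rV[R]_n :=
  [set v | forall i : 'I_n, 0 <= v ord0 i <= 1].
Definition cube_bdry (n : nat) : set 'rV[R]_n :=
  [set v | @cube n v /\ exists i : 'I_n, v ord0 i = 0 \/ v ord0 i = 1].
Definition disk (n : nat) : set 'rV[R]_n :=
  [set v | \sum_(i < n) v ord0 i ^+ 2 <= 1].
Definition odisk (n : nat) : set 'rV[R]_n :=
  [set v | \sum_(i < n) v ord0 i ^+ 2 < 1].
Definition dsphere (n : nat) : set 'rV[R]_n :=
  [set v | \sum_(i < n) v ord0 i ^+ 2 = 1].
Arguments cube n : clear implicits.
Arguments cube_bdry n : clear implicits.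
Arguments disk n : clear implicits.
Arguments odisk n : clear implicits.
Arguments dsphere n : clear implicits.

(** ** Homotopy groups, unfolded: pi_n(Y, y) is the set of classes of maps
    (I^n, dI^n) -> (Y, y) up to homotopy relative to dI^n. *)
Definition cube_map (n : nat) (Y : topologicalType) (y : Y)
    (g : 'rV[R]_n -> Y) : Prop :=
  {within cube n, continuous g} /\ (forall v, cube_bdry _ v -> g v = y).

Definition rel_homotopic (n : nat) (Y : topologicalType) (y : Y)
    (g1 g2 : 'rV[R]_n -> Y) : Prop :=
  exists G : 'rV[R]_n * R -> Y,
    [/\ {within cube n `*` unitI, continuous G},
        (forall v, cube _ v -> G (v, 0) = g1 v /\ G (v, 1) = g2 v) &
        (forall v t, cube_bdry _ v -> unitI t -> G (v, t) = y)].

(** f is a k-equivalence: for every basepoint e, the induced map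
    pi_i(E,e) -> pi_i(X,f e) is surjective for i <= k and injective for i < k. *)
Definition k_equivalence (E X : topologicalType) (f : E -> X) (k : nat) : Prop :=
  forall (e : E) (i : nat), leq i k ->
    (forall g : 'rV[R]_i -> X, cube_map (f e) g ->
       exists h : 'rV[R]_i -> E, cube_map e h /\ rel_homotopic (f e) (f \o h) g) /\
    (ltn i k -> forall h1 h2 : 'rV[R]_i -> E, cube_map e h1 -> cube_map e h2 ->
       rel_homotopic (f e) (f \o h1) (f \o h2) -> rel_homotopic e h1 h2).

Definition hurewicz_fibration (X B : topologicalType) (p : X -> B) : Prop :=
  forall (Z : topologicalType) (h : Z -> X) (G : Z * R -> B),
    continuous h -> {within [set: Z] `*` unitI, continuous G} ->
    (forall z, G (z, 0) = p (h z)) ->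
    exists H : Z * R -> X,
      [/\ {within [set: Z] `*` unitI, continuous H},
          (forall z, H (z, 0) = h z) &
          (forall z t, unitI t -> p (H (z, t)) = G (z, t))].

Definition cofibration (B X : topologicalType) (s : B -> X) : Prop :=
  forall (Z : topologicalType) (g : X -> Z) (G : B * R -> Z),
    continuous g -> {within [set: B] `*` unitI, continuous G} ->
    (forall b, G (b, 0) = g (s b)) ->
    exists H : X * R -> Z,
      [/\ {within [set: X] `*` unitI, continuous H},
          (forall x, H (x, 0) = g x) &
          (forall b t, unitI t -> H (s b, t) = G (b, t))].

Definition closed_cofibration (B X : topologicalType) (s : B -> X) : Prop :=
  closed (range s) /\ cofibration s.

Definition paracompact (X : topologicalType) : Prop :=
  forall (I : Type) (U : I -> set X),
    (forall i, open (U i)) -> (forall x, exists i, U i x) ->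
    exists (J : Type) (V : J -> set X),
      [/\ (forall j, open (V j)), (forall x, exists j, V j x),
          (forall j, exists i, V j `<=` U i) &
          (forall x : X, exists N : set X, nbhs x N /\ finite_set [set j | V j `&` N !=set0])].

Unset Implicit Arguments.
Record CWstructure (B : topologicalType) := {
  cw_cell : Type;
  cw_dim : cw_cell -> nat;
  cw_char : forall a, 'rV[R]_(cw_dim a) -> B;
  cw_hausdorff : hausdorff_space B;
  cw_cont : forall a, {within disk (cw_dim a), continuous (cw_char a)};
  cw_inj : forall a u v, odisk _ u -> odisk _ v -> cw_char a u = cw_char a v -> u = v;
  (* the characteristic map is a homeomorphism from the open disk onto the open cell *)
  cw_open : forall a (A : set 'rV[R]_(cw_dim a)),
      (exists W, open W /\ A = W `&` odisk (cw_dim a)) ->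
      exists V, open V /\ cw_char a @` A = V `&` (cw_char a @` odisk (cw_dim a));
  cw_cover : forall b, exists a v, odisk _ v /\ cw_char a v = b;
  cw_disj : forall a a' (u : 'rV[R]_(cw_dim a)) (v : 'rV[R]_(cw_dim a')),
      odisk _ u -> odisk _ v -> cw_char a u = cw_char a' v -> a = a';
  cw_cf : forall a, exists F : set cw_cell,
      [/\ finite_set F, (forall a', F a' -> ltn (cw_dim a') (cw_dim a)) &
          forall v, dsphere _ v -> exists a', F a' /\
             exists u, odisk _ u /\ cw_char a' u = cw_char a v];
  cw_weak : forall A : set B,
      (forall a, closed (A `&` (cw_char a @` disk (cw_dim a)))) -> closed A
}.

Set Implicit Arguments.
Arguments cw_dim {B} c a.
Arguments cw_char {B} c a _.

Definition cw_dimension (B : topologicalType) (C : CWstructure B) : option nat :=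
  least_opt (fun N => forall a, leq (cw_dim C a) N).

Definition fw_local_section (B E X : topologicalType) (pE : E -> B) (pX : X -> B)
    (f : E -> X) (U : set X) : Prop :=
  exists s : X -> E,
    [/\ {within U, continuous s}, (forall x, U x -> pE (s x) = pX x) &
    exists H : X * R -> X,
      [/\ {within U `*` unitI, continuous H},
          (forall x, U x -> H (x, 0) = f (s x) /\ H (x, 1) = x) &
          (forall x t, U x -> unitI t -> pX (H (x, t)) = pX x)]].

Definition fwp_local_section (B E X : topologicalType) (pE : E -> B) (pX : X -> B)
    (sE : B -> E) (sX : B -> X) (f : E -> X) (U : set X) : Prop :=
  range sX `<=` U /\
  exists s : X -> E,
    [/\ {within U, continuous s}, (forall x, U x -> pE (s x) = pX x),
        (forall b, s (sX b) = sE b) &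
    exists H : X * R -> X,
      [/\ {within U `*` unitI, continuous H},
          (forall x, U x -> H (x, 0) = f (s x) /\ H (x, 1) = x),
          (forall x t, U x -> unitI t -> pX (H (x, t)) = pX x) &
          (forall b t, unitI t -> H (sX b, t) = sX b)]].

Definition open_cover_by (X : topologicalType) (P : set X -> Prop) (n : nat) : Prop :=
  exists U : 'I_n.+1 -> set X,
    [/\ (forall i, open (U i)), (forall x, exists i, U i x) & (forall i, P (U i))].

Definition secatB (B E X : topologicalType) (pE : E -> B) (pX : X -> B)
    (f : E -> X) : option nat :=
  least_opt (open_cover_by (fw_local_section pE pX f)).

Definition secatBB (B E X : topologicalType) (pE : E -> B) (pX : X -> B)
    (sE : B -> E) (sX : B -> X) (f : E -> X) : option nat :=
  least_opt (open_cover_by (fwp_local_section pE pX sE sX f)).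

(* Main.v *)
Require Import Defs.
From HB Require Import structures.
From mathcomp Require Import all_boot all_order all_algebra.
From mathcomp Require Import all_classical all_reals all_analysis.
From mathcomp Require Import Rstruct Rstruct_topology.
From mathcomp Require Import lra ring zify.

Set Implicit Arguments.
Unset Strict Implicit.
Unset Printing Implicit Defensive.
Import Order.TTheory GRing.Theory Num.Theory.
Import numFieldNormedType.Exports.
Local Open Scope classical_set_scope.
Local Open Scope ring_scope.

(** Let [P] be the space of pairs of a point [e] of [E] and a vertical path in
    [X] from [f e] to the section [sX]: it is fibred over [B], and a fibrewise
    (pointed) local section of [f] near the section is a local section of [P]
    (agreeing with the section [w] of constant paths).  A cover of [X] by n+1
    open sets with local sections restricts to such a cover of [B] with local
    sections of [P].  It suffices to extend it over [B * [-1, 1]] to a family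
    of n+1 local sections that at the other end are all defined everywhere and
    equal to [w]: a vertical deformation of a neighbourhood of the section then
    transplants this family into [X].

    The extension is made cell by cell.  The fibres of [P] are (k-1)-connected,
    so on a cube of dimension d each of the n+1 partial sections extends over
    the k-skeleton of a fine grid, and from there over the complement of a dual
    skeleton, the set where at least k+1 coordinates lie in a prescribed finite
    set.  Taking disjoint finite sets for the n+1 indices, these exceptional
    sets have no common point as soon as d < (n+1)(k+1). *)

(** * Continuity on subsets *)

(** A cell of dimension m of B gives a prism of dimension m + 1 over [-1, 1], so what the extension
    requires is dim B + 1 < (n+1)(k+1): this is the origin of the term -1 in the hypothesis. A
    single local section need not extend over a cube. Only the covering property of the whole family
    is maintained, so each domain may shrink inside the cube, while on its boundary the domains and
    the values have to be preserved exactly. Two devices secure this. The grid is finer than a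
    Lebesgue number of the domains on the boundary, so that near a boundary point some old section
    is defined on every face involved and is retained there. Moreover each new section is first
    built over a displaced point, and is brought back by lifting a homotopy that is stationary near
    the boundary. All balls are taken in the maximum norm: they are cubes, a product of balls is a
    ball, and the prism over a cell is again a cell. *)

Section within.
Context {T U W : topologicalType}.
Implicit Types (D A : set T).

Lemma within_comp D (A : set U) (g : U -> W) (f : T -> U) :
  {within A, continuous g} -> {within D, continuous f} ->
  (forall x, D x -> A (f x)) -> {within D, continuous (g \o f)}.
Proof.
move=> /subspace_continuousP cg /subspace_continuousP cf DA.
apply/subspace_continuousP => x Dx.
have h : f @ within D (nbhs x) --> within A (nbhs (f x)).
  move=> O /= nO; rewrite /nbhs /= /within /=.
  have := cf _ Dx (fun y => A y -> O y) nO.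
  rewrite /nbhs /= /within /= => h.
  apply: filterS h => y h Dy; apply: h => //; exact: DA.
by move=> O /(cg _ (DA _ Dx)) nO; have := h _ nO.
Qed.

Lemma within_pair D (f : T -> U) (g : T -> W) :
  {within D, continuous f} -> {within D, continuous g} ->
  {within D, continuous (fun x => (f x, g x))}.
Proof. by move=> cf cg x; exact: cvg_pair (cf x) (cg x). Qed.

Lemma within_eq D (f g : T -> U) : (forall x, D x -> f x = g x) ->
  {within D, continuous f} -> {within D, continuous g}.
Proof.
move=> e; apply: subspace_eq_continuous => x; rewrite inE; exact: e.
Qed.

Lemma within_openU D (A1 A2 : set T) (f : T -> U) : open A1 -> open A2 ->
  {within D `&` A1, continuous f} -> {within D `&` A2, continuous f} ->
  {within D `&` (A1 `|` A2), continuous f}.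
Proof.
move=> oA1 oA2 /subspace_continuousP c1 /subspace_continuousP c2.
apply/subspace_continuousP => x [Dx [Ax|Ax]] O nO.
  have := c1 x (conj Dx Ax) O nO; rewrite /nbhs /= /within /= => h.
  have {}oA1 : nbhs x A1 by exact: open_nbhs_nbhs.
  by near=> y => -[Dy _]; apply: (near h y) => //; split => //; near: y.
have := c2 x (conj Dx Ax) O nO; rewrite /nbhs /= /within /= => h.
have {}oA2 : nbhs x A2 by exact: open_nbhs_nbhs.
by near=> y => -[Dy _]; apply: (near h y) => //; split => //; near: y.
Unshelve. all: by end_near. Qed.

Lemma within_bigcup_closed (I : finType) (P : pred I) (A : I -> set T) (f : T -> U) :
  (forall i, closed (A i)) ->
  (forall i, P i -> {within A i, continuous f}) ->
  {within [set x | exists2 i, P i & A i x], continuous f}.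
Proof.
move=> cA cf.
suff h (s : seq I) : {within [set x | exists2 i, (i \in s) && P i & A i x], continuous f}.
  apply: continuous_subspaceW (h (enum I)) => x [i Pi Ai]; exists i => //.
  by rewrite mem_enum.
have cl (s' : seq I) : closed [set x | exists2 i, (i \in s') && P i & A i x].
  elim: s' => [|i s' IH].
    rewrite [X in closed X](_ : _ = set0); first exact: closed0.
    by apply/seteqP; split => // x [].
  rewrite [X in closed X](_ : _ = (if P i then A i else set0) `|`
     [set x | exists2 i, (i \in s') && P i & A i x]).
    by apply: closedU => //; case: ifP => // _; exact: closed0.
  apply/seteqP; split => x.
    by case=> j; rewrite inE => /andP[/predU1P[->|js] Pj] Aj;
      [left; rewrite Pj|right; exists j => //; rewrite js].
  case; last by case=> j /andP[js Pj] Aj; exists j => //; rewrite inE js orbT.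
  by case: ifP => // Pi Ai; exists i => //; rewrite inE eqxx.
elim: s => [|i s IH].
  apply: continuous_subspaceW (@continuous_subspace0 _ _ f) => x [].
  by [].
case Pi : (P i).
  have := withinU_continuous (cA i) (cl s) (cf _ Pi) IH.
  apply: continuous_subspaceW => x [j]; rewrite inE => /andP[/predU1P[->|js] Pj] Aj.
    by left.
  by right; exists j => //; rewrite js.
apply: continuous_subspaceW IH => x [j]; rewrite inE => /andP[/predU1P[->|js] Pj] Aj.
  by rewrite Pi in Pj.
by exists j => //; rewrite js.
Qed.

(* A partial map with relatively open domain [D `&` O] is encoded by total
   data [O], [g] such that all these sets are closed. *)
Definition partial_continuous D (O : set T) (g : T -> U) :=
  forall C : set U, closed C -> closed [set x | D x /\ (O x -> C (g x))].

Lemma partial_continuous_eq D (O O' : set T) (g g' : T -> U) :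
  (forall x, D x -> (O x <-> O' x)) -> (forall x, D x -> O x -> g x = g' x) ->
  partial_continuous D O g -> partial_continuous D O' g'.
Proof.
move=> eO eg h C cC; rewrite [X in closed X](_ : _ = [set x | D x /\ (O x -> C (g
  x))]); first exact: h.
by apply/seteqP; split => x /= [Dx k]; split => // Ox; move: (k); rewrite -?eg //;
  try (by apply/eO); (apply; apply/eO).
Qed.

(** The case of empty [C] is the relative openness of the domain. In the other direction, each test
    set is the union of the part outside the domain and a closed set that induces the preimage of
    [C]. *)
Lemma partial_continuousP D (O : set T) (g : T -> U) : closed D ->
  partial_continuous D O g <->
  closed (D `\` O) /\ {within D `&` O, continuous g}.
Proof.
move=> cD; split.
  move=> h; split.
    rewrite [X in closed X](_ : _ = [set x | D x /\ (O x -> set0 (g x))]).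
      exact: h closed0.
    by apply/seteqP; split => x.
  apply/continuous_closedP => C /h cC; apply/closed_subspaceP.
  exists [set x | D x /\ (O x -> C (g x))] => //.
  by apply/seteqP; split => x /= -[a [Dx Ox]]; split => //; case: a => _ /(_ Ox).
move=> [cO /continuous_closedP h] C /h /closed_subspaceP[V cV VE].
rewrite [X in closed X](_ : _ = (D `\` O) `|` (D `&` V)).
  by apply: closedU => //; exact: closedI.
apply/seteqP; split => x /=.
  case=> Dx k; have [Ox|nO] := pselect (O x); last by left.
  right; split => //; suff [] : (V `&` (D `&` O)) x by [].
  by rewrite VE; split => //; exact: k.
case=> -[Dx k]; split => // Ox.
by suff [] : ((from_subspace (D `&` O) g @^-1` C) `&` (D `&` O)) x by []; rewrite -VE.
Qed.

Lemma partial_continuous_open D (O : set T) (g : T -> U) : closed D -> open O ->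
  {within D `&` O, continuous g} -> partial_continuous D O g.
Proof.
move=> cD oO h; apply/partial_continuousP => //; split => //.
by rewrite setDE; apply: closedI => //; exact: open_closedC.
Qed.

End within.

Lemma partial_continuous_setU {T U : topologicalType} (D1 D2 O : set T) (g : T -> U) :
  partial_continuous D1 O g -> partial_continuous D2 O g ->
  partial_continuous (D1 `|` D2) O g.
Proof.
move=> h1 h2 C cC; rewrite [X in closed X](_ : _ = [set x | D1 x /\ (O x -> C (g x))]
  `|` [set x | D2 x /\ (O x -> C (g x))]); first by apply: closedU; [exact: h1|exact: h2].
by apply/seteqP; split => x /=; [case=> -[] Dx k; [left|right]|case=> -[Dx k];
  split => //; [left|right]].
Qed.

Section cts.
Context {R : realType} {T : topologicalType} {V : normedModType R}.
Implicit Types (f g : T -> V) (a b : T -> R).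
Lemma ctsC {U : topologicalType} (c : U) : continuous (fun _ : T => c).
Proof. by move=> x; exact: cvg_cst. Qed.
Lemma ctsD f g : continuous f -> continuous g -> continuous (fun x => f x + g x).
Proof. by move=> cf cg x; exact: cvgD (cf x) (cg x). Qed.
Lemma ctsB f g : continuous f -> continuous g -> continuous (fun x => f x - g x).
Proof. by move=> cf cg x; exact: cvgB (cf x) (cg x). Qed.
Lemma ctsN f : continuous f -> continuous (fun x => - f x).
Proof. by move=> cf x; exact: cvgN (cf x). Qed.
Lemma ctsZ a f : continuous a -> continuous f -> continuous (fun x => a x *: f x).
Proof. by move=> cf cg x; exact: cvgZ (cf x) (cg x). Qed.
Lemma ctsNorm f : continuous f -> continuous (fun x => `|f x|).
Proof. by move=> cf x; exact: cvg_norm (cf x). Qed.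
Lemma ctsM a b : continuous a -> continuous b -> continuous (fun x => a x * b x).
Proof. by move=> cf cg x; exact: cvgM (cf x) (cg x). Qed.
Lemma ctsV a : (forall x, a x != 0) -> continuous a -> continuous (fun x => (a x)^-1).
Proof. by move=> h cf x; exact: cvgV (h x) (cf x). Qed.
Lemma ctsmax a b : continuous a -> continuous b -> continuous (fun x => Num.max (a x)
  (b x)).
Proof. by move=> cf cg x; exact: continuous_max (cf x) (cg x). Qed.
Lemma ctsmin a b : continuous a -> continuous b -> continuous (fun x => Num.min (a x)
  (b x)).
Proof. by move=> cf cg x; exact: continuous_min (cf x) (cg x). Qed.
Lemma ctspair {U W : topologicalType} (f' : T -> U) (g' : T -> W) :
  continuous f' -> continuous g' -> continuous (fun x => (f' x, g' x)).
Proof. by move=> cf cg x; exact: cvg_pair (cf x) (cg x). Qed.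
Lemma ctscomp {U W : topologicalType} (f' : U -> W) (g' : T -> U) :
  continuous f' -> continuous g' -> continuous (fun x => f' (g' x)).
Proof. by move=> cf cg x; exact: continuous_comp (cg x) (cf (g' x)). Qed.
Lemma ctsid : continuous (fun x : T => x).
Proof. by move=> x; exact: cvg_id. Qed.
Lemma ctsfst {U W : topologicalType} (f' : T -> U * W) :
  continuous f' -> continuous (fun x => (f' x).1).
Proof. by move=> cf x; apply: continuous_comp (cf x) _; exact: cvg_fst. Qed.
Lemma ctssnd {U W : topologicalType} (f' : T -> U * W) :
  continuous f' -> continuous (fun x => (f' x).2).
Proof. by move=> cf x; apply: continuous_comp (cf x) _; exact: cvg_snd. Qed.
End cts.

Ltac cts_step f :=
  lazymatch f with
  | from_subspace _ _ => rewrite /from_subspace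
  | (fun x => x) => exact: ctsid
  | @fst _ _ => apply: (@ctsfst _ _ _ id); exact: ctsid
  | @snd _ _ => apply: (@ctssnd _ _ _ id); exact: ctsid
  | (fun x => (@?a x, @?b x)) => apply: (@ctspair _ _ _ a b)
  | (fun x => fst (@?a x)) => apply: (@ctsfst _ _ _ a)
  | (fun x => snd (@?a x)) => apply: (@ctssnd _ _ _ a)
  | (fun x => Num.max (@?a x) (@?b x)) => apply: (@ctsmax _ _ a b)
  | (fun x => Num.min (@?a x) (@?b x)) => apply: (@ctsmin _ _ a b)
  | (fun x => Num.norm (@?a x)) => apply: (@ctsNorm _ _ _ a)
  | (fun x => @?a x *: @?b x) => apply: (@ctsZ _ _ _ a b)
  | (fun x => @?a x * @?b x) => apply: (@ctsM _ _ a b)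
  | (fun x => @?a x - @?b x) => apply: (@ctsB _ _ _ a b)
  | (fun x => - @?a x) => apply: (@ctsN _ _ _ a)
  | (fun x => @?a x + @?b x) => apply: (@ctsD _ _ _ a b)
  | (fun x => (@?a x)^-1) => apply: (@ctsV _ _ a)
  | (fun x => ?h (@?a x)) => apply: (@ctscomp _ _ _ h a)
  end.
Ltac cts_const f :=
  match f with
  | (fun _ : ?T => ?c) => let k := constr:(fun _ : T => c) in exact: ctsC
  end.
Ltac cts := repeat first [ assumption |
  match goal with
  | |- forall y, @continuous_at _ _ y ?f => cts_const f
  end |
  match goal with
  | |- forall y, @continuous_at _ _ y ?f => cts_step f
  end ].

Definition cball (R : realType) (V : normedModType R) : set V := [set v | `|v| <= 1].
Definition csphere (R : realType) (V : normedModType R) : set V := [set v | `|v| = 1].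
Arguments cball {R} V.
Arguments csphere {R} V.

Lemma norm_pair (R : realType) (V W : normedModType R) (v : V) (w : W) :
  `|(v, w)| = Num.max `|v| `|w|.
Proof. by []. Qed.

(** The homotopy lifting property over a subset, stopped at a variable time [m]. Only the end of the
    lifted path is kept, and it is the given point wherever [m] vanishes. Relative lifting problems
    are solved by making the time zero on the part where the lift is prescribed. *)
Definition lifting (R : realType) (P B : topologicalType) (p : P -> B) :=
  forall (T : topologicalType) (D : set T) (s : T -> P) (G : T * R -> B) (m : T -> R),
  {within D, continuous s} ->
  {within D `*` [set t : R | 0 <= t <= 1], continuous G} ->
  {within D, continuous m} -> (forall z, D z -> 0 <= m z <= 1) ->
  (forall z, D z -> G (z, 0) = p (s z)) ->
  exists H : T -> P, [/\ {within D, continuous H},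
    forall z, D z -> p (H z) = G (z, m z) &
    forall z, D z -> m z = 0 -> H z = s z].
Arguments lifting R {P B} p.

Section maxmin.
Context {R : realDomainType}.
Implicit Types a b : R.
Lemma maxcase a b : (a <= b /\ Num.max a b = b) \/ (b <= a /\ Num.max a b = a).
Proof. by case: (leP a b) => h; [left|right; split => //; exact: ltW]. Qed.
Lemma mincase a b : (a <= b /\ Num.min a b = a) \/ (b <= a /\ Num.min a b = b).
Proof. by case: (leP a b) => h; [left|right; split => //; exact: ltW]. Qed.
End maxmin.

Ltac max_case d T a b :=
  let m := fresh "m" in let e := fresh "e" in let h := fresh "h" in
  assert (e : (is_true (@Order.le d T a b) /\ @Order.max d T a b = b) \/
              (is_true (@Order.le d T b a) /\ @Order.max d T a b = a)) by exact: maxcase;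
  set (m := @Order.max d T a b) in *; clearbody m; destruct e as [[h e]|[h e]].
Ltac min_case d T a b :=
  let m := fresh "m" in let e := fresh "e" in let h := fresh "h" in
  assert (e : (is_true (@Order.le d T a b) /\ @Order.min d T a b = a) \/
              (is_true (@Order.le d T b a) /\ @Order.min d T a b = b)) by exact: mincase;
  set (m := @Order.min d T a b) in *; clearbody m; destruct e as [[h e]|[h e]].
Ltac mm :=
  repeat match goal with
  | |- context [@Order.max ?d ?T ?a ?b] => max_case d T a b
  | |- context [@Order.min ?d ?T ?a ?b] => min_case d T a b
  | H : context [@Order.max ?d ?T ?a ?b] |- _ => max_case d T a b
  | H : context [@Order.min ?d ?T ?a ?b] |- _ => min_case d T a b
  end.

(** * Lifting over boxes *)

Lemma cballR (R : realType) (t : R) : cball R t <-> (-1 <= t <= 1).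
Proof. by rewrite /cball /= ler_norml. Qed.

Lemma closed_cball (R : realType) (V : normedModType R) : closed (cball V).
Proof.
rewrite /cball [X in closed X](_ : _ = (fun v : V => `|v|) @^-1` [set x | x <= 1]) //.
apply: closed_comp; last exact: closed_le.
by move=> x _; exact: norm_continuous.
Qed.

Lemma closed_csphere (R : realType) (V : normedModType R) : closed (csphere V).
Proof.
rewrite /csphere [X in closed X](_ : _ = (fun v : V => `|v|) @^-1` [set x | x = 1]) //.
apply: closed_comp; last exact: closed_eq.
by move=> x _; exact: norm_continuous.
Qed.

Lemma closed_setX (T U : topologicalType) (A : set T) (C : set U) :
  closed A -> closed C -> closed (A `*` C).
Proof.
move=> cA cC; rewrite [X in closed X](_ : _ = fst @^-1` A `&` snd @^-1` C); last first.
  by apply/seteqP; split => -[x y].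
apply: closedI; apply: closed_comp => // x _; [exact: cvg_fst|exact: cvg_snd].
Qed.

Lemma closed_le_fun (R : realType) (T : topologicalType) (f g : T -> R) :
  continuous f -> continuous g -> closed [set x | f x <= g x].
Proof.
move=> cf cg; rewrite [X in closed X](_ : _ = (fun x => g x - f x) @^-1` [set y | 0 <=
  y]).
  by apply: closed_comp; [move=> x _; apply: ctsB|exact: closed_ge].
by apply/seteqP; split => x /=; rewrite subr_ge0.
Qed.

Section box.
Variables (R : realType) (P B : topologicalType) (p : P -> B) (Q : normedModType R).
Hypothesis fp : lifting R p.

(** On the ray from (0, 3) through [z], the point of parameter [u] is [ray z u], with [z] itself at
    [u = 1]. It meets the bottom at [u = (3 - z.2) / 4] and the side at [u] equal to the norm of
    [z.1]; the larger value is met first from [z]. Inside the box [(3 - z.2) / 4] is at least 1/2,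
    so the constant 1/2 only keeps [lam] away from 0 elsewhere. *)
Let lam (z : Q * R) : R := Num.max (2^-1) (Num.max `|z.1| ((3 - z.2) / 4)).

Let lam_cts : continuous lam.
Proof. by rewrite /lam; cts. Qed.

Let lamP z : (cball Q `*` cball R) z ->
  [/\ 2^-1 <= lam z <= 1, `|z.1| <= lam z & (3 - z.2) / 4 <= lam z] /\
  (lam z = `|z.1| \/ lam z = (3 - z.2) / 4).
Proof.
case: z => v t [] /=; rewrite /cball /= => v1 /ler_normlP[t1 t2].
rewrite /lam /=; have v0 := normr_ge0 v.
split; [split; mm; lra|].
by mm; [right|left|right|left]; lra.
Qed.

Let ray (z : Q * R) (u : R) : Q * R := (u^-1 *: z.1, 3 - (3 - z.2) / u).

Let ray_in z u : (cball Q `*` cball R) z -> lam z <= u <= 1 ->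
  (cball Q `*` cball R) (ray z u).
Proof.
move=> Dz /andP[u1 u2]; have [[/andP[l0 l1] l2 l3] _] := lamP Dz.
have u0 : 0 < u by lra.
case: z Dz u1 l0 l1 l2 l3 => v t [] /=; rewrite /cball /= => v1 /ler_normlP[t1 t2].
move=> u1 l0 l1 l2 l3; split => /=.
  by rewrite normrZ ger0_norm ?invr_ge0 ?(ltW u0)// ler_pdivrMl// mulr1; lra.
apply/ler_normlP; split.
  by rewrite opprB lerBlDr ler_pdivrMr//; lra.
by rewrite lerBlDr -lerBlDl ler_pdivlMr//; nra.
Qed.

(** Projection along the rays spreads the prescribed lift from the bottom and the sides over the
    box. It then lies over the wrong point of [B]; this is repaired by lifting the motion along the
    ray for the time [1 - lam], which is zero on the bottom and the sides. *)
Lemma box_lift (a : Q -> P) (b : Q * R -> P) (G : Q * R -> B) :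
  {within cball Q, continuous a} ->
  {within csphere Q `*` cball R, continuous b} ->
  {within cball Q `*` cball R, continuous G} ->
  (forall z, csphere Q z -> b (z, -1) = a z) ->
  (forall z, cball Q z -> p (a z) = G (z, -1)) ->
  (forall z t, csphere Q z -> cball R t -> p (b (z, t)) = G (z, t)) ->
  exists H : Q * R -> P,
    [/\ {within cball Q `*` cball R, continuous H},
      forall z, cball Q z -> H (z, -1) = a z,
      forall z t, csphere Q z -> cball R t -> H (z, t) = b (z, t) &
      forall z t, cball Q z -> cball R t -> p (H (z, t)) = G (z, t)].
Proof.
move=> ca cb cG ba pa pb.
set D := cball Q `*` cball R.
pose r z := ray z (lam z).
pose C1 := D `&` [set z : Q * R | `|z.1| <= (3 - z.2) / 4].
pose C2 := D `&` [set z : Q * R | (3 - z.2) / 4 <= `|z.1|].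
have lam0 z : lam z != 0.
  by rewrite /lam; apply: lt0r_neq0; rewrite lt_max; apply/orP; left; lra.
have rC : continuous r by rewrite /r /ray; cts.
have cD : closed D by apply: closed_setX; exact: closed_cball.
have cC1 : closed C1 by apply: closedI => //; apply: closed_le_fun; cts.
have cC2 : closed C2 by apply: closedI => //; apply: closed_le_fun; cts.
have r1 z : C1 z -> (r z).2 = -1 /\ cball Q (r z).1.
  move=> [Dz /= h]; have [[/andP[l0 l1] l2 l3] l4] := lamP Dz.
  have l5 : lam z = (3 - z.2) / 4 by case: l4; lra.
  split; last by have [] := ray_in Dz (_ : lam z <= lam z <= 1); rewrite // lexx.
  have h0 : 3 - z.2 != 0 by apply: lt0r_neq0; lra.
  rewrite /r /ray /= l5; rewrite invf_div mulrCA divff //; lra.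
have r2 z : C2 z -> csphere Q (r z).1 /\ cball R (r z).2.
  move=> [Dz /= h]; have [[/andP[l0 l1] l2 l3] l4] := lamP Dz.
  have l5 : lam z = `|z.1| by case: l4; lra.
  split; last by have [] := ray_in Dz (_ : lam z <= lam z <= 1); rewrite // lexx.
  rewrite /r /ray /csphere /= l5 normrZ normfV normr_id mulVf //.
  by rewrite -l5.
pose s z := if `[< C1 z >] then a (r z).1 else b (r z).
have sC2 z : C2 z -> s z = b (r z).
  move=> C2z; rewrite /s; case: asboolP => // C1z.
  have [e _] := r1 _ C1z; have [h _] := r2 _ C2z.
  by rewrite -ba // -e -surjective_pairing.
have cs : {within D, continuous s}.
  have -> : D = C1 `|` C2.
    apply/seteqP; split => [z Dz|z [[]//|[]//]].
    by case: (leP `|z.1| ((3 - z.2) / 4)) => h; [left|right]; split => //=; lra.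
  apply: withinU_continuous => //.
    apply: (@within_eq _ _ _ (a \o (fun z => (r z).1))).
      by move=> z C1z /=; rewrite /s asboolT.
    apply: within_comp ca _ _; last by move=> z /r1[].
    by apply: continuous_subspaceT; cts.
  apply: (@within_eq _ _ _ (b \o r)).
    by move=> z /sC2.
  apply: within_comp cb _ _; last by move=> z /r2.
  exact: continuous_subspaceT.
pose m z := 1 - lam z.
pose u (y : Q * R * R) := Num.max (2^-1) (Num.min 1 (lam y.1 + y.2)).
have uP z t : D z -> 0 <= t <= 1 -> lam z <= u (z, t) <= 1.
  move=> Dz /andP[t0 t1]; have [[/andP[l0 l1] l2 l3] l4] := lamP Dz.
  rewrite /u /=; mm; lra.
have cu : continuous u by rewrite /u; cts.
have [||||H [cH pH H0]] := @fp _ D s (fun y => G (ray y.1 (u y))) m cs.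
- apply: (within_comp cG); last first.
    by move=> [z t] [Dz tI]; apply: ray_in => //; exact: uP.
  apply: continuous_subspaceT; rewrite /ray.
  have u0 x : u x != 0.
    by rewrite /u; apply: lt0r_neq0; rewrite lt_max; apply/orP; left; lra.
  by cts.
- by apply: continuous_subspaceT; rewrite /m; cts.
- move=> z Dz; have [[/andP[l0 l1] l2 l3] l4] := lamP Dz; rewrite /m; lra.
- move=> z Dz; have [[/andP[l0 l1] l2 l3] l4] := lamP Dz.
  have -> : u (z, 0) = lam z.
    by rewrite /u /= addr0; mm; lra.
  rewrite -/(r z) /s; case: asboolP => C1z.
    by have [e h] := r1 _ C1z; rewrite pa // -e -surjective_pairing.
  have C2z : C2 z by split => //=; case: (leP ((3 - z.2) / 4) `|z.1|) => // h;
    case: C1z; split => //=; lra.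
  by have [e h] := r2 _ C2z; rewrite [r z in RHS]surjective_pairing pb //
    -surjective_pairing.
have mu z : D z -> u (z, m z) = 1.
  by move=> Dz; rewrite /u /m /= addrC subrK; mm; lra.
have ray1 z : ray z 1 = z.
  by rewrite /ray invr1 scale1r mulr1 opprB addrC subrK -surjective_pairing.
exists H; split => //.
- move=> z zb; have Dz : D (z, -1) by split => //=; apply/cballR; lra.
  have C1z : C1 (z, -1).
    split => //=; move: zb; rewrite /cball /=; lra.
  have l1 : lam (z, -1) = 1.
    have [[/andP[l0 l1] /= l2 l3] l4] := lamP Dz; lra.
  rewrite H0 // /m ?l1 ?subrr // /s asboolT // /r l1.
  by rewrite ray1.
- move=> z t zs tb; have zb : cball Q z by rewrite /cball /= zs.
  have Dz : D (z, t) by [].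
  have /cballR/andP[t1 t2] := tb.
  have C2z : C2 (z, t) by split => //=; rewrite zs; lra.
  have l1 : lam (z, t) = 1.
    have [[/andP[l0 l1] /= l2 l3] l4] := lamP Dz; rewrite zs in l2; lra.
  by rewrite H0 // /m ?l1 ?subrr // sC2 // /r l1 ray1.
- by move=> z t zb tb; rewrite pH // mu // ray1.
Qed.

End box.

Lemma cball_prod (R : realType) (V W : normedModType R) :
  cball (V * W)%type = cball V `*` cball W.
Proof.
apply/seteqP; split => -[v w] /=; rewrite /cball /= norm_pair ge_max.
  by case/andP.
by case=> /= -> ->.
Qed.

Lemma csphere_prod (R : realType) (V W : normedModType R) (v : V) (w : W) :
  csphere (V * W)%type (v, w) <->
  (csphere V v /\ cball W w) \/ (cball V v /\ csphere W w).
Proof.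
rewrite /csphere /cball /= norm_pair; split.
  by move=> h; mm; [right|left]; lra.
by case=> -[]; mm; lra.
Qed.

Lemma csphereR (R : realType) (t : R) : csphere R t <-> (t = -1 \/ t = 1).
Proof.
rewrite /csphere /=; split; last by case=> ->; rewrite ?normrN normr1.
by case: (ger0P t) => h e; [right|left]; lra.
Qed.

Lemma csphere_cball (R : realType) (V : normedModType R) (v : V) : csphere V v -> cball
  V v.
Proof. by rewrite /csphere /cball /= => ->. Qed.

Lemma cballN1 (R : realType) : cball R (-1).
Proof. by rewrite /cball /= normrN normr1. Qed.
Lemma cball1 (R : realType) : cball R 1.
Proof. by rewrite /cball /= normr1. Qed.
#[local] Hint Resolve cballN1 cball1 csphere_cball : core.

(** Filling a box without a base is lifting over a one-point base, for which ['rV[R]_0] serves. *)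
Lemma lifting_unit (R : realType) (P : topologicalType) :
  lifting R (fun _ : P => 0 : 'rV[R]_0).
Proof.
move=> T D s G m cs _ _ _ _; exists s; split => // z Dz.
by rewrite [RHS]thinmx0.
Qed.

Section box2.
Variables (R : realType) (P B : topologicalType) (p : P -> B) (Q : normedModType R).
Hypothesis fp : lifting R p.

(** In the maximum norm the sphere of [Q * R] is the part over the sphere of [Q] together with two
    end balls. Three side maps that agree on the common edges therefore glue to one side map for
    [box_lift] over [Q * R]. *)
Lemma box_lift2 (a c0 c1 : Q * R -> P) (b : Q * R * R -> P) (G : Q * R * R -> B) :
  {within cball Q `*` cball R, continuous a} ->
  {within csphere Q `*` cball R `*` cball R, continuous b} ->
  {within cball Q `*` cball R, continuous c0} ->
  {within cball Q `*` cball R, continuous c1} ->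
  {within cball Q `*` cball R `*` cball R, continuous G} ->
  (forall z s, csphere Q z -> cball R s -> b ((z, s), -1) = a (z, s)) ->
  (forall z t, csphere Q z -> cball R t -> b ((z, -1), t) = c0 (z, t)) ->
  (forall z t, csphere Q z -> cball R t -> b ((z, 1), t) = c1 (z, t)) ->
  (forall z, cball Q z -> c0 (z, -1) = a (z, -1)) ->
  (forall z, cball Q z -> c1 (z, -1) = a (z, 1)) ->
  (forall z s, cball Q z -> cball R s -> p (a (z, s)) = G ((z, s), -1)) ->
  (forall z s t, csphere Q z -> cball R s -> cball R t -> p (b ((z, s), t)) = G ((z,
    s), t)) ->
  (forall z t, cball Q z -> cball R t -> p (c0 (z, t)) = G ((z, -1), t)) ->
  (forall z t, cball Q z -> cball R t -> p (c1 (z, t)) = G ((z, 1), t)) ->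
  exists H : Q * R * R -> P,
    [/\ {within cball Q `*` cball R `*` cball R, continuous H},
      forall z s, cball Q z -> cball R s -> H ((z, s), -1) = a (z, s),
      forall z s t, csphere Q z -> cball R s -> cball R t -> H ((z, s), t) = b ((z, s),
        t),
      forall z t, cball Q z -> cball R t -> H ((z, -1), t) = c0 (z, t) /\ H ((z, 1), t)
        = c1 (z, t) &
      forall z s t, cball Q z -> cball R s -> cball R t -> p (H ((z, s), t)) = G ((z,
        s), t)].
Proof.
move=> ca cb cc0 cc1 cG ba bc0 bc1 c0a c1a pa pb pc0 pc1.
pose sd (y : Q * R * R) : P := if y.1.2 == -1 then c0 (y.1.1, y.2) else
  if y.1.2 == 1 then c1 (y.1.1, y.2) else b y.
have n1 : (1 : R) == -1 = false by apply/eqP; lra.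
have sd0 z t : sd ((z, -1), t) = c0 (z, t) by rewrite /sd /= eqxx.
have sd1 z t : sd ((z, 1), t) = c1 (z, t) by rewrite /sd /= n1 eqxx.
have sdb z s t : csphere Q z -> cball R s -> cball R t -> sd ((z, s), t) = b ((z, s), t).
  move=> zs sb tb; rewrite /sd /=; case: eqP => [->|_]; first by rewrite bc0.
  by case: eqP => [->|//]; rewrite bc1.
have sph (y : Q * R) : csphere (Q * R)%type y ->
    (csphere Q y.1 /\ cball R y.2) \/ (cball Q y.1 /\ y.2 = -1) \/ (cball Q y.1 /\ y.2
      = 1).
  case: y => z s /csphere_prod[|]; first by left.
  by case=> zb /csphereR[]; right; [left|right].
have cF (T : topologicalType) (f : Q * R -> P) (E : set (Q * R * R)) :
    {within cball Q `*` cball R, continuous f} ->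
    (forall y, E y -> cball Q y.1.1 /\ cball R y.2) ->
    {within E, continuous (fun y => f (y.1.1, y.2))}.
  move=> cf h; apply: (within_comp cf) => [|y /h//].
  by apply: continuous_subspaceT; cts.
have csd : {within csphere (Q * R)%type `*` cball R, continuous sd}.
  apply: (@continuous_subspaceW _ _ _ ((csphere Q `*` cball R `*` cball R) `|`
     ((cball Q `*` [set -1] `*` cball R) `|` (cball Q `*` [set 1] `*` cball R)))).
    by move=> [y t] [/sph[[? ?]|[[? ?]|[? ?]]] tb]; [left|right; left|right; right].
  apply: withinU_continuous.
  - by repeat apply: closed_setX;
    [exact: closed_csphere|exact: closed_cball|exact: closed_cball].
  - apply: closedU; repeat apply: closed_setX; try exact: closed_cball; exact: closed_eq.
  - by apply: within_eq cb => -[[z s] t] [[? ?] ?]; rewrite sdb.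
  apply: withinU_continuous.
  - by repeat apply: closed_setX; try exact: closed_cball; exact: closed_eq.
  - by repeat apply: closed_setX; try exact: closed_cball; exact: closed_eq.
  - apply: within_eq (cF P c0 _ cc0 _); first by move=> [[z s] t] [[/= _ ->]];
    rewrite sd0.
    by move=> [[z s] t] [[]].
  - apply: within_eq (cF P c1 _ cc1 _); first by move=> [[z s] t] [[/= _ ->]];
    rewrite sd1.
    by move=> [[z s] t] [[]].
have [|||||H [cH H0 Hb pH]] := @box_lift R P B p (Q * R)%type fp a sd G _ csd.
- by rewrite cball_prod.
- by rewrite cball_prod.
- move=> [z s] /sph[[/= zs sb]|[[/= zb ->]|[/= zb ->]]]; first by rewrite sdb // ba.
    by rewrite sd0 c0a.
  by rewrite sd1 c1a.
- by move=> [z s]; rewrite cball_prod => -[? ?]; rewrite pa.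
- move=> [z s] t /sph[[/= zs sb]|[[/= zb ->]|[/= zb ->]]] tb; first by rewrite sdb // pb.
    by rewrite sd0 pc0.
  by rewrite sd1 pc1.
rewrite cball_prod in cH.
exists H; split => //.
- by move=> z s zb sb; apply: H0; rewrite cball_prod.
- by move=> z s t zs sb tb; rewrite Hb ?sdb //; apply/csphere_prod; left.
- move=> z t zb tb; rewrite !Hb ?sd0 ?sd1 //; apply/csphere_prod; right; split => //;
    by apply/csphereR; auto.
- by move=> z s t zb sb tb; apply: pH => //; rewrite cball_prod.
Qed.

End box2.

Section kan.
Variables (R : realType) (P : topologicalType) (Q : normedModType R).

Lemma box_fill (a : Q -> P) (b : Q * R -> P) :
  {within cball Q, continuous a} ->
  {within csphere Q `*` cball R, continuous b} ->
  (forall z, csphere Q z -> b (z, -1) = a z) ->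
  exists H : Q * R -> P,
    [/\ {within cball Q `*` cball R, continuous H},
      forall z, cball Q z -> H (z, -1) = a z &
      forall z t, csphere Q z -> cball R t -> H (z, t) = b (z, t)].
Proof.
move=> ca cb ba.
have [|||H [? ? ? _]] := box_lift (@lifting_unit R P) ca cb _ ba (G := fun _ => 0 :
  'rV[R]_0) => //.
  by apply: continuous_subspaceT; cts.
by exists H.
Qed.

Lemma box_fill2 (a c0 c1 : Q * R -> P) (b : Q * R * R -> P) :
  {within cball Q `*` cball R, continuous a} ->
  {within csphere Q `*` cball R `*` cball R, continuous b} ->
  {within cball Q `*` cball R, continuous c0} ->
  {within cball Q `*` cball R, continuous c1} ->
  (forall z s, csphere Q z -> cball R s -> b ((z, s), -1) = a (z, s)) ->
  (forall z t, csphere Q z -> cball R t -> b ((z, -1), t) = c0 (z, t)) ->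
  (forall z t, csphere Q z -> cball R t -> b ((z, 1), t) = c1 (z, t)) ->
  (forall z, cball Q z -> c0 (z, -1) = a (z, -1)) ->
  (forall z, cball Q z -> c1 (z, -1) = a (z, 1)) ->
  exists H : Q * R * R -> P,
    [/\ {within cball Q `*` cball R `*` cball R, continuous H},
      forall z s, cball Q z -> cball R s -> H ((z, s), -1) = a (z, s),
      forall z s t, csphere Q z -> cball R s -> cball R t -> H ((z, s), t) = b ((z, s),
        t) &
      forall z t, cball Q z -> cball R t -> H ((z, -1), t) = c0 (z, t) /\ H ((z, 1), t)
        = c1 (z, t)].
Proof.
move=> ca cb cc0 cc1 h1 h2 h3 h4 h5.
have [|||||H [? ? ? ? _]] := box_lift2 (@lifting_unit R P) ca cb cc0 cc1 _ h1 h2 h3 h4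
  h5 (G := fun _ => 0 : 'rV[R]_0) => //.
  by apply: continuous_subspaceT; cts.
by exists H.
Qed.

End kan.

(** * Compression of disks along a k-equivalence *)

Lemma cballN (R : realType) (V : normedModType R) (v : V) : cball V v -> cball V (- v).
Proof. by rewrite /cball /= normrN. Qed.

Lemma cballZ (R : realType) (V : normedModType R) (v : V) (u : R) :
  cball V v -> 0 <= u <= 1 -> cball V (u *: v).
Proof.
rewrite /cball /= => h /andP[u0 u1]; rewrite normrZ ger0_norm //.
by rewrite mulr_ile1.
Qed.

Lemma conv_cball (R : realType) (s t : R) : -1 <= s <= 1 -> -1 <= t <= 1 ->
  -1 <= (1 - t) / 2 * s + (1 + t) / 2 <= 1.
Proof.
move=> /andP[s1 s2] /andP[t1 t2].
have h1 : 0 <= (1 - t) * (1 - s) by apply: mulr_ge0; lra.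
have h2 : 0 <= (1 - t) * (1 + s) by apply: mulr_ge0; lra.
nra.
Qed.

Section homotopy_groups.
Variables (R : realType) (E X : topologicalType) (f : E -> X).
Hypothesis cf : continuous f.

Definition sphere_surjective (V : normedModType R) :=
  forall (e0 : E) (g : V -> X), {within cball V, continuous g} ->
    (forall v, csphere V v -> g v = f e0) ->
  exists (c : V -> E) (L : V * R -> X),
    [/\ {within cball V, continuous c}, forall v, csphere V v -> c v = e0,
     {within cball V `*` cball R, continuous L},
     forall v, cball V v -> L (v, -1) = f (c v) /\ L (v, 1) = g v &
     forall v t, csphere V v -> cball R t -> L (v, t) = f e0].

(** Only triviality of the kernel is recorded. In dimension 0 the sphere is empty, and the free
    choice of [e0] makes this injectivity on path components. *)
Definition sphere_injective (V : normedModType R) :=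
  forall (e0 : E) (g : V -> E) (K : V * R -> X), {within cball V, continuous g} ->
    (forall v, csphere V v -> g v = e0) ->
    {within cball V `*` cball R, continuous K} ->
    (forall v, cball V v -> K (v, -1) = f (g v) /\ K (v, 1) = f e0) ->
    (forall v t, csphere V v -> cball R t -> K (v, t) = f e0) ->
  exists M : V * R -> E,
    [/\ {within cball V `*` cball R, continuous M},
     forall v, cball V v -> M (v, -1) = g v /\ M (v, 1) = e0 &
     forall v t, csphere V v -> cball R t -> M (v, t) = e0].

(* The contraction of the ball moves the difference of [h] and [f \o e] to a
   based sphere; surjectivity lifts it, and the boxes carry it back. *)
Lemma homotopy_correction (Q : normedModType R) (e : Q -> E) (h : Q -> X) :
  sphere_surjective Q ->
  {within cball Q, continuous e} -> {within cball Q, continuous h} ->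
  (forall z, csphere Q z -> h z = f (e z)) ->
  exists (e' : Q -> E) (K : Q * R -> X),
    [/\ {within cball Q, continuous e'}, forall z, csphere Q z -> e' z = e z,
     {within cball Q `*` cball R, continuous K},
     forall z, cball Q z -> K (z, -1) = f (e' z) /\ K (z, 1) = h z &
     forall z t, csphere Q z -> cball R t -> K (z, t) = h z].
Proof.
move=> surj ce ch he.
pose k (t : R) := (1 - t) / 2.
have kC : continuous k by rewrite /k; cts.
have kb z t : cball Q z -> cball R t -> cball Q (k t *: z).
  by move=> zb /cballR tb; apply: cballZ => //; rewrite /k; lra.
have k0 : k 1 = 0 by rewrite /k; lra.
have k1 : k (-1) = 1 by rewrite /k; lra.
have cfe (T : topologicalType) (D : set T) (u : T -> Q) : continuous u ->
    (forall y, D y -> cball Q (u y)) -> {within D, continuous (fun y => e (u y))}.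
  by move=> cu h'; apply: (within_comp ce) => //; exact: continuous_subspaceT.
have [||X1 [cX1 X1h X1s]] := @box_fill R X Q h (fun y => f (e (k y.2 *: y.1))) ch.
- apply: (@within_comp _ _ _ _ setT).
  + exact: continuous_subspaceT.
  + by apply: cfe; [cts|case=> z t [/= ? ?]; apply: kb; auto].
  + by [].
- by move=> z zs; rewrite /= k1 scale1r he.
have [|v vs|c [L [cc ce0 cL L1 Ls]]] := surj (e 0) (fun z => X1 (z, 1)).
- apply: (within_comp cX1); last by [].
  by apply: continuous_subspaceT; cts.
- by rewrite X1s // /= k0 scale0r.
have [||E1 [cE1 E1c E1s]] := @box_fill R E Q c (fun y => e (k (- y.2) *: y.1)) cc.
- by apply: cfe; [cts|case=> z t [/= ? ?]; apply: kb; auto; exact: cballN].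
- by move=> z zs; rewrite /= opprK k0 scale0r ce0.
have [||||||||H [cH Ha Hb Hc]] := @box_fill2 R X Q L (fun y => f (E1 y))
   (fun y => X1 (y.1, - y.2)) (fun y => f (e (k (- y.2) *: y.1.1))) cL.
- apply: (@within_comp _ _ _ _ setT).
  + exact: continuous_subspaceT.
  + by apply: cfe; [cts|case=> -[z s] t [[/= ? ?] ?]; apply: kb; auto; exact: cballN].
  + by [].
- apply: (@within_comp _ _ _ _ setT) => //.
  exact: continuous_subspaceT.
- apply: (within_comp cX1); first by apply: continuous_subspaceT; cts.
  by move=> [z t] [/= ? ?]; split => //=; exact: cballN.
- by move=> z s zs sb; rewrite /= opprK k0 scale0r Ls.
- by move=> z t zs tb; rewrite /= E1s.
- by move=> z t zs tb; rewrite /= X1s // ; exact: cballN.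
- by move=> z zb; rewrite E1c //; case: (L1 z zb).
- by move=> z zb; rewrite /= opprK; case: (L1 z zb).
exists (fun z => E1 (z, 1)), (fun y => H (y, 1)); split.
- by apply: (within_comp cE1); [apply: continuous_subspaceT; cts|].
- by move=> z zs; rewrite E1s //= k1 scale1r.
- by apply: (within_comp cH); [apply: continuous_subspaceT; cts|move=> y ?; split].
- by move=> z zb; have [-> ->] := Hc z 1 zb (cball1 _); rewrite X1h.
- by move=> z t zs tb; rewrite Hb //= k1 scale1r he.
Qed.

(** An extension [r] of [e] from the top and the sides over the box contracts that part of the
    sphere to the point [e0]. Moving the boundary of the bottom face along this contraction turns
    [e] on the bottom into a based sphere [A], and turns [h] into a nullhomotopy of its image in
    [X]. Injectivity gives a nullhomotopy [M] in [E], and a last box undoes the motion of the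
    boundary. The result is not compared with [h]; [homotopy_correction] takes care of that. *)
Lemma sphere_extension (V : normedModType R) (e : V * R -> E) (h : V * R -> X) :
  sphere_injective V ->
  {within csphere (V * R)%type, continuous e} ->
  {within cball (V * R)%type, continuous h} ->
  (forall z, csphere (V * R)%type z -> h z = f (e z)) ->
  exists e' : V * R -> E, {within cball (V * R)%type, continuous e'} /\
    forall z, csphere (V * R)%type z -> e' z = e z.
Proof.
move=> inj ce; rewrite cball_prod => ch he.
have sphV v t : csphere V v -> cball R t -> csphere (V * R)%type (v, t).
  by move=> ? ?; apply/csphere_prod; left.
have sph0 v : cball V v -> csphere (V * R)%type (v, -1).
  by move=> ?; apply/csphere_prod; right; split => //; apply/csphereR; left.
have sph1 v : cball V v -> csphere (V * R)%type (v, 1).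
  by move=> ?; apply/csphere_prod; right; split => //; apply/csphereR; right.
have [|||r' [cr' r'a r'b]] := @box_fill R E V (fun v => e (v, 1)) (fun y => e (y.1, -
  y.2)).
- by apply: (within_comp ce); [apply: continuous_subspaceT; cts|].
- apply: (within_comp ce); first by apply: continuous_subspaceT; cts.
  by move=> [v t] [/= ? ?]; apply: sphV => //; exact: cballN.
- by move=> v vs; rewrite /= opprK.
pose r (y : V * R) := r' (y.1, - y.2).
have r1 v : cball V v -> r (v, 1) = e (v, 1) by move=> vb; rewrite /r /= r'a.
have rs v t : csphere V v -> cball R t -> r (v, t) = e (v, t).
  by move=> vs tb; rewrite /r r'b //= ?opprK //; exact: cballN.
have cr : {within cball V `*` cball R, continuous r}.
  apply: (within_comp cr'); first by apply: continuous_subspaceT; cts.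
  by move=> [v t] [? ?]; split => //=; exact: cballN.
(* the segment from [y] to the centre of the top face *)
pose w (y : V * R) (t : R) : V * R := (((1 - t) / 2) *: y.1, (1 - t) / 2 * y.2 + (1 +
  t) / 2).
have wb y t : (cball V `*` cball R) y -> cball R t -> (cball V `*` cball R) (w y t).
  case: y => v s [/= vb /cballR sb] /cballR tb; split => /=.
    by apply: cballZ => //; lra.
  exact/cballR/conv_cball.
have a0 : (1 - -1) / 2 = 1 :> R by lra.
have a1 : (1 + -1) / 2 = 0 :> R by lra.
have a2 : (1 - 1) / 2 = 0 :> R by lra.
have a3 : (1 + 1) / 2 = 1 :> R by lra.
have w0 y : w y (-1) = y.
  case: y => v s; congr pair; first by rewrite /= a0 scale1r.
  by rewrite /= a0 a1 mul1r addr0.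
have w1 y : w y 1 = (0, 1).
  case: y => v s; congr pair; first by rewrite /= a2 scale0r.
  by rewrite /= a2 a3 mul0r add0r.
pose e0 := e (0, 1).
have cb0 : cball V 0 by rewrite /cball /= normr0.
have rw1 y : r (w y 1) = e0 by rewrite w1 r1.
have crw (T : topologicalType) (D : set T) (u : T -> V * R) (m : T -> R) :
    continuous u -> continuous m ->
    (forall y, D y -> (cball V `*` cball R) (u y) /\ cball R (m y)) ->
    {within D, continuous (fun y => r (w (u y) (m y)))}.
  move=> cu cm h'; apply: (within_comp cr); last by move=> y /h'[? ?]; exact: wb.
  by apply: continuous_subspaceT; rewrite /w; cts.
have cfw (T : topologicalType) (D : set T) (u : T -> E) : {within D, continuous u} ->
    {within D, continuous (fun y => f (u y))}.
  move=> cu; apply: (@within_comp _ _ _ _ setT) cu _ => //.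
  exact: continuous_subspaceT.
have [|||A [cA Aa As]] := @box_fill R E V (fun v => e (v, -1)) (fun y => r (w (y.1, -1)
  y.2)).
- by apply: (within_comp ce); [apply: continuous_subspaceT; cts|].
- by apply: crw; [cts|cts|case=> v t [/= ? ?]; split => //; split; auto].
- by move=> v vs; rewrite /= w0 rs.
have [||||||||H2 [cH2 H2a H2b H2c]] := @box_fill2 R X V h (fun y => f (A y))
   (fun y => f (r (w (y.1, 1) y.2))) (fun y => f (r (w y.1 y.2))) ch.
- by apply/cfw/crw; [cts|cts|case=> -[v s] t [[/= ? ?] ?]; split => //; split; auto].
- exact: cfw.
- by apply/cfw/crw; [cts|cts|case=> v t [/= ? ?]; split => //; split; auto].
- by move=> v s vs sb; rewrite /= w0 rs // he //; exact: sphV.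
- by move=> v t vs tb; rewrite /= As.
- by [].
- by move=> v vb; rewrite Aa // he //; exact: sph0.
- by move=> v vb; rewrite /= w0 r1 // he //; exact: sph1.
have [|||||M [cM M1 Ms]] := inj e0 (fun v => A (v, 1)) (fun y => H2 (y, 1)).
- by apply: (within_comp cA); [apply: continuous_subspaceT; cts|].
- by move=> v vs; rewrite As //= rw1.
- by apply: (within_comp cH2); [apply: continuous_subspaceT; cts|move=> y ?; split].
- by move=> v vb; have [-> ->] := H2c v 1 vb (cball1 _); rewrite /= rw1.
- by move=> v t vs tb; rewrite H2b //= rw1.
have [||||||||H3 [cH3 H3a H3b H3c]] := @box_fill2 R E V M (fun y => A (y.1, - y.2))
   (fun y => r (w (y.1, 1) (- y.2))) (fun y => r (w y.1 (- y.2))) cM.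
- by apply/crw; [cts|cts|case=> -[v s] t [[/= ? ?] ?]; split; [by split;
  auto|exact: cballN]].
- apply: (within_comp cA); first by apply: continuous_subspaceT; cts.
  by case=> v t [/= ? ?]; split => //; exact: cballN.
- by apply/crw; [cts|cts|case=> v t [/= ? ?]; split; [by split; auto|exact: cballN]].
- by move=> v s vs sb; rewrite /= opprK rw1 Ms.
- by move=> v t vs tb; rewrite /= As //; exact: cballN.
- by [].
- by move=> v vb; rewrite /= opprK; case: (M1 v vb).
- by move=> v vb; rewrite /= opprK rw1; case: (M1 v vb).
exists (fun y => H3 (y, 1)); split.
  by apply: (within_comp cH3); [apply: continuous_subspaceT; cts|move=> y ?; split].
move=> [v s] /csphere_prod[[vs sb]|[vb /csphereR[->|->]]].
- by rewrite H3b //= w0 rs.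
- by have [-> _] := H3c v 1 vb (cball1 _); rewrite Aa.
- by have [_ ->] := H3c v 1 vb (cball1 _); rewrite /= w0 r1.
Qed.

End homotopy_groups.

Section fibrewise.
Variables (R : realType) (B E X : topologicalType) (pE : E -> B) (pX : X -> B)
  (sX : B -> X) (f : E -> X).
Hypotheses (cpX : continuous pX) (csX : continuous sX) (cf : continuous f).
Hypotheses (lE : lifting R pE) (lX : lifting R pX).
Hypotheses (pXs : forall b, pX (sX b) = b) (pXf : forall e, pX (f e) = pE e).

(** For [Q] of dimension i this is the vanishing of the i-th relative homotopy of [f]: a ball in [X]
    with boundary in [E] moves into [E] relative to its boundary. The motion need not be
    vertical. *)
Definition compressible (Q : normedModType R) :=
  forall (e : Q -> E) (h : Q -> X),
  {within csphere Q, continuous e} -> {within cball Q, continuous h} ->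
  (forall z, csphere Q z -> h z = f (e z)) ->
  exists (e' : Q -> E) (K : Q * R -> X),
    [/\ {within cball Q, continuous e'}, forall z, csphere Q z -> e' z = e z,
     {within cball Q `*` cball R, continuous K},
     forall z, cball Q z -> K (z, -1) = f (e' z) /\ K (z, 1) = h z &
     forall z t, csphere Q z -> cball R t -> K (z, t) = h z].

Lemma within_postcomp (T U W : topologicalType) (D : set T) (g : U -> W) (u : T -> U) :
  continuous g -> {within D, continuous u} -> {within D, continuous (fun y => g (u y))}.
Proof.
move=> cg cu; apply: (@within_comp _ _ _ _ setT) cu _ => //.
exact: continuous_subspaceT.
Qed.

Lemma within_fst (T U W : topologicalType) (D : set T) (A : set U) (u : T -> W) :
  {within D, continuous u} -> {within D `*` A, continuous (fun y => u y.1)}.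
Proof.
move=> cu; apply: (within_comp cu); last by case=> y1 y2 [].
by apply: continuous_subspaceT; cts.
Qed.

(** The projection of [K] to [B] is lifted to [E] from [e'], which gives [Et]. The path that runs
    back along [f Et] and out again along [K] projects to a loop of the form c^-1 c. A box over
    [pX K] contracts this loop, and its top face is the vertical homotopy. *)
Lemma fibrewise_compression (Q : normedModType R) (e : Q -> E) (h : Q -> X) :
  compressible Q ->
  {within csphere Q, continuous e} -> {within cball Q, continuous h} ->
  (forall z, csphere Q z -> h z = f (e z)) ->
  exists (e' : Q -> E) (K : Q * R -> X),
    [/\ {within cball Q, continuous e'}, forall z, csphere Q z -> e' z = e z,
     {within cball Q `*` cball R, continuous K},
     forall z, cball Q z -> [/\ K (z, -1) = f (e' z), K (z, 1) = h z &
       pE (e' z) = pX (h z)] &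
     forall z t, cball Q z -> cball R t ->
       (csphere Q z -> K (z, t) = h z) /\ pX (K (z, t)) = pX (h z)].
Proof.
move=> comp ce ch he.
have [e' [K [ce' e'e cK K1 Ks]]] := comp e h ce ch he.
have [|||||Et [cEt Eta Etb pEt]] := @box_lift R E B pE Q lE e' (fun y => e y.1) (fun y
  => pX (K y)) ce'.
- exact: (within_fst ce).
- exact: within_postcomp.
- by move=> z zs; rewrite /= e'e.
- by move=> z zb; have [-> _] := K1 _ zb; rewrite pXf.
- by move=> z t zs tb; rewrite /= Ks // he // pXf.
have cfe' : {within cball Q, continuous (fun z => f (e' z))} by exact: within_postcomp.
have [||||||||||||||H [cH Ha Hb Hc pH]] := @box_lift2 R X B pX Q lX (fun y => f (e' y.1))
  (fun y => f (Et y)) K (fun y => h y.1.1) (fun y => pX (K (y.1.1, y.2))).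
- exact: (within_fst cfe').
- apply: (within_fst (within_fst _)); apply: continuous_subspaceW ch;
  exact: csphere_cball.
- exact: within_postcomp.
- by [].
- apply: within_postcomp => //; apply: (within_comp cK).
    by apply: continuous_subspaceT; cts.
  by case=> -[z s] t [[/= ? ?] ?].
- by move=> z s zs sb; rewrite /= e'e // he.
- by move=> z t zs tb; rewrite /= Etb // he.
- by move=> z t zs tb; rewrite /= Ks.
- by move=> z zb; rewrite Eta.
- by move=> z zb; case: (K1 _ zb).
- by move=> z s zb sb; rewrite /=; case: (K1 _ zb) => ->.
- by move=> z s t zs sb tb; rewrite /= Ks.
- by move=> z t zb tb; rewrite /= pXf pEt.
- by [].
exists (fun z => Et (z, 1)), (fun y => H (y, 1)); split.
- by apply: (within_comp cEt); [apply: continuous_subspaceT; cts|].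
- by move=> z zs; rewrite Etb.
- by apply: (within_comp cH); [apply: continuous_subspaceT; cts|move=> y ?; split].
- move=> z zb; have [-> ->] := Hc z 1 zb (cball1 _); split => //.
    by case: (K1 _ zb).
  by rewrite pEt //; case: (K1 _ zb) => _ ->.
- move=> z t zb tb; split; first by move=> zs; rewrite Hb.
  by rewrite pH //=; case: (K1 _ zb) => _ ->.
Qed.

(** The homotopy is extended from its end on the section, backwards in time. Its other end is a ball
    in [X] that equals [f e] on the sphere, and this ball is compressed into [E] by a vertical
    homotopy. The last box, whose base homotopy is constant, joins the two vertical homotopies into
    one without disturbing the values on the sphere. *)
Lemma path_lift_extension (Q : normedModType R) (q : Q -> B) (e : Q -> E) (H : Q * R ->
  X) :
  compressible Q ->
  {within cball Q, continuous q} -> {within csphere Q, continuous e} ->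
  {within csphere Q `*` cball R, continuous H} ->
  (forall z, csphere Q z -> [/\ pE (e z) = q z, H (z, -1) = f (e z) & H (z, 1) = sX (q
    z)]) ->
  (forall z t, csphere Q z -> cball R t -> pX (H (z, t)) = q z) ->
  exists (e' : Q -> E) (H' : Q * R -> X),
    [/\ {within cball Q, continuous e'}, {within cball Q `*` cball R, continuous H'},
     forall z, csphere Q z -> e' z = e z /\ (forall t, cball R t -> H' (z, t) = H (z, t)),
     forall z, cball Q z -> [/\ pE (e' z) = q z, H' (z, -1) = f (e' z) & H' (z, 1) = sX
       (q z)] &
     forall z t, cball Q z -> cball R t -> pX (H' (z, t)) = q z].
Proof.
move=> comp cq ce cH H1 pH.
have csq : {within cball Q, continuous (fun z => sX (q z))} by exact: within_postcomp.
have [|||||A [cA Aa Ab pA]] := @box_lift R X B pX Q lX (fun z => sX (q z))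
   (fun y => H (y.1, - y.2)) (fun y => q y.1) csq.
- apply: (within_comp cH); first by apply: continuous_subspaceT; cts.
  by case=> z t [/= ? ?]; split => //; exact: cballN.
- exact: (within_fst cq).
- by move=> z zs; rewrite /= opprK; case: (H1 _ zs).
- by [].
- by move=> z t zs tb; rewrite /= pH //; exact: cballN.
have cA1 : {within cball Q, continuous (fun z => A (z, 1))}.
  by apply: (within_comp cA); [apply: continuous_subspaceT; cts|].
have hA z : csphere Q z -> A (z, 1) = f (e z).
  by move=> zs; rewrite Ab //=; case: (H1 _ zs).
have [e' [K [ce' e'e cK K1 K2]]] := fibrewise_compression comp ce cA1 hA.
have [||||||||||||||H' [cH' Ha Hb Hc pH']] := @box_lift2 R X B pX Q lX (fun y => A
  (y.1, - y.2))
  (fun y => K (y.1, - y.2)) (fun y => sX (q y.1)) (fun y => H y.1) (fun y => q y.1.1).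
- apply: (within_comp cA); first by apply: continuous_subspaceT; cts.
  by case=> z t [/= ? ?]; split => //; exact: cballN.
- exact: (within_fst cH).
- apply: (within_comp cK); first by apply: continuous_subspaceT; cts.
  by case=> z t [/= ? ?]; split => //; exact: cballN.
- exact: (within_fst csq).
- exact: (within_fst (within_fst cq)).
- by move=> z s zs sb; rewrite /= Ab ?opprK //; exact: cballN.
- move=> z t zs tb; have tb' := cballN tb;
  rewrite /= (K2 z (- t) (csphere_cball zs) tb').1 // hA //.
  by case: (H1 _ zs).
- by move=> z t zs tb; case: (H1 _ zs).
- by move=> z zb; rewrite /= opprK; case: (K1 _ zb).
- by move=> z zb; rewrite /= Aa.
- by move=> z s zb sb; rewrite /= pA //; exact: cballN.
- by move=> z s t zs sb tb; rewrite /= pH.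
- by move=> z t zb tb; have tb' := cballN tb; rewrite /= (K2 z (- t) zb tb').2 pA.
- by [].
exists e', (fun y => H' (y, 1)); split => //.
- by apply: (within_comp cH'); [apply: continuous_subspaceT; cts|move=> y ?; split].
- by move=> z zs; rewrite e'e //; split => // t tb; rewrite Hb.
- move=> z zb; have [-> ->] := Hc z 1 zb (cball1 _); case: (K1 _ zb) => ? ? h;
  split => //.
  by rewrite h pA.
- by move=> z t zb tb; rewrite pH'.
Qed.

End fibrewise.

(** * The fibrewise homotopy fibre over the section *)

Definition clamp (R : realType) (t : R) : R := Num.max (-1) (Num.min 1 t).

Lemma clamp_cts (R : realType) : continuous (@clamp R).
Proof. by rewrite /clamp; cts. Qed.

Lemma clamp_cball (R : realType) (t : R) : cball R (clamp t).
Proof. by apply/cballR; rewrite /clamp; mm; lra. Qed.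

Lemma clamp_id (R : realType) (t : R) : cball R t -> clamp t = t.
Proof. by move=> /cballR; rewrite /clamp; mm; lra. Qed.

Lemma clamp_lo (R : realType) (t : R) : t <= -1 -> clamp t = -1.
Proof. by rewrite /clamp; mm; lra. Qed.

Lemma clamp_hi (R : realType) (t : R) : 1 <= t -> clamp t = 1.
Proof. by rewrite /clamp; mm; lra. Qed.

(** In [subspace D] the points outside [D] are isolated, so the values there are free. This and the
    next lemma turn partial data into total data on another space. *)
Lemma subspace_total (T U : topologicalType) (D : set T) (f : T -> U) (d : T -> U) :
  {within D, continuous f} ->
  continuous ((fun z => if `[< D z >] then f z else d z) : subspace D -> U).
Proof.
apply: within_eq => z Dz; rewrite asboolT //.
Qed.

Lemma subspace_prod_total (T U W : topologicalType) (D : set T) (f : T * W -> U) (d : T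
  -> U) :
  {within D `*` setT, continuous f} ->
  continuous ((fun y => if `[< D y.1 >] then f y else d y.1) : subspace D * W -> U).
Proof.
move=> cf [z t] O; rewrite /=.
have [Dz|nDz] := pselect (D z); [rewrite (asboolT Dz)|rewrite (asboolF nDz)] => nO;
  last first.
  have h : nbhs (z : subspace D) [set z].
    by case: (nbhs_subspaceP D z) => [/nDz|_] // y ->.
  exists ([set z], setT) => /=; first by split => //; exact: filterT.
  by move=> [z' t'] [/= -> _]; rewrite asboolF //; exact: nbhs_singleton.
move/subspace_continuousP : cf => /(_ (z, t) (conj Dz Logic.I) O nO).
rewrite /nbhs /= /within /= => -[[P1 P2] /= [n1 n2] k].
exists (P1 `&` D, P2) => /=.
  split => //; case: (nbhs_subspaceP D z) => // _.
  by rewrite /within /=; apply: filterS n1 => y h Dy; split.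
move=> [z' t'] [/= [h1 Dz'] h2]; rewrite asboolT //.
by have := k (z', t'); apply.
Qed.

Definition total_lifting (R : realType) (P B : topologicalType) (p : P -> B) :=
  forall (T : topologicalType) (s : T -> P) (G : T * R -> B) (m : T -> R),
  continuous s -> continuous G -> continuous m -> (forall z, 0 <= m z <= 1) ->
  (forall z, G (z, 0) = p (s z)) ->
  exists H : T -> P, [/\ continuous H, forall z, p (H z) = G (z, m z) &
    forall z, m z = 0 -> H z = s z].
Arguments total_lifting R {P B} p.

(** The total property is applied to the space [subspace D], with the constant homotopy and time 0
    outside [D]. Clamping the time makes the homotopy total in its second variable as well. *)
Lemma total_lifting_lifting (R : realType) (P B : topologicalType) (p : P -> B) :
  total_lifting R p -> lifting R p.
Proof.
move=> lp T D s G m cs cG cm mI G0.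
pose u (t : R) := Num.max 0 (Num.min 1 t).
have cu : continuous u by rewrite /u; cts.
have uI t : 0 <= u t <= 1 by rewrite /u; mm; lra.
have ui t : 0 <= t <= 1 -> u t = t by rewrite /u; mm; lra.
have cG' : {within D `*` setT, continuous (fun y => G (y.1, u y.2))}.
  apply: (within_comp cG); first by apply: continuous_subspaceT; cts.
  by move=> [z t] [? ?]; split => //=.
have [||H [cH pH Hs]] := lp (subspace D) s
  (fun y => if `[< D y.1 >] then G (y.1, u y.2) else p (s y.1))
  (fun z => if `[< D z >] then m z else 0) cs
  (@subspace_prod_total _ _ _ D _ (fun z => p (s z)) cG') (@subspace_total _ _ D _
    (fun=> 0) cm).
- by move=> z; case: asboolP => [/mI//|_]; rewrite lexx ler01.
- move=> z /=; case: asboolP => // Dz; rewrite ui ?lexx ?ler01 //; exact: G0.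
exists H; split => //.
- by move=> z Dz; rewrite pH /= asboolT // ui // mI.
- by move=> z Dz m0; apply: Hs; rewrite asboolT.
Qed.

Lemma curry_within (T W U : topologicalType) (D : set T) (f : T * W -> U) :
  {within D `*` setT, continuous f} ->
  {within D, continuous (curry f : T -> {compact-open, W -> U})}.
Proof.
move=> /subspace_continuousP cf; apply/subspace_continuousP => x Dx.
apply/compact_open_cvgP => K O /= cptK oO fKO.
rewrite /nbhs /= /within /=.
suff : \forall z \near x, D z -> forall v, K v -> O (f (z, v)).
  by apply: filterS => z h Dz _ [v Kv <-]; exact: h.
suff : \forall z \near x, K `<=` (fun v => D z -> O (f (z, v))).
  by apply: filterS => z h Dz v Kv; exact: h.
move/compact_near_coveringP/near_covering_withinP : cptK; apply.
move=> v Kv.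
have /= := cf (x, v) (conj Dx Logic.I) O.
have nO : nbhs (f (x, v)) O by apply: open_nbhs_nbhs; split => //; apply: fKO; exists v.
move=> /(_ nO); rewrite /nbhs /= /within /= => -[[P1 P2] /= [n1 n2] k].
exists (P2, P1) => //= -[v' x'] [/= h2 h1] Kv' Dx'.
by have := k (x', v'); apply.
Unshelve. all: by end_near. Qed.

Section path_space.
Variables (R : realType) (B E X : topologicalType) (pE : E -> B) (sE : B -> E)
  (pX : X -> B) (sX : B -> X) (f : E -> X).
Hypotheses (csE : continuous sE) (cpX : continuous pX) (csX : continuous sX)
  (cf : continuous f).
Hypotheses (lE : lifting R pE) (lX : lifting R pX).
Hypotheses (pEs : forall b, pE (sE b) = b) (pXs : forall b, pX (sX b) = b)
  (pXf : forall e, pX (f e) = pE e) (fsE : forall b, f (sE b) = sX b).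

(* The homotopy fibre of [f] over the section [sX], fibrewise over [B]; paths
   are parametrised by the whole line and constant outside [-1, 1]. *)
Definition path_space : set (E * {compact-open, R -> X}) :=
  [set y | [/\ continuous (y.2 : R -> X), forall t, pX (y.2 t) = pE y.1,
    forall t, t <= -1 -> y.2 t = f y.1 & forall t, 1 <= t -> y.2 t = sX (pE y.1)]].

Let Pt : topologicalType := set_type path_space.

Definition path_start (y : set_type path_space) : E := (set_val y).1.
Definition path_eval (y : set_type path_space) : R -> X := (set_val y).2.
Definition path_base (y : set_type path_space) : B := pE (path_start y).

Lemma path_startC : continuous (path_start : Pt -> E).
Proof.
have cv : continuous (set_val : Pt -> E * {compact-open, R -> X}).
  exact: initial_continuous.
by rewrite /path_start; cts.
Qed.

(** Evaluation is continuous for the compact-open topology because the line is locally compact and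
    regular. *)
Lemma path_evalC : continuous (fun y : Pt * R => path_eval y.1 y.2).
Proof.
have cv : continuous (set_val : Pt -> E * {compact-open, R -> X}).
  exact: initial_continuous.
have cm : continuous (path_eval : Pt -> {compact-open, R -> X}).
  by rewrite /path_eval; cts.
have h := @continuous_uncurry_regular Pt R X path_eval (@locally_compactR R) _ cm _.
have {}h : continuous (uncurry path_eval).
  apply: h; first exact: uniform_regular.
  by move=> u; have [] := set_valP u.
have -> : (fun y : Pt * R => path_eval y.1 y.2) = uncurry path_eval.
  by apply/funext => -[].
exact: h.
Qed.

Lemma path_evalP (y : Pt) : [/\ forall t, pX (path_eval y t) = path_base y,
  forall t, t <= -1 -> path_eval y t = f (path_start y) &
  forall t, 1 <= t -> path_eval y t = sX (path_base y)].
Proof. by have [] := set_valP y. Qed.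

Lemma path_ext (y y' : Pt) : path_start y = path_start y' ->
  (forall t, cball R t -> path_eval y t = path_eval y' t) -> y = y'.
Proof.
move=> e h; suff : set_val y = set_val y' by exact: val_inj.
rewrite [set_val y]surjective_pairing [set_val y']surjective_pairing; congr pair => //.
apply/funext => t; have [_ y1 y2] := path_evalP y; have [_ y1' y2'] := path_evalP y'.
have [tl|tl] := leP t (-1).
  by have := y1 _ tl; rewrite /path_eval => ->; have := y1' _ tl;
    rewrite /path_eval => ->; rewrite e.
have [tr|tr] := leP 1 t.
  by have := y2 _ tr; rewrite /path_eval => ->; have := y2' _ tr;
    rewrite /path_eval => ->; rewrite /path_base e.
by apply: h; apply/cballR; lra.
Qed.

Lemma const_path_subproof b : path_space (sE b, fun=> sX b).
Proof.
split => /=; first exact: ctsC.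
- by move=> t; rewrite pXs pEs.
- by move=> t _; rewrite fsE.
- by move=> t _; rewrite pEs.
Qed.

Definition const_path b : Pt := SigSub (mem_set (const_path_subproof b)).

Lemma path_mk (T : topologicalType) (D : set T) (e : T -> E) (H : T * R -> X) :
  {within D, continuous e} -> {within D `*` cball R, continuous H} ->
  (forall z, D z -> H (z, -1) = f (e z) /\ H (z, 1) = sX (pE (e z))) ->
  (forall z t, D z -> cball R t -> pX (H (z, t)) = pE (e z)) ->
  exists g : T -> Pt, {within D, continuous g} /\ forall z, D z ->
    path_start (g z) = e z /\ forall t, cball R t -> path_eval (g z) t = H (z, t).
Proof.
move=> ce cH H1 pH.
have cC := @clamp_cts R.
have cH' : {within D `*` setT, continuous (fun y => H (y.1, clamp y.2))}.
  apply: (within_comp cH); first by apply: continuous_subspaceT; cts.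
  by move=> [z t] [? ?]; split => //=; exact: clamp_cball.
have mem z : D z -> path_space (e z, fun t => H (z, clamp t)).
  move=> Dz; split => /=.
  - apply/continuous_subspace_setT; apply: (within_comp cH).
      by apply: continuous_subspaceT; cts.
    by move=> t _; split => //=; exact: clamp_cball.
  - by move=> t; rewrite pH //; exact: clamp_cball.
  - by move=> t /clamp_lo ->; case: (H1 _ Dz).
  - by move=> t /clamp_hi ->; case: (H1 _ Dz).
pose g z : Pt := if pselect (D z) is left Dz then SigSub (mem_set (mem z Dz))
  else const_path (pE (e z)).
have gE z : D z -> set_val (g z) = (e z, fun t => H (z, clamp t)).
  by move=> Dz; rewrite /g; case: pselect.
exists g; split.
  apply: (@continuous_comp_initial _ (subspace D) _ (@set_val _ path_space) g).
  apply: (@within_eq _ _ D (fun z => (e z, curry (fun y => H (y.1, clamp y.2)) z)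
     : E * {compact-open, R -> X})).
    by move=> z Dz; rewrite /= gE.
  apply: within_pair => //.
  exact: curry_within.
move=> z Dz; rewrite /path_start /path_eval gE //=; split => // t tb.
by rewrite clamp_id.
Qed.

Lemma const_pathC : continuous const_path.
Proof.
have [||||g [cg gE]] := @path_mk B setT sE (fun y => sX y.1).
- exact: continuous_subspaceT.
- by apply: continuous_subspaceT; cts.
- by move=> b _; rewrite fsE pEs.
- by move=> b t _ _; rewrite pXs pEs.
have -> : const_path = g.
  apply/funext => b; have [h1 h2] := gE b Logic.I.
  by apply: path_ext => [|t tb]; rewrite ?h1 ?h2.
exact/continuous_subspace_setT.
Qed.

(** The starting point is lifted along [G] in [E]. The new path is then the top of a box in [X] that
    has the old path as bottom and [f Et] and [sX G] as sides. The height [m z] of this box varies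
    with the parameter [z], so the projection of [box_lift] is redone in adapted coordinates. *)
Lemma path_base_lifting : lifting R path_base.
Proof.
apply: total_lifting_lifting => T s G m cs cG cm mI G0.
have cS := path_startC; have cM := path_evalC.
pose e z := path_start (s z).
have ce : continuous e by rewrite /e; cts.
pose gam (y : T * R) := path_eval (s y.1) y.2.
have cgam : continuous gam.
  by apply: (@ctscomp _ _ _ (fun y : Pt * R => path_eval y.1 y.2) (fun y => (s y.1,
    y.2))); cts.
have gamP z := path_evalP (s z).
pose m' (y : T * R) := Num.min (m y.1) (Num.max 0 y.2).
have [|||||Et [cEt pEt Et0]] := @lE (T * R)%type setT (fun y => e y.1)
  (fun y => G (y.1.1, y.2)) m'.
- by apply: continuous_subspaceT; cts.
- by apply: continuous_subspaceT; cts.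
- by apply: continuous_subspaceT; rewrite /m'; cts.
- by move=> [z t] _; have := mI z; rewrite /m' /=; mm; lra.
- by move=> [z t] _; rewrite /= G0.
have {}cEt : continuous Et by apply/continuous_subspace_setT.
(* The top point (t, m z) is projected from (0, m z + 1): at parameter [u] the ray is at (t / u,
   [tau]), and it meets the bottom at [u = c z] and a side at [u] equal to the absolute value of t.
   Where [m z = 0], [c z] is 1 and nothing moves. *)
pose c z := (1 + m z)^-1.
have m0 z : 1 + m z != 0 by apply: lt0r_neq0; have := mI z; lra.
have cc : continuous c by rewrite /c; cts.
have cI z : [/\ 2^-1 <= c z, c z <= 1 & c z * (1 + m z) = 1].
  have h : c z * (1 + m z) = 1 by rewrite /c mulVf.
  by have := mI z; split => //; nra.
pose lam (y : T * R) := Num.max `|y.2| (c y.1).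
have clam : continuous lam by rewrite /lam; cts.
pose tau (y : T * R) (u : R) := m y.1 + 1 - u^-1.
have lam0 y : 2^-1 <= lam y by have [] := cI y.1; rewrite /lam; mm; lra.
have lamn y : lam y != 0 by apply: lt0r_neq0; have := lam0 y; lra.
pose D := [set: T] `*` cball R.
have lam1 y : D y -> lam y <= 1.
  by case: y => z t [_ /=]; rewrite /cball /=; have [] := cI z; rewrite /lam /=; mm; lra.
have tauI y u : lam y <= u <= 1 -> 0 <= tau y u <= m y.1.
  move=> /andP[h1 h2]; have [c1 c2 c3] := cI y.1; have := lam0 y => h0.
  have h3 : c y.1 <= lam y by rewrite /lam; mm; lra.
  have u0 : 0 < u by lra.
  have hu : u * u^-1 = 1 by rewrite divff // lt0r_neq0.
  have ui0 : 0 < u^-1 by rewrite invr_gt0.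
  have := mI y.1; rewrite /tau; set w := u^-1 in hu ui0 *; nra.
pose C0 := [set y : T * R | `|y.2| <= c y.1].
pose C1 := [set y : T * R | c y.1 <= y.2].
pose C2 := [set y : T * R | c y.1 <= - y.2].
have cC0 : closed C0 by apply: closed_le_fun; cts.
have cC1 : closed C1 by apply: closed_le_fun; cts.
have cC2 : closed C2 by apply: closed_le_fun; cts.
have lC0 y : C0 y -> lam y = c y.1 by rewrite /C0 /lam /=; mm; lra.
have lC1 y : C1 y -> lam y = y.2.
  rewrite /C1 /lam /= => h; have [c1 _ _] := cI y.1; rewrite ger0_norm; last lra.
  by mm; lra.
have lC2 y : C2 y -> lam y = - y.2.
  rewrite /C2 /lam /= => h; have [c1 _ _] := cI y.1; rewrite ler0_norm; last lra.
  by mm; lra.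
have tC0 y : C0 y -> tau y (lam y) = 0.
  by move=> /lC0 h; rewrite /tau h /c invrK [m _ + 1]addrC subrr.
pose st y := if `[< C0 y >] then gam (y.1, y.2 / lam y) else
  if `[< C1 y >] then sX (G (y.1, tau y (lam y))) else f (Et (y.1, tau y (lam y))).
have EtG z t : 0 <= t <= m z -> pE (Et (z, t)) = G (z, t).
  move=> tI; rewrite pEt // /=; congr (G (z, _)); rewrite /m' /=; mm; lra.
have stC1 y : C1 y -> st y = sX (G (y.1, tau y (lam y))).
  move=> h; rewrite /st (asboolT h); case: asboolP => // h0.
  rewrite tC0 // G0 lC1 // divff; last by rewrite -(lC1 _ h).
  by have [_ _ /(_ 1 (lexx _))] := gamP y.1.
have stC2 y : C2 y -> st y = f (Et (y.1, tau y (lam y))).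
  move=> h; rewrite /st; case: asboolP => h0.
    rewrite tC0 // Et0 //; last by rewrite /m' /=; have := mI y.1; mm; lra.
    have -> : y.2 / lam y = -1.
      by rewrite -[y.2]opprK -lC2 // mulNr divff.
    by have [_ /(_ (-1) (lexx _)) + _] := gamP y.1.
  case: asboolP => // h1; exfalso; have [c1 _ _] := cI y.1; move: h h1;
    rewrite /C1 /C2 /=; lra.
have ctau : continuous (fun y => tau y (lam y)) by rewrite /tau; cts.
have cst : continuous st.
  apply/continuous_subspace_setT.
  have -> : [set: T * R] = C0 `|` (C1 `|` C2).
    apply/seteqP; split => // y _; rewrite /C0 /C1 /C2 /setU /=.
    have [h'|h'] := leP `|y.2| (c y.1); first by left.
    by right; case: (ger0P y.2) h' => h h'; [left|right]; lra.
  apply: withinU_continuous => //; first exact: closedU.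
    apply: (@within_eq (T * R)%type X C0 (fun y => gam (y.1, y.2 / lam y))).
      by move=> y h; rewrite /st asboolT.
    by apply: continuous_subspaceT; cts.
  apply: withinU_continuous => //.
    apply: (@within_eq (T * R)%type X C1 (fun y => sX (G (y.1, tau y (lam y)))));
      first by move=> y /stC1.
    by apply: continuous_subspaceT; cts.
  apply: (@within_eq (T * R)%type X C2 (fun y => f (Et (y.1, tau y (lam y)))));
    first by move=> y /stC2.
  by apply: continuous_subspaceT; cts.
have pst y : D y -> pX (st y) = G (y.1, tau y (lam y)).
  move=> Dy; have tI : 0 <= tau y (lam y) <= m y.1 by apply: tauI; rewrite lexx lam1.
  rewrite /st; case: asboolP => h0.
    by rewrite tC0 // G0; have [-> _ _] := gamP y.1.
  by case: asboolP => _; rewrite ?pXs // pXf EtG.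
pose u (y : T * R * R) := Num.max 2^-1 (Num.min 1 (lam y.1 + y.2)).
have un y : u y != 0 by apply: lt0r_neq0; rewrite /u; mm; lra.
have cu : continuous u by rewrite /u; cts.
have [|||||H [cH pH H0]] := @lX (T * R)%type D st
  (fun y => G (y.1.1, tau y.1 (u y))) (fun y => 1 - lam y).
- exact: continuous_subspaceT.
- by apply: continuous_subspaceT; rewrite /tau; cts.
- by apply: continuous_subspaceT; cts.
- by move=> y Dy; have := lam0 y; have := lam1 y Dy; lra.
- move=> y Dy; rewrite pst //=; congr (G (_, tau _ _)).
  by have := lam0 y; have := lam1 y Dy; rewrite /u /= addr0; mm; lra.
have u1 y : D y -> u (y, 1 - lam y) = 1.
  by move=> Dy; rewrite /u /=; mm; lra.
have tau1 y : tau y 1 = m y.1 by rewrite /tau invr1 addrK.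
pose e' z := Et (z, m z).
have e'G z : pE (e' z) = G (z, m z).
  by rewrite EtG // lexx andbT; have /andP[] := mI z.
have ce' : continuous e' by rewrite /e'; cts.
have [||g [cg gE]] := @path_mk T setT e' H (continuous_subspaceT ce') cH.
- move=> z _; have [c1 c2 c3] := cI z.
  have l1 : lam (z, 1) = 1 by rewrite /lam /= normr1; mm; lra.
  have l2 : lam (z, -1) = 1 by rewrite /lam /= normrN normr1; mm; lra.
  rewrite !H0 ?l1 ?l2 ?subrr //.
  rewrite stC2; last by rewrite /C2 /= opprK.
  by rewrite stC1 // l1 l2 !tau1 /= e'G.
- by move=> z t _ tb; rewrite pH // u1 // tau1 e'G.
exists g; split.
- exact/continuous_subspace_setT.
- by move=> z; have [h _] := gE z Logic.I; rewrite /path_base h e'G.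
- move=> z mz; have [h1 h2] := gE z Logic.I.
  apply: path_ext => [|t tb].
    by rewrite h1 /e' mz Et0 // /m' /= mz; mm; lra.
  rewrite h2 //; have c1 : c z = 1 by rewrite /c mz addr0 invr1.
  have l1 : lam (z, t) = 1 by move: tb; rewrite /cball /lam /= c1; mm; lra.
  by rewrite H0 ?l1 ?subrr // /st asboolT /gam /= ?l1 ?divr1 // /C0 /= c1.
Qed.

Lemma path_space_extension (Q : normedModType R) (q : Q -> B) (g : Q -> Pt) :
  compressible f Q ->
  {within cball Q, continuous q} -> {within csphere Q, continuous g} ->
  (forall z, csphere Q z -> path_base (g z) = q z) ->
  exists g' : Q -> Pt, [/\ {within cball Q, continuous g'},
    forall z, csphere Q z -> g' z = g z & forall z, cball Q z -> path_base (g' z) = q z].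
Proof.
move=> comp cq cg gq.
have cS := path_startC; have cM := path_evalC.
have [||||e' [H' [ce' cH' h1 h2 h3]]] := @path_lift_extension R B E X pE pX sX f
   cpX csX cf lE lX pXs pXf Q q (fun z => path_start (g z))
   (fun y => path_eval (g y.1) y.2) comp cq.
- exact: within_postcomp.
- apply: (@within_comp _ _ _ _ setT (fun y : Pt * R => path_eval y.1 y.2)
    (fun y => (g y.1, y.2))) => //; first exact: continuous_subspaceT.
  apply: within_pair; first exact: (within_fst cg).
  by apply: continuous_subspaceT; cts.
- move=> z zs; have [_ y1 y2] := path_evalP (g z); split => /=.
  + exact: gq.
  + exact: y1.
  + by rewrite y2 // gq.
- by move=> z t zs tb /=; have [-> _ _] := path_evalP (g z); exact: gq.
have [||g' [cg' g'E]] := @path_mk _ (cball Q) e' H' ce' cH'.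
- by move=> z zb; have [-> -> ->] := h2 z zb.
- by move=> z t zb tb; have [-> _ _] := h2 z zb; exact: h3.
exists g'; split => //.
- move=> z zs; have [k1 k2] := g'E z (csphere_cball zs); have [k3 k4] := h1 z zs.
  by apply: path_ext => [|t tb]; rewrite ?k1 ?k2 ?k4.
- by move=> z zb; rewrite /path_base; have [-> _] := g'E z zb; have [] := h2 z zb.
Qed.

End path_space.

(** * Lifts over the skeleton of a cubical grid *)

Section row_vectors.
Context {R : realType}.

Lemma rV_norm_le n (v : 'rV[R]_n) (c : R) : 0 <= c ->
  (`|v| <= c) <-> (forall i, `|v ord0 i| <= c).
Proof.
move=> c0; rewrite [`|v|]mx_normrE; split.
  move=> /bigmax_leP[_ h] i; exact: (h (ord0, i)).
by move=> h; apply/bigmax_leP; split => // -[a i] _ /=; rewrite ord1.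
Qed.

Lemma rV_coord_le n (v : 'rV[R]_n) i : `|v ord0 i| <= `|v|.
Proof. by have [h _] := rV_norm_le v (normr_ge0 v); apply: h. Qed.

Lemma rV_norm_attained n (v : 'rV[R]_n) : 0 < `|v| -> exists i, `|v ord0 i| = `|v|.
Proof.
move=> v0; have : `|v| != 0 by rewrite lt0r_neq0.
by move=> /mx_norm_neq0 [[a i]] /=; rewrite ord1 => h; exists i; rewrite -h.
Qed.

Lemma cts_rV (T : topologicalType) n (f : T -> 'rV[R]_n) :
  (forall i, continuous (fun x => f x ord0 i)) -> continuous f.
Proof.
move=> h x A [P PA /= k].
suff : \forall y \near x, forall i, P ord0 i (f y ord0 i).
  by apply: filterS => y hy; have := k (f y); apply => a i; rewrite ord1; exact: hy.
apply: filter_forall => i; exact: (h i x (P ord0 i) (PA ord0 i)).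
Qed.

Lemma cts_coord (T : topologicalType) n (f : T -> 'rV[R]_n) i :
  continuous f -> continuous (fun x => f x ord0 i).
Proof. by move=> cf; apply: (@ctscomp _ _ _ (fun v : 'rV[R]_n => v ord0 i) f) => //;
  exact: coord_continuous. Qed.

Lemma cts_sum (T : topologicalType) (I : Type) (r : seq I) (F : I -> T -> R) :
  (forall i, continuous (F i)) -> continuous (fun x => \sum_(i <- r) F i x).
Proof.
move=> h; elim: r => [|i r IH].
  have -> : (fun x => \sum_(i <- [::]) F i x) = (fun=> 0).
    by apply/funext => x; rewrite big_nil.
  by cts.
have -> : (fun x => \sum_(j <- i :: r) F j x) = (fun x => F i x + \sum_(j <- r) F j x).
  by apply/funext => x; rewrite big_cons.
exact: ctsD.
Qed.

End row_vectors.

(** The fibrewise form of the vanishing of the homotopy of the fibres in degree i - 1. For [i = 0]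
    the sphere is empty and the condition provides a point over each point of [B]. *)
Definition sphere_extensible (R : realType) (P B : topologicalType) (p : P -> B) (i :
  nat) :=
  forall (q : 'rV[R]_i -> B) (g : 'rV[R]_i -> P),
  {within cball _, continuous q} -> {within csphere _, continuous g} ->
  (forall z, csphere _ z -> p (g z) = q z) ->
  exists g' : 'rV[R]_i -> P, [/\ {within cball _, continuous g'},
    forall z, csphere _ z -> g' z = g z & forall z, cball _ z -> p (g' z) = q z].
Arguments sphere_extensible R {P B} p i.

Section grid.
Variables (R : realType) (d M : nat).
(* [c i = 2r] stands for the point r and [c i = 2r+1] for the interval [r, r+1] *)
Notation face := {ffun 'I_d -> 'I_(M.*2.+1)}.
Implicit Types (c : face) (y : 'rV[R]_d).

Definition lo c i : R := ((c i)./2)%:R.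
Definition hi c i : R := (uphalf (c i))%:R.
Definition fcell c : set 'rV[R]_d := [set y | forall i, lo c i <= y ord0 i <= hi c i].
Definition foddset c : {set 'I_d} := finset (fun i => odd (c i)).
Definition fdim c := #|foddset c|.
Definition fbd c : set 'rV[R]_d :=
  [set y | fcell c y /\ exists2 i, odd (c i) & y ord0 i = lo c i \/ y ord0 i = hi c i].
Definition gcube : set 'rV[R]_d := [set y | forall i, 0 <= y ord0 i <= M%:R].

Lemma hi_odd c i : odd (c i) -> hi c i = lo c i + 1.
Proof. by move=> o; rewrite /hi /lo uphalf_half o add1n -natr1. Qed.
Lemma hi_even c i : ~~ odd (c i) -> hi c i = lo c i.
Proof. by move=> o; rewrite /hi /lo uphalf_half (negbTE o). Qed.

Lemma fcell_gcube c : fcell c `<=` gcube.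
Proof.
move=> y h i; have /andP[h1 h2] := h i; apply/andP; split.
  by apply: le_trans h1; rewrite ler0n.
apply: le_trans h2 _; rewrite ler_nat uphalf_half.
have := ltn_ord (c i); rewrite ltnS => h3.
rewrite -leq_double doubleD -mul2n.
have := odd_double_half (c i); case: (odd _) => /= e;
  last by rewrite mul2n -[X in (_ <= X)%N]addn0; lia.
have : (c i != M.*2 :> nat).
  by apply/eqP => e'; move: e; rewrite e' doubleK; lia.
by move=> ne; lia.
Qed.

Lemma closed_fcell c : closed (fcell c).
Proof.
rewrite [X in closed X](_ : _ = \bigcap_i [set y : 'rV[R]_d | lo c i <= y ord0 i] `&`
   \bigcap_i [set y : 'rV[R]_d | y ord0 i <= hi c i]); last first.
  apply/seteqP; split => y /=.
    by move=> h; split => i _; have /andP[] := h i.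
  by case=> h1 h2 i; apply/andP; split; [exact: h1|exact: h2].
by apply: closedI; apply: closed_bigI => i _; apply: closed_le_fun;
  [exact: ctsC|exact/cts_coord/ctsid|exact/cts_coord/ctsid|exact: ctsC].
Qed.

Lemma fbd_face c y : fbd c y ->
  exists c', [/\ (fdim c' < fdim c)%N, fcell c' y & fcell c' `<=` fcell c].
Proof.
case=> cy [i oi yi].
have hM : (uphalf (c i) <= M)%N.
  have := ltn_ord (c i); rewrite ltnS => h3.
  rewrite uphalf_half oi.
  have := odd_double_half (c i); rewrite oi; lia.
have [j jE jy] : exists2 j : nat, (j <= M)%N & y ord0 i = j%:R.
  by case: yi => ->; [exists (c i)./2 => //; have := odd_double_half (c i);
    rewrite oi uphalf_half oi in hM *; lia|exists (uphalf (c i))].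
have jM : (j.*2 < M.*2.+1)%N by rewrite ltnS leq_double.
exists [ffun l => if l == i then Ordinal jM else c l]; split.
- apply: proper_card; apply/properP; split.
    apply/fintype.subsetP => l; rewrite !inE ffunE; case: eqP => //= _.
    by rewrite odd_double.
  by exists i; rewrite !inE ?ffunE ?eqxx //= odd_double.
- move=> l; rewrite /lo /hi ffunE; case: eqP => [->|_] /=; last exact: cy.
  by rewrite uphalf_double doubleK jy lexx.
- move=> z h l; have := h l; rewrite {1}/lo {1}/hi ffunE; case: eqP => [->|_] //=.
  by rewrite uphalf_double doubleK -jy => e; have := cy i; lra.
Qed.

(** Off [fbd c] the odd coordinates of [y] lie strictly between consecutive integers, which forces
    [c'] to agree with [c] there. The bound on dimensions leaves no further odd coordinate to [c'],
    and the even ones are then read off from [y]. *)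
Lemma fcell_inter c c' y : (fdim c' <= fdim c)%N -> c != c' ->
  fcell c y -> fcell c' y -> fbd c y.
Proof.
move=> dim ne cy c'y; split => //; apply: contrapT => nb.
have int (a b : nat) : a%:R < b.+1%:R :> R -> (a <= b)%N by rewrite ltr_nat ltnS.
have oddE i : odd (c i) -> c' i = c i.
  move=> oi.
  have /andP[l1 l2] := cy i; have /andP[l1' l2'] := c'y i.
  have h1 : lo c i < y ord0 i.
    by rewrite lt_neqAle l1 andbT; apply/eqP => e; apply: nb; exists i => //; left.
  have h2 : y ord0 i < hi c i.
    by rewrite lt_neqAle l2 andbT; apply/eqP => e; apply: nb; exists i => //; right.
  have k1 : ((c' i)./2 < uphalf (c i))%N by rewrite -(ltr_nat R);
    exact: le_lt_trans l1' h2.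
  have k2 : ((c i)./2 < uphalf (c' i))%N by rewrite -(ltr_nat R);
    exact: lt_le_trans h1 l2'.
  apply: val_inj => /=.
  have e1 := odd_double_half (c i); have e2 := odd_double_half (c' i).
  move: k1 k2; rewrite !uphalf_half oi in e1 *; case: (odd (c' i)) e2 => /= e2 k1 k2; lia.
have sub : foddset c \subset foddset c'.
  by apply/fintype.subsetP => i; rewrite !inE => oi; rewrite oddE.
have /eqP se : foddset c == foddset c' by rewrite eqEcard sub.
case/eqP: ne; apply/ffunP => i; case oi : (odd (c i)); first by rewrite oddE.
have oi' : odd (c' i) = false.
  have : (i \in foddset c) = (i \in foddset c') by rewrite se.
  by rewrite !inE oi.
have /andP[l1 l2] := cy i; have /andP[l1' l2'] := c'y i.
rewrite hi_even ?oi // in l2; rewrite hi_even ?oi' // in l2'.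
have k : lo c i = lo c' i by lra.
move/eqP : k; rewrite /lo eqr_nat => /eqP k.
apply: val_inj => /=; rewrite -(odd_double_half (c i)) -(odd_double_half (c' i)).
by rewrite oi oi' k.
Qed.

Section face_chart.
Variable c : face.
Notation n := #|foddset c|.

Definition fchart (u : 'rV[R]_n) : 'rV[R]_d :=
  \row_i (lo c i + \sum_(l < n) (if enum_val l == i then (1 + u ord0 l) / 2 else 0)).
Definition fcoord (y : 'rV[R]_d) : 'rV[R]_n :=
  \row_l (2 * (y ord0 (enum_val l) - lo c (enum_val l)) - 1).

Lemma fchartC : continuous fchart.
Proof.
apply: cts_rV => i.
have -> : (fun x : 'rV[R]_n => fchart x ord0 i) = (fun x => lo c i + \sum_(l < n) (if
  enum_val l == i then (1 + x ord0 l) / 2 else 0)).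
  by apply/funext => x; rewrite mxE.
apply: ctsD; first exact: ctsC.
apply: cts_sum => l; case: (enum_val l == i); last exact: ctsC.
have h : continuous (fun x : 'rV[R]_n => x ord0 l) by exact/cts_coord/ctsid.
by cts.
Qed.

Lemma fcoordC : continuous fcoord.
Proof.
apply: cts_rV => l.
have -> : (fun y : 'rV[R]_d => fcoord y ord0 l) = (fun y => 2 * (y ord0 (enum_val l) -
  lo c (enum_val l)) - 1).
  by apply/funext => x; rewrite mxE.
have h : continuous (fun x : 'rV[R]_d => x ord0 (enum_val l)) by exact/cts_coord/ctsid.
by cts.
Qed.

Lemma fchart_odd u l : fchart u ord0 (enum_val l) = lo c (enum_val l) + (1 + u ord0 l)
  / 2.
Proof.
rewrite mxE; congr (_ + _); rewrite (bigD1 l) //= eqxx big1 ?addr0 // => j jl.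
by rewrite (inj_eq enum_val_inj) (negbTE jl).
Qed.

Lemma fchart_even u i : ~~ odd (c i) -> fchart u ord0 i = lo c i.
Proof.
move=> oi; rewrite mxE big1 ?addr0 // => l _; case: eqP => // e.
by have := enum_valP l; rewrite e inE (negbTE oi).
Qed.

Lemma odd_enum_val i : odd (c i) -> exists l : 'I_n, i = enum_val l.
Proof.
move=> oi; have ic : i \in foddset c by rewrite inE.
by exists (enum_rank_in ic i); rewrite enum_rankK_in.
Qed.

Lemma enum_val_odd (l : 'I_n) : odd (c (enum_val l)).
Proof. by have := enum_valP l; rewrite inE. Qed.

Lemma fcoordK y : fcell c y -> fchart (fcoord y) = y.
Proof.
move=> cy; apply/rowP => i; case oi : (odd (c i)).
  have [l ->] := odd_enum_val oi; rewrite fchart_odd mxE.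
  by rewrite (_ : ord0 = 0) //; lra.
rewrite fchart_even ?oi //; have := cy i; rewrite hi_even ?oi // => /andP[? ?].
by apply/eqP; rewrite eq_le; apply/andP; split.
Qed.

Lemma fchart_cell u : cball _ u -> fcell c (fchart u).
Proof.
move=> ub i; case oi : (odd (c i));
  last by rewrite fchart_even ?oi // hi_even ?oi // lexx.
have [l ->] := odd_enum_val oi; rewrite fchart_odd hi_odd ?enum_val_odd //.
have := le_trans (rV_coord_le u l) ub; rewrite ler_norml; lra.
Qed.

Lemma fchart_bd u : csphere _ u -> fbd c (fchart u).
Proof.
move=> us; split; first exact/fchart_cell/csphere_cball.
have [|l] := @rV_norm_attained _ _ u; first by rewrite us.
rewrite us => /csphereR h; exists (enum_val l); first exact: enum_val_odd.
rewrite fchart_odd hi_odd ?enum_val_odd //.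
by case: h => ->; [left|right]; lra.
Qed.

Lemma fcoord_ball y : fcell c y -> cball _ (fcoord y).
Proof.
move=> cy; apply/rV_norm_le; first exact: ler01.
move=> l; have := cy (enum_val l); rewrite hi_odd ?enum_val_odd // => /andP[h1 h2].
by rewrite mxE ler_norml; lra.
Qed.

Lemma fcoord_sphere y : fbd c y -> csphere _ (fcoord y).
Proof.
case=> cy [i oi yi]; apply/eqP; rewrite eq_le fcoord_ball //=.
have [l e] := odd_enum_val oi.
apply: le_trans (rV_coord_le _ l); rewrite mxE -e.
rewrite hi_odd // in yi; case: yi => ->.
  by rewrite subrr mulr0 sub0r normrN normr1.
have -> : 2 * (lo c i + 1 - lo c i) - 1 = 1 :> R by lra.
by rewrite normr1.
Qed.
End face_chart.

Variables (P B : topologicalType) (p : P -> B) (k : nat) (q : 'rV[R]_d -> B)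
  (O : set 'rV[R]_d) (G : 'rV[R]_d -> P) (S0 : 'rV[R]_d -> P).
Hypothesis ext : forall i, (i <= k)%N -> sphere_extensible R p i.
Hypotheses (cq : {within gcube, continuous q}) (cG : {within gcube `&` O, continuous G})
  (pG : forall y, gcube y -> O y -> p (G y) = q y).

Lemma skeleton_lift (r : nat) : (r <= k.+1)%N ->
  exists S : 'rV[R]_d -> P, forall c, (fdim c < r)%N ->
    [/\ {within fcell c, continuous S}, forall y, fcell c y -> p (S y) = q y &
      fcell c `<=` O -> forall y, fcell c y -> S y = G y].
Proof.
elim: r => [_|r IH rk]; first by exists S0.
have [S HS] := IH (ltnW rk).
have cS : {within [set y | exists2 c, (fdim c < r)%N & fcell c y], continuous S}.
  apply: within_bigcup_closed => [c|c cr]; first exact: closed_fcell.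
  by have [] := HS _ cr.
have step c : exists Sc : 'rV[R]_d -> P, fdim c = r ->
    [/\ {within fcell c, continuous Sc}, forall y, fcell c y -> p (Sc y) = q y,
      fcell c `<=` O -> forall y, fcell c y -> Sc y = G y &
      forall y, fbd c y -> Sc y = S y].
  have [cr|] := pselect (fdim c = r); last by exists S.
  have bdr y : fbd c y -> exists2 c', (fdim c' < r)%N & fcell c' y.
    by rewrite -cr => /fbd_face[c' [? ? _]]; exists c'.
  (* A face inside [O] receives [G]. Its boundary faces lie in [O] too, so [S] is already [G] on
     them. *)
  have [cO|ncO] := pselect (fcell c `<=` O).
    exists G => _; split => //.
    - by apply: continuous_subspaceW cG => y cy; split; [exact: fcell_gcube cy|exact: cO].
    - by move=> y cy; apply: pG; [exact: fcell_gcube cy|exact: cO].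
    - move=> y /fbd_face[c' [c'r c'y c'c]]; rewrite cr in c'r.
      by have [_ _ h] := HS _ c'r; rewrite h // => z /c'c /cO.
  have ck : (#|foddset c| <= k)%N by rewrite -/(fdim c) cr.
  have [|||g [cg gS pg]] := ext ck (q := q \o @fchart c) (g := S \o @fchart c).
  - apply: (within_comp cq); first exact/continuous_subspaceT/fchartC.
    by move=> u /fchart_cell; exact: fcell_gcube.
  - apply: (within_comp cS); first exact/continuous_subspaceT/fchartC.
    by move=> u /fchart_bd /bdr.
  - move=> u /fchart_bd /bdr[c' c'r c'y]; have [_ h _] := HS _ c'r.
    exact: h.
  exists (g \o @fcoord c) => _; split.
  - apply: (within_comp cg); first exact/continuous_subspaceT/fcoordC.
    by move=> y; exact: fcoord_ball.
  - by move=> y cy; rewrite /= pg /= ?fcoordK //; exact: fcoord_ball.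
  - by [].
  - move=> y yb; have [cy _] := yb; rewrite /= gS /= ?fcoordK //; exact: fcoord_sphere.
have [Sc HSc] := choice step.
(* Distinct faces of dimension r meet inside their boundaries, where every [Sc] equals [S], so the
   face that [pick] selects does not influence the value. *)
pose S' y := if [pick c | (fdim c == r) && `[< fcell c y >]] is Some c then Sc c y else
  S y.
have S'r c y : fdim c = r -> fcell c y -> S' y = Sc c y.
  move=> cr cy; rewrite /S'; case: pickP => [c' /andP[/eqP c'r /asboolP c'y]|/(_ c)];
    last first.
    by rewrite cr eqxx /= asboolT.
  have [->//|ne] := eqVneq c c'.
  have [_ _ _ h1] := HSc _ cr; have [_ _ _ h2] := HSc _ c'r.
  rewrite h1 ?h2 //; first by apply: (@fcell_inter c' c); rewrite ?cr ?c'r // eq_sym.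
  by apply: (@fcell_inter c c'); rewrite ?cr ?c'r.
have S'l c y : (fdim c < r)%N -> fcell c y -> S' y = S y.
  move=> cr cy; rewrite /S'; case: pickP => // c' /andP[/eqP c'r /asboolP c'y].
  have [_ _ _ h2] := HSc _ c'r; rewrite h2 //.
  apply: (@fcell_inter c' c) => //; first by rewrite c'r ltnW.
  by apply/eqP => e; move: cr; rewrite -e c'r ltnn.
exists S' => c; rewrite ltnS leq_eqVlt => /orP[/eqP cr|cr].
  have [h1 h2 h3 h4] := HSc _ cr; split.
  - by apply: within_eq h1 => y cy; rewrite (S'r c).
  - by move=> y cy; rewrite (S'r c) // h2.
  - by move=> cO y cy; rewrite (S'r c) // h3.
have [h1 h2 h3] := HS _ cr; split.
- by apply: within_eq h1 => y cy; rewrite (S'l c).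
- by move=> y cy; rewrite (S'l c) // h2.
- by move=> cO y cy; rewrite (S'l c) // h3.
Qed.

End grid.

(** * Extension of a family of local sections over a cell *)

Section staircase.
Variables (R : realType) (M N j : nat).
Hypothesis jN : (j.+1 < N)%N.

Definition unit_clamp (x : R) : R := Num.max 0 (Num.min 1 x).

(* [stair] collapses all of [0, M] onto the integers, except for the narrow
   intervals around the points [r + (j+1)/N], where [bad] holds. *)
Definition rise (r : nat) (y : R) : R :=
  unit_clamp (2 * (N%:R * (y - r%:R)) - 2 * j.+1%:R + 2^-1).
Definition stair (y : R) : R := \sum_(r < M) rise r y.
Definition bad (y : R) : bool :=
  [exists r : 'I_M, `|N%:R * (y - r%:R) - j.+1%:R| <= 4^-1].

Lemma stairC : continuous stair.
Proof.
apply: (@cts_sum R R _ _ (fun (r : 'I_M) y => rise r y)) => r.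
by rewrite /rise /unit_clamp; cts.
Qed.

Lemma rise_lo r y : y <= r%:R -> rise r y = 0.
Proof.
move=> h; rewrite /rise.
have h1 : N%:R * (y - r%:R) <= 0 by apply: mulr_ge0_le0; rewrite ?ler0n // subr_le0.
have h2 : 1 <= j.+1%:R :> R by rewrite ler1n.
by rewrite /unit_clamp; mm; lra.
Qed.

Lemma rise_hi r y : r.+1%:R <= y -> rise r y = 1.
Proof.
rewrite -natr1 => h; rewrite /rise.
have h0 : j.+2%:R <= N%:R :> R by rewrite ler_nat.
have h1 : N%:R <= N%:R * (y - r%:R) by apply: ler_peMr; rewrite ?ler0n //; lra.
rewrite -[j.+2%:R]natr1 in h0.
by rewrite /unit_clamp; mm; lra.
Qed.

Lemma sum_lt_ord a : (a <= M)%N -> \sum_(r < M) (r < a)%N%:R = a%:R :> R.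
Proof.
move=> aM; rewrite -natr_sum; congr (_%:R).
elim: M aM => [|m IH]; first by rewrite leqn0 big_ord0 => /eqP->.
rewrite leq_eqVlt big_ord_recr /= => /orP[/eqP->|am].
  rewrite ltnS leqnn (eq_bigr (fun=> 1%N)) ?sum1_card ?card_ord ?addn1 // => i _.
  by rewrite ltnS ltnW.
by rewrite IH // ltnNge -ltnS am addn0.
Qed.

Lemma stair_ge a y : (a <= M)%N -> a%:R <= y -> a%:R <= stair y.
Proof.
move=> aM ay; rewrite -sum_lt_ord //; apply: ler_sum => r _.
case: ltnP => [ra|_]; last by rewrite /= mulr0n /rise /unit_clamp; mm; lra.
by rewrite /= mulr1n rise_hi //; apply: le_trans ay; rewrite ler_nat.
Qed.

Lemma stair_le b y : (b <= M)%N -> y <= b%:R -> stair y <= b%:R.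
Proof.
move=> bM yb; rewrite -sum_lt_ord //; apply: ler_sum => r _.
case: ltnP => [_|br]; first by rewrite /= mulr1n /rise /unit_clamp; mm; lra.
by rewrite /= mulr0n rise_lo //; apply: le_trans yb _; rewrite ler_nat.
Qed.

Lemma nat_floor (y : R) : 0 <= y -> exists a : nat, a%:R <= y < a.+1%:R.
Proof. by move=> y0; exists (Num.truncn y); exact: truncn_itv. Qed.

Lemma stair_bounds y : 0 <= y <= M%:R -> 0 <= stair y <= M%:R.
Proof.
by move=> /andP[y0 y1]; rewrite (@stair_ge 0) // stair_le.
Qed.

Lemma stair_near y : 0 <= y <= M%:R -> `|stair y - y| <= 1.
Proof.
move=> /andP[y0 yM]; have [a /andP[a1 a2]] := nat_floor y0.
have aM : (a <= M)%N by rewrite -(ler_nat R); exact: le_trans yM.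
have s1 := stair_ge aM a1.
have s2 : stair y <= a.+1%:R.
  have [lt|ge] := leqP a.+1 M; first by apply: stair_le => //; exact: ltW.
  have -> : a.+1 = M.+1 by lia.
  by rewrite -natr1; apply: le_trans (stair_le (leqnn _) yM) _; lra.
by rewrite -natr1 in a2 s2; rewrite ler_norml; lra.
Qed.

Lemma not_bad_stair y : ~~ bad y -> exists m : nat, stair y = m%:R.
Proof.
move=> nb.
exists (\sum_(r < M) (rise r y == 1%R))%N; rewrite natr_sum; apply: eq_bigr => r _.
have : ~~ (`|N%:R * (y - r%:R) - j.+1%:R| <= 4^-1).
  by apply: contra nb => h; apply/existsP; exists r.
rewrite -ltNge /rise; set w := N%:R * _ => h.
have : 1 < 2 * w - 2 * j.+1%:R + 2^-1 \/ 2 * w - 2 * j.+1%:R + 2^-1 < 0.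
  by case: (ger0P (w - j.+1%:R)) h => h1 h2; [left|right]; lra.
set x := _ + 2^-1; case=> hx.
  have -> : unit_clamp x = 1 by rewrite /unit_clamp; mm; lra.
  by rewrite eqxx.
have -> : unit_clamp x = 0 by rewrite /unit_clamp; mm; lra.
by rewrite eq_sym oner_eq0.
Qed.

(** The code is a vertex of the grid off the bad intervals and the unit interval around [y] on them.
    Taken in all coordinates, it names a face whose dimension is at most the number of bad
    coordinates and all of whose points are within one mesh of the original point. *)
Lemma stair_code y : 0 <= y <= M%:R -> exists a : 'I_(M.*2.+1),
  [/\ (a./2)%:R <= stair y <= (uphalf a)%:R, odd a -> bad y &
    forall t : R, (a./2)%:R <= t <= (uphalf a)%:R -> `|t - y| <= 1].
Proof.
move=> yI; have /andP[y0 yM] := yI; case: (boolP (bad y)) => [b|nb]; last first.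
  have [m e] := not_bad_stair nb.
  have mM : (m <= M)%N.
    by have := stair_bounds yI; rewrite e ler_nat => /andP[].
  have mM' : (m.*2 < M.*2.+1)%N by rewrite ltnS leq_double.
  exists (Ordinal mM') => /=; rewrite doubleK uphalf_double odd_double; split => //.
    by rewrite e lexx.
  move=> t h; have -> : t = stair y by rewrite e; lra.
  exact: stair_near.
have [a /andP[a1 a2]] := nat_floor y0.
have aM : (a < M)%N.
  rewrite -(ltr_nat R); apply: le_lt_trans a1 _.
  have /existsP[r] := b; rewrite ler_norml => /andP[_ h].
  have rM : r.+1%:R <= M%:R :> R by rewrite ler_nat.
  apply: lt_le_trans rM; rewrite -natr1 -ltrBlDl.
  have N0 : 0 < N%:R :> R by rewrite ltr0n; lia.
  rewrite -(ltr_pM2l N0) mulr1.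
  have : j.+2%:R <= N%:R :> R by rewrite ler_nat.
  by rewrite -natr1; lra.
have aM' : (a.*2.+1 < M.*2.+1)%N by lia.
exists (Ordinal aM') => /=.
rewrite uphalf_double doubleK; split => //.
  by rewrite (stair_ge (ltnW aM)) //= stair_le // ltW.
by move=> t; rewrite -natr1 in a2 *; rewrite ler_norml; lra.
Qed.

Lemma open_not_bad : open [set y | ~~ bad y].
Proof.
rewrite openE => /= y nb.
have h : \forall z \near y, forall r : 'I_M, 4^-1 < `|N%:R * (z - r%:R) - j.+1%:R|.
  apply: (@filter_forall _ _ (fun (r : 'I_M) (z : R) => 4^-1 < `|N%:R * (z - r%:R) -
    j.+1%:R|) (nbhs (y : R)) _) => r.
  have c : continuous (fun z : R => `|N%:R * (z - r%:R) - j.+1%:R|) by cts.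
  have := c y [set t | 4^-1 < t]; apply; apply: open_nbhs_nbhs; split;
    first exact: open_gt.
  by rewrite /= ltNge; apply: contra nb => h; apply/existsP; exists r.
rewrite /interior; apply: filterS h => z h; apply/existsPn => r.
by rewrite -ltNge.
Qed.

End staircase.

(** In the coordinate [N * y] the bad intervals have half-width 1/4 and are centred at the integers
    [N * r + j.+1]. A common point forces equal centres, and [j.+1 < N] is then the residue modulo
    [N]. *)
Lemma bad_disjoint (R : realType) (M N j j' : nat) (y : R) :
  (j.+1 < N)%N -> (j'.+1 < N)%N -> bad M N j y -> bad M N j' y -> j = j'.
Proof.
move=> jN jN' /existsP[r h] /existsP[r' h'].
have e : (N * r + j.+1 = N * r' + j'.+1)%N.
  rewrite !ler_norml !mulrBr in h h'.
  have k1 : (N * r + j.+1)%:R < (N * r' + j'.+1).+1%:R :> R.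
    by rewrite -natr1 !natrD !natrM; lra.
  have k2 : (N * r' + j'.+1)%:R < (N * r + j.+1).+1%:R :> R.
    by rewrite -natr1 !natrD !natrM; lra.
  by move: k1 k2; rewrite !ltr_nat; lia.
have : ((N * r + j.+1) %% N = (N * r' + j'.+1) %% N)%N by rewrite e.
by rewrite ![(N * _)%N]mulnC !modnMDl !modn_small // => -[].
Qed.

Lemma compact_csphere (R : realType) d : compact (csphere 'rV[R]_d).
Proof.
apply: bounded_closed_compact; last exact: closed_csphere.
exists 1; split; first exact: num_real.
by move=> x x1 v /= ->; exact: ltW.
Qed.

Lemma open_lt_fun (R : realType) (T : topologicalType) (f g : T -> R) :
  continuous f -> continuous g -> open [set x | f x < g x].
Proof.
move=> cf cg; rewrite -[X in open X]setCK; apply: closed_openC.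
rewrite [X in closed X](_ : _ = [set x | g x <= f x]); first exact: closed_le_fun.
by apply/seteqP; split => x /=; rewrite leNgt => /negP.
Qed.

Lemma open_preimage (T U : topologicalType) (f : T -> U) (A : set U) :
  continuous f -> open A -> open (f @^-1` A).
Proof. by move=> cf oA; apply: open_comp => // x _; exact: cf. Qed.

Lemma lebesgue_number (R : realType) d (n : nat) (O : 'I_n.+1 -> set 'rV[R]_d) :
  (forall j, open (O j)) -> (forall z, csphere _ z -> exists j, O j z) ->
  exists2 e : R, 0 < e <= 1 & forall z, csphere _ z ->
    exists j, forall v, `|v - z| < e -> O j v.
Proof.
move=> oO cov.
have /compact_near_coveringP/near_covering_withinP := @compact_csphere R d.
move=> /(_ R (0^'+) (fun e z => exists j, forall v, `|v - z| < e -> O j v) _).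
case=> [z zs|e /= e0 h].
  have [j jz] := cov z zs.
  have /nbhs_ballP[e e0 eO] : nbhs z (O j) by exact: open_nbhs_nbhs.
  rewrite /= in e0.
  exists (ball z (e / 2), [set t | t < e / 2]) => /=.
    split; first by apply: nbhsx_ballx; lra.
    by apply: nbhs_right_lt; lra.
  move=> [z' t] [/= h1 h2] _; exists j => v hv; apply: eO.
  move: h1; rewrite -!ball_normE /= => h1.
  rewrite distrC; apply: le_lt_trans (ler_distD z' _ _) _.
  by rewrite [`|z' - z|]distrC; lra.
exists (Num.min 1 (e / 2)).
  by apply/andP; split; mm; lra.
have t0 : 0 < Num.min 1 (e / 2) by mm; lra.
have t1 : Num.min 1 (e / 2) < e by mm; lra.
move=> z zs; apply: (h (Num.min 1 (e / 2))) => //=.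
by rewrite sub0r normrN ger0_norm // ltW.
Qed.

Section cell_extension.
Variables (R : realType) (P B : topologicalType) (p : P -> B) (k n d : nat)
  (w : B -> P).
Hypothesis lp : lifting R p.
Hypothesis ext : forall i, (i <= k)%N -> sphere_extensible R p i.
Hypothesis dim : (d < n.+1 * k.+1)%N.
Notation V := 'rV[R]_d.
Variables (q : V -> B) (U : 'I_n.+1 -> set V) (g : 'I_n.+1 -> V -> P).
Hypothesis cq : {within cball V, continuous q}.
Hypothesis cg : forall j, partial_continuous (csphere V) (U j) (g j).
Hypothesis pg : forall j z, csphere V z -> U j z -> p (g j z) = q z.
Hypothesis cov : forall z, csphere V z -> exists j, U j z.

(** Radial projection to the sphere where the norm is at least 1/2; closer to the centre the
    constant 1/2 only keeps the formula continuous. *)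
Let rho (v : V) : V := (Num.max 2^-1 `|v|)^-1 *: v.

Let rhoC : continuous rho.
Proof.
rewrite /rho; cts => v; apply: lt0r_neq0; mm; lra.
Qed.

Let rho_sphere v : 2^-1 < `|v| -> csphere V (rho v) /\ `|v| *: rho v = v.
Proof.
move=> h; have v0 : `|v| != 0 by apply: lt0r_neq0; lra.
have -> : rho v = `|v|^-1 *: v.
  by rewrite /rho; congr (_^-1 *: _); mm; lra.
rewrite /csphere /= normrZ normfV normr_id mulVf //; split => //.
by rewrite scalerA mulfV // scale1r.
Qed.

Let rho_id v : csphere V v -> rho v = v.
Proof.
rewrite /csphere /= => h.
by have [_] := @rho_sphere v ltac:(rewrite h; lra); rewrite h scale1r.
Qed.

Let O j : set V := [set v | 2^-1 < `|v| /\ U j (rho v)].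

Let openO j : open (O j).
Proof.
have /(partial_continuousP _ _ (@closed_csphere R V))[cU _] := @cg j.
rewrite [X in open X](_ : _ = [set v | 2^-1 < `|v|] `&` rho @^-1` (~` (csphere V `\` U
  j))).
  apply: openI; first by apply: open_lt_fun; [exact: ctsC|exact: norm_continuous].
  by apply: open_preimage => //; exact: closed_openC.
apply/seteqP; split => v /= [h1 h2]; split => //; first by case.
by have [h3 _] := rho_sphere h1; apply: contrapT => h4; apply: h2.
Qed.

(** Lifting along the radius from [rho v] inwards to [v] takes the time 1 minus the norm of [v],
    which is zero on the sphere. *)
Let collar j : exists Gh : V -> P, [/\ {within cball V `&` O j, continuous Gh},
  forall v, cball V v -> O j v -> p (Gh v) = q v &
  forall v, csphere V v -> U j v -> Gh v = g j v].
Proof.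
have /(partial_continuousP _ _ (@closed_csphere R V))[_ cU] := @cg j.
have hI v : (cball V `&` O j) v -> 0 <= 1 - `|v| <= 1.
  by rewrite /cball => -[/= h [h' _]]; lra.
have [|||||Gh [c1 c2 c3]] := lp (D := cball V `&` O j) (s := fun v => g j (rho v))
  (G := fun y => q ((1 - y.2) *: rho y.1)) (m := fun v => 1 - `|v|).
- apply: (within_comp cU); first exact: continuous_subspaceT.
  by move=> v [_ [/rho_sphere[? _] ?]].
- apply: (within_comp cq); first by apply: continuous_subspaceT; cts.
  move=> [v t] [[/= _ [/rho_sphere[h _] _]] t01]; apply: cballZ;
    first exact: csphere_cball.
  lra.
- by apply: continuous_subspaceT; cts.
- exact: hI.
- move=> v [_ [/rho_sphere[h _] Uv]] /=; rewrite subr0 scale1r pg //.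
exists Gh; split => //.
- move=> v vb Ov; rewrite c2 //=; have [/rho_sphere[_ e] _] := Ov.
  by rewrite opprB addrC subrK e.
- move=> v vs Uv.
  have Ov : O j v by split; [rewrite vs; lra|rewrite rho_id].
  rewrite c3 ?rho_id //; first by split => //; exact: csphere_cball.
  by rewrite vs subrr.
Qed.

(** Deep inside, the section is the one on the skeleton, [S j], taken at the pushed point [phi j];
    near the sphere it is the collar extension [Gh j]. On the overlap the whole face that contains
    the pushed point lies in the collar domain, where [S j] was chosen to be [Gh j]. Both lie over a
    displaced point, and a last lifting removes the displacement. *)
Lemma cell_extension : exists (W : 'I_n.+1 -> set V) (G : 'I_n.+1 -> V -> P),
  [/\ forall j, partial_continuous (cball V) (W j) (G j),
    forall j z, cball V z -> W j z -> p (G j z) = q z,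
    forall z, cball V z -> exists j, W j z &
    forall j z, csphere V z -> (W j z <-> U j z) /\ (U j z -> G j z = g j z)].
Proof.
have [Gh HGh] := choice collar.
have [|del /andP[del0 del1] leb] := @lebesgue_number R d n O openO.
  by move=> z zs; have [j Uj] := cov zs; exists j; split; [rewrite zs;
    lra|rewrite rho_id].
(* The side of length 2 is cut into [M] intervals, so the mesh [h] is 2 / [M], and the constant 8
   makes it less than [del / 4]. *)
have [M hM] : exists M : nat, 8 / del < M%:R.
  by exists (Num.bound (8 / del)); apply: archi_boundP; apply: divr_ge0; lra.
have M0 : 0 < M%:R :> R by apply: lt_trans hM; apply: divr_gt0; lra.
have Mn0 : M%:R != 0 :> R by exact: lt0r_neq0.
pose h := 2 / M%:R : R.
have h0 : 0 < h by apply: divr_gt0.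
have h4 : h < del / 4.
  rewrite /h ltr_pdivrMr //; rewrite ltr_pdivrMr // in hM; lra.
have hM2 : h * M%:R = 2 by rewrite /h -mulrA mulVf // mulr1.
pose toy (v : V) : V := \row_i ((v ord0 i + 1) / h).
pose tov (y : V) : V := \row_i (h * y ord0 i - 1).
have h_neq : h != 0 by exact: lt0r_neq0.
have tovK v : tov (toy v) = v.
  by apply/rowP => i; rewrite !mxE /= mulrC -mulrA mulVf // mulr1 addrK.
have ctoy : continuous toy.
  apply: cts_rV => i; rewrite (_ : (fun x => _) = (fun x : V => (x ord0 i + 1) / h));
    last by apply/funext => x; rewrite mxE.
  have c : continuous (fun x : V => x ord0 i) by exact/cts_coord/ctsid.
  by cts.
have ctov : continuous tov.
  apply: cts_rV => i; rewrite (_ : (fun x => _) = (fun x : V => h * x ord0 i - 1));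
    last by apply/funext => x; rewrite mxE.
  have c : continuous (fun x : V => x ord0 i) by exact/cts_coord/ctsid.
  by cts.
have toyb v : cball V v -> gcube M (toy v).
  move=> vb i; have := le_trans (rV_coord_le v i) vb; rewrite ler_norml mxE => /andP[a b].
  rewrite divr_ge0 /=; [|lra|lra].
  by rewrite ler_pdivrMr // mulrC hM2; lra.
have tovb y : gcube M y -> cball V (tov y).
  move=> yb; apply/rV_norm_le => // i; have /andP[a b] := yb i.
  rewrite mxE ler_norml; rewrite -(ler_pM2l h0) hM2 in b.
  have c : 0 <= h * y ord0 i by apply: mulr_ge0 => //; lra.
  lra.
have dist_tov (y y' : V) : (forall i, `|y ord0 i - y' ord0 i| <= 1) -> `|tov y - tov
  y'| <= h.
  move=> yy; apply/rV_norm_le; first exact: ltW.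
  move=> i; rewrite !mxE; have -> : h * y ord0 i - 1 - (h * y' ord0 i - 1) = h * (y
    ord0 i - y' ord0 i) by lra.
  by rewrite normrM gtr0_norm // -[X in _ <= X]mulr1 ler_pM2l.
(* With [N = n.+2] the n+1 fractions (j+1) / (n+2) are distinct interior points of the unit
   interval. *)
have jN (j : 'I_n.+1) : (j.+1 < n.+2)%N by rewrite ltnS.
pose phi (j : 'I_n.+1) (y : V) : V := \row_i stair M n.+2 j (y ord0 i).
have cphi j : continuous (phi j).
  apply: cts_rV => i; rewrite (_ : (fun x => _) = (fun x : V => stair M n.+2 j (x ord0
    i))); last by apply/funext => x; rewrite mxE.
  apply: ctscomp; first exact: stairC.
  exact/cts_coord/ctsid.
have phib j y : gcube M y -> gcube M (phi j y).
  by move=> yb i; rewrite mxE; exact: stair_bounds.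
pose bads j v := finset (fun i => bad M n.+2 j (toy v ord0 i)).
(* These are points that [phi j] pushes into faces of dimension at most [k], over which [S j]
   exists. *)
pose W0 (j : 'I_n.+1) : set V := [set v | (#|bads j v| <= k)%N].
have openW0 j : open (W0 j).
  rewrite openE => /= v Wv.
  have nb : \forall v' \near v, forall i : 'I_d, ~~ bad M n.+2 j (toy v ord0 i) -> ~~
    bad M n.+2 j (toy v' ord0 i).
    apply: (@filter_forall _ _ (fun (i : 'I_d) (v' : V) => ~~ bad M n.+2 j (toy v ord0
      i) -> ~~ bad M n.+2 j (toy v' ord0 i)) (nbhs (v : V)) _) => i.
    case: (boolP (bad M n.+2 j (toy v ord0 i))) => b; first by apply: filterE.
    have c : continuous (fun x : V => toy x ord0 i) by exact: cts_coord.
    have H : nbhs (v : V) [set x | ~~ bad M n.+2 j (toy x ord0 i)].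
      exact: (c v [set y | ~~ bad M n.+2 j y] (open_nbhs_nbhs (conj (@open_not_bad R M
        n.+2 j) b))).
    by apply: filterS H => v' hv' _.
  rewrite /interior; apply: filterS nb => v' nb; apply: leq_trans Wv.
  apply: subset_leq_card; apply/fintype.subsetP => i; rewrite !inE.
  by apply: contraTT; exact: nb.
have face j v : cball V v -> W0 j v -> exists c : {ffun 'I_d -> 'I_(M.*2.+1)},
    [/\ (fdim c <= k)%N, fcell c (phi j (toy v)) &
      forall z, fcell c z -> `|tov z - v| <= h].
  move=> vb Wv; have yb := toyb v vb.
  have [c Hc] := choice (fun i => @stair_code R M n.+2 j (jN j) (toy v ord0 i) (yb i)).
  exists (finfun c); split.
  - apply: leq_trans Wv; apply: subset_leq_card; apply/fintype.subsetP => i.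
    by rewrite !inE ffunE; have [_ + _] := Hc i; exact.
  - by move=> i; rewrite /lo /hi ffunE mxE; have [] := Hc i.
  - move=> z cz; rewrite -[v in X in _ - X](tovK v); apply: dist_tov => i.
    by have := cz i; rewrite /lo /hi ffunE; have [_ _] := Hc i; exact.
have Sk j : exists S : V -> P, forall c : {ffun 'I_d -> 'I_(M.*2.+1)}, (fdim c <
  k.+1)%N ->
    [/\ {within fcell c, continuous S}, forall y, fcell c y -> p (S y) = q (tov y) &
      fcell c `<=` tov @^-1` (O j) -> forall y, fcell c y -> S y = Gh j (tov y)].
  have [cGh pGh _] := HGh j.
  apply: (skeleton_lift (fun y => w (q (tov y))) ext _ _ _ (leqnn _)).
  - by apply: (within_comp cq); [exact: continuous_subspaceT|exact: tovb].
  - apply: (within_comp cGh); first exact: continuous_subspaceT.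
    by move=> y [? ?]; split => //; exact: tovb.
  - by move=> y yb Oy; rewrite pGh //; exact: tovb.
have [S HS] := choice Sk.
pose eps := del / 4.
(* [sc] is 1 up to norm [1 - eps] and 0 from norm [1 - eps / 2] on: the straight homotopy [kap] to
   the pushed point is completed inside and switched off near the sphere. *)
pose sc (v : V) := unit_clamp (2 * (1 - `|v|) / eps - 1).
have eps0 : 0 < eps by rewrite /eps; lra.
have csc : continuous sc by rewrite /sc /unit_clamp; cts; exact: norm_continuous.
have sc01 v : 0 <= sc v <= 1 by rewrite /sc /unit_clamp; mm; lra.
have sc0 v : 1 - eps / 2 <= `|v| -> sc v = 0.
  move=> hv; have : 2 * (1 - `|v|) / eps - 1 <= 0 by rewrite subr_le0 ler_pdivrMr //; lra.
  by rewrite /sc /unit_clamp => ?; mm; lra.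
have sc1 v : `|v| <= 1 - eps -> sc v = 1.
  move=> hv; have : 1 <= 2 * (1 - `|v|) / eps - 1 by rewrite lerBrDr ler_pdivlMr //; lra.
  by rewrite /sc /unit_clamp => ?; mm; lra.
pose kap j (s : R) (v : V) : V := v + s *: (tov (phi j (toy v)) - v).
have kap0 j v : kap j 0 v = v by rewrite /kap scale0r addr0.
have kap1 j v : kap j 1 v = tov (phi j (toy v)) by rewrite /kap scale1r addrC subrK.
have kapb j s v : cball V v -> 0 <= s <= 1 -> cball V (kap j s v).
  move=> vb /andP[s0 s1]; rewrite /cball /=.
  have -> : kap j s v = (1 - s) *: v + s *: tov (phi j (toy v)).
    by rewrite /kap scalerBr scalerBl scale1r addrA addrAC.
  apply: le_trans (ler_normD _ _) _; rewrite !normrZ ger0_norm ?(ger0_norm s0); last lra.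
  have h1 : `|v| <= 1 := vb.
  have h2 : `|tov (phi j (toy v))| <= 1 by apply/tovb/phib/toyb.
  have h3 : (1 - s) * `|v| <= (1 - s) * 1 by apply: ler_wpM2l => //; lra.
  have h5 : s * `|tov (phi j (toy v))| <= s * 1 by apply: ler_wpM2l.
  lra.
have kap_near j s v : cball V v -> 0 <= s <= 1 -> `|kap j s v - v| <= h.
  move=> vb /andP[s0 s1]; rewrite /kap addrC addKr normrZ ger0_norm //.
  have : `|tov (phi j (toy v)) - v| <= h.
    rewrite -[v in X in _ - X](tovK v); apply: dist_tov => i.
    by rewrite [phi j _ _ _]mxE; exact: (stair_near (jN j) (toyb v vb i)).
  move=> h1; apply: le_trans (_ : 1 * h <= h); last by rewrite mul1r.
  by apply: ler_pM.
(* A radius strictly larger than the mesh makes [N j] open, and it keeps in [O j] both the segment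
   described by [kap] and the whole face around the pushed point. *)
pose N j : set V := [set v | exists2 e, h < e & forall v', `|v' - v| < e -> O j v'].
have openN j : open (N j).
  rewrite openE => /= v [e he Hv]; rewrite /interior.
  apply/nbhs_ballP; exists ((e - h) / 2) => /=; first by rewrite divr_gt0 // subr_gt0.
  move=> v'; rewrite -ball_normE /= => vv'; exists ((e + h) / 2); first lra.
  move=> v'' h2; apply: Hv; apply: le_lt_trans (ler_distD v' _ _) _.
  by rewrite [`|v' - v|]distrC; lra.
have NO j v : N j v -> O j v.
  by case=> e he; apply; rewrite subrr normr0; lra.
have covN v : cball V v -> 1 - eps <= `|v| -> exists j, N j v.
  move=> vb hv; have v2 : 2^-1 < `|v| by rewrite /eps in hv; lra.
  have [zs ze] := rho_sphere v2; have [j Hj] := leb _ zs; exists j.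
  exists (del / 2); first lra.
  move=> v' v'v; apply: Hj; apply: le_lt_trans (ler_distD v _ _) _.
  have : `|v - rho v| <= del / 4.
    rewrite -{1}ze -{2}[rho v]scale1r -scalerBl normrZ zs mulr1.
    by rewrite distrC ger0_norm; move: vb; rewrite /cball /= /eps in hv *; lra.
  lra.
pose A1 j : set V := ([set v | 1 - eps / 2 < `|v|] `&` O j) `|` N j.
pose A3 j : set V := W0 j `&` [set v | `|v| < 1 - eps].
pose W j : set V := A1 j `|` A3 j.
have openA1 j : open (A1 j).
  apply: openU => //; apply: openI => //.
  by apply: open_lt_fun; [exact: ctsC|exact: norm_continuous].
have openA3 j : open (A3 j).
  by apply: openI => //; apply: open_lt_fun; [exact: norm_continuous|exact: ctsC].
pose G' j v := if `[< A3 j v >] then S j (phi j (toy v)) else Gh j (kap j (sc v) v).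
have Skb j v : cball V v -> A3 j v -> exists2 c : {ffun 'I_d -> 'I_(M.*2.+1)},
   (fdim c < k.+1)%N & fcell c (phi j (toy v)).
  by move=> vb [Wv _]; have [c [? ? _]] := face j v vb Wv; exists c.
have G'1 j v : cball V v -> A1 j v -> G' j v = Gh j (kap j (sc v) v).
  move=> vb A1v; rewrite /G'; case: asboolP => // -[Wv hv].
  have [e he Nv] : N j v by case: A1v => // -[/= hv' _]; move: hv => /=; lra.
  have [c [ck cy cv]] := face j v vb Wv.
  have [_ _ H] := HS j c ck; rewrite sc1 ?kap1; last exact: ltW.
  by apply: H => // z cz /=; apply: Nv; apply: le_lt_trans he; exact: cv.
have kapO j v : cball V v -> A1 j v -> O j (kap j (sc v) v).
  move=> vb [[hv Ov]|[e he Nv]]; first by rewrite sc0 ?kap0 // ltW.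
  by apply: Nv; apply: le_lt_trans he; exact: kap_near.
have ckap j : continuous (fun y : R * V => kap j y.1 y.2) by rewrite /kap; cts.
have pG' j v : cball V v -> W j v -> p (G' j v) = q (kap j (sc v) v).
  move=> vb [A1v|A3v].
    have [_ pGh _] := HGh j.
    by rewrite G'1 // pGh //; [exact: kapb|exact: kapO].
  rewrite /G' asboolT //; have [c ck cy] := Skb j v vb A3v.
  have [_ -> // _] := HS j c ck.
  by rewrite sc1 ?kap1 //; case: A3v => _ /= /ltW.
have cG' j : {within cball V `&` W j, continuous (G' j)}.
  apply: within_openU => //.
    apply: (@within_eq _ _ _ (fun v => Gh j (kap j (sc v) v))).
      by move=> v [vb A1v]; rewrite G'1.
    have [cGh _ _] := HGh j.
    apply: (within_comp cGh).
      apply: continuous_subspaceT.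
      by apply: (@ctscomp _ _ _ (fun y : R * V => kap j y.1 y.2) (fun v => (sc v, v)))
        => //; cts.
    by move=> v [vb A1v]; split; [exact: kapb|exact: kapO].
  apply: (@within_eq _ _ _ (fun v => S j (phi j (toy v)))).
    by move=> v [vb A3v]; rewrite /G' asboolT.
  have cS : {within [set y | exists2 c : {ffun 'I_d -> 'I_(M.*2.+1)}, (fdim c < k.+1)%N
    & fcell c y], continuous (S j)}.
    apply: within_bigcup_closed => [c|c cr]; first exact: closed_fcell.
    by have [] := HS j _ cr.
  apply: (within_comp cS); last by move=> v [vb A3v]; exact: Skb.
  by apply: continuous_subspaceT; have := cphi j; move=> ?; cts.
(* [G'] lies over the displaced point [kap j (sc v) v]. Lifting the return to [v] for the time
   [sc v] leaves the values near the sphere unchanged. *)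
have fin j : exists G : V -> P, [/\ {within cball V `&` W j, continuous G},
    forall v, cball V v -> W j v -> p (G v) = q v &
    forall v, cball V v -> W j v -> sc v = 0 -> G v = G' j v].
  have [|||||G [c1 c2 c3]] := lp (D := cball V `&` W j) (s := G' j)
    (G := fun y => q (kap j (Num.max 0 (sc y.1 - y.2)) y.1)) (m := sc).
  - exact: cG'.
  - apply: (within_comp cq).
      apply: continuous_subspaceT.
      by apply: (@ctscomp _ _ _ (fun y : R * V => kap j y.1 y.2) (fun y => (Num.max 0
        (sc y.1 - y.2), y.1))) => //; cts.
    move=> [v t] [[/= vb _] t01]; apply: kapb => //.
    by have := sc01 v; mm; lra.
  - exact: continuous_subspaceT.
  - by [].
  - move=> v [vb Wv]; rewrite pG' //= subr0; congr (q (kap _ _ _)).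
    by have := sc01 v; mm; lra.
  exists G; split.
  - exact: c1.
  - by move=> v vb Wv; rewrite c2 //= subrr maxxx kap0.
  - by move=> v vb Wv; exact: c3.
have [G HG] := choice fin.
exists W, G; split.
- move=> j; apply: partial_continuous_open; first exact: closed_cball.
    exact: openU.
  by have [] := HG j.
- by move=> j z zb Wz; have [_ -> //] := HG j.
- move=> v vb; have [hv|hv] := leP (1 - eps) `|v|.
    by have [j Nj] := covN v vb hv; exists j; left; right.
  apply: contrapT => nW.
  have nW0 (j : 'I_n.+1) : (k.+1 <= #|bads j v|)%N.
    by rewrite ltnNge; apply/negP => Wj; apply: nW; exists j; right.
  (* The pairs of an index and a coordinate bad for it are counted twice: at least [k.+1] for each
     index, at most one for each coordinate. *)
  have : (n.+1 * k.+1 <= d)%N.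
    rewrite -[n.+1]card_ord -sum_nat_const.
    apply: leq_trans (_ : \sum_(j < n.+1) #|bads j v| <= _)%N.
      by apply: leq_sum => j _.
    rewrite (eq_bigr (fun j : 'I_n.+1 => \sum_(i < d) bad M n.+2 j (toy v ord0 i))%N);
      last first.
      by move=> j _; rewrite -sum1dep_card big_mkcond.
    rewrite exchange_big /= -[X in (_ <= X)%N]card_ord -sum1_card.
    apply: leq_sum => i _.
    case: (pickP (fun j : 'I_n.+1 => bad M n.+2 j (toy v ord0 i))) => [j bj|nb].
      rewrite (bigD1 j) //= bj big1 ?addn0 // => j' j'j.
      apply/eqP; rewrite eqb0; apply: contra j'j => bj'.
      by apply/eqP/val_inj; exact: (bad_disjoint (jN j') (jN j) bj' bj).
    by rewrite big1 // => j _; rewrite nb.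
  by rewrite leqNgt dim.
- move=> j z zs; have zb := csphere_cball zs; have zs' : `|z| = 1 := zs.
  have WU : W j z <-> U j z.
    split.
      move=> [[[_ [_]]|/NO[_]]|[_ /=]]; rewrite ?rho_id //.
      by rewrite zs' /eps; lra.
    move=> Uz; left; left; split; first by rewrite /= zs' /eps; lra.
    by split; [rewrite zs'; lra|rewrite rho_id].
  split => // Uz; have Wz : W j z by apply/WU.
  have s0 : sc z = 0 by apply: sc0; rewrite zs' /eps; lra.
  have [_ _ H] := HG j; rewrite H // /G'; case: asboolP => [[_ /=]|_].
    by rewrite zs' /eps => ?; exfalso; lra.
  by rewrite s0 kap0; have [_ _ ->] := HGh j.
Qed.

End cell_extension.

(** * Local sections over the cylinder of a CW-complex *)

Section row_snoc.
Variables (R : realType) (m : nat).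
Notation V := 'rV[R]_m.

Definition snoc (y : V * R) : 'rV[R]_m.+1 :=
  \row_i (if unlift ord_max i is Some j then y.1 ord0 j else y.2).
Definition unsnoc (z : 'rV[R]_m.+1) : V * R :=
  (\row_j z ord0 (lift ord_max j), z ord0 ord_max).

Lemma snocK : cancel snoc unsnoc.
Proof.
case=> v t; rewrite /unsnoc /snoc; congr pair; last by rewrite mxE unlift_none.
by apply/rowP => j; rewrite !mxE liftK.
Qed.

Lemma unsnocK : cancel unsnoc snoc.
Proof.
move=> z; apply/rowP => i; rewrite !mxE; case: unliftP => [j ->|->] //=.
by rewrite mxE.
Qed.

Lemma snocC : continuous snoc.
Proof.
apply: cts_rV => i.
rewrite (_ : (fun x => _) = (fun x : V * R => if unlift ord_max i is Some j then x.1
  ord0 j else x.2)); last first.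
  by apply/funext => x; rewrite mxE.
case: (unlift ord_max i) => [j|]; last by cts.
by apply: cts_coord; cts.
Qed.

Lemma unsnocC : continuous unsnoc.
Proof.
apply: ctspair; last exact/cts_coord/ctsid.
apply: cts_rV => j.
rewrite (_ : (fun x => _) = (fun x : 'rV[R]_m.+1 => x ord0 (lift ord_max j))); last first.
  by apply/funext => x; rewrite mxE.
exact/cts_coord/ctsid.
Qed.

Lemma norm_snoc y : `|snoc y| = `|y|.
Proof.
case: y => v t; rewrite norm_pair; apply/eqP; rewrite eq_le; apply/andP; split.
  apply/rV_norm_le => [|i]; first by rewrite le_max normr_ge0.
  rewrite mxE; case: unliftP => [j _|_] /=; rewrite le_max ?lexx ?orbT //.
  by rewrite rV_coord_le.
rewrite ge_max; apply/andP; split.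
  apply/rV_norm_le => // j; apply: le_trans (rV_coord_le _ (lift ord_max j)).
  by rewrite mxE liftK.
by apply: le_trans (rV_coord_le _ ord_max); rewrite mxE unlift_none.
Qed.

Lemma norm_unsnoc z : `|unsnoc z| = `|z|.
Proof. by rewrite -[in RHS](unsnocK z) norm_snoc. Qed.

Lemma cball_snoc y : cball (V * R)%type y -> cball _ (snoc y).
Proof. by rewrite /cball /= norm_snoc. Qed.
Lemma csphere_snoc y : csphere (V * R)%type y -> csphere _ (snoc y).
Proof. by rewrite /csphere /= norm_snoc. Qed.
Lemma cball_unsnoc z : cball _ z -> cball (V * R)%type (unsnoc z).
Proof. by rewrite /cball /= norm_unsnoc. Qed.
Lemma csphere_unsnoc z : csphere _ z -> csphere (V * R)%type (unsnoc z).
Proof. by rewrite /csphere /= norm_unsnoc. Qed.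

End row_snoc.

Lemma partial_continuous_comp (T T' U : topologicalType) (D : set T) (O : set T) (g : T
  -> U)
    (D' : set T') (u : T' -> T) :
  continuous u -> (forall x, D' x <-> D (u x)) ->
  partial_continuous D O g -> partial_continuous D' (O \o u) (g \o u).
Proof.
move=> cu DD' h C cC.
rewrite [X in closed X](_ : _ = u @^-1` [set x | D x /\ (O x -> C (g x))]).
  by apply: closed_comp; [move=> x _; exact: cu|exact: h].
by apply/seteqP; split => x /= [/DD' ? ?].
Qed.

Lemma cell_extension_prod (R : realType) (P B : topologicalType) (p : P -> B) (k n m :
  nat)
    (w : B -> P) (q : 'rV[R]_m * R -> B) (U : 'I_n.+1 -> set ('rV[R]_m * R))
    (g : 'I_n.+1 -> 'rV[R]_m * R -> P) :
  lifting R p -> (forall i, (i <= k)%N -> sphere_extensible R p i) ->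
  (m.+1 < n.+1 * k.+1)%N ->
  {within cball ('rV[R]_m * R)%type, continuous q} ->
  (forall j, partial_continuous (csphere ('rV[R]_m * R)%type) (U j) (g j)) ->
  (forall j z, csphere ('rV[R]_m * R)%type z -> U j z -> p (g j z) = q z) ->
  (forall z, csphere ('rV[R]_m * R)%type z -> exists j, U j z) ->
  exists (W : 'I_n.+1 -> set ('rV[R]_m * R)) (G : 'I_n.+1 -> 'rV[R]_m * R -> P),
  [/\ forall j, partial_continuous (cball ('rV[R]_m * R)%type) (W j) (G j),
    forall j z, cball ('rV[R]_m * R)%type z -> W j z -> p (G j z) = q z,
    forall z, cball ('rV[R]_m * R)%type z -> exists j, W j z &
    forall j z, csphere ('rV[R]_m * R)%type z ->
      (W j z <-> U j z) /\ (U j z -> G j z = g j z)].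
Proof.
move=> lp ext dim cq cg pg cov.
have cu := @unsnocC R m; have cs := @snocC R m.
have [||||W [G [c1 c2 c3 c4]]] := @cell_extension R P B p k n m.+1 w lp ext dim
  (q \o @unsnoc R m) (fun j => U j \o @unsnoc R m) (fun j => g j \o @unsnoc R m).
- by apply: (within_comp cq); [exact: continuous_subspaceT|exact: cball_unsnoc].
- move=> j; apply: partial_continuous_comp (cg j) => // x.
  by rewrite /csphere /= norm_unsnoc.
- by move=> j z /csphere_unsnoc zs; exact: pg.
- by move=> z /csphere_unsnoc /cov.
exists (fun j => W j \o @snoc R m), (fun j => G j \o @snoc R m); split.
- move=> j; apply: partial_continuous_comp (c1 j) => // x.
  by rewrite /cball /= norm_snoc.
- by move=> j z /cball_snoc zb Wz; rewrite /= c2 //= snocK.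
- by move=> z /cball_snoc /c3.
- by move=> j z /csphere_snoc zs; have := c4 j _ zs; rewrite /= snocK.
Qed.

(** In dimension i + 1 injectivity in dimension i extends [e] over the ball, and surjectivity in
    dimension i + 1 then corrects this extension so that its image is homotopic to [h]. In dimension
    0 the ball is a point with empty sphere, and surjectivity on path components suffices. *)
Lemma compressible_rV (R : realType) (E X : topologicalType) (f : E -> X) (k : nat) :
  continuous f ->
  (forall x : X, exists e (K : R -> X), [/\ {within cball R, continuous K}, K (-1) = f
    e & K 1 = x]) ->
  (forall i, (i <= k)%N -> sphere_surjective (R := R) f 'rV[R]_i) ->
  (forall i, (i < k)%N -> sphere_injective (R := R) f 'rV[R]_i) ->
  forall i, (i <= k)%N -> compressible (R := R) f 'rV[R]_i.
Proof.
move=> cf surj0 surj inj [_|i ik] e h ce ch he.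
  have [e0 [K [cK K0 K1]]] := surj0 (h 0).
  exists (fun=> e0), (fun y => K y.2); split.
  - by apply: continuous_subspaceT; exact: ctsC.
  - by move=> z; rewrite /csphere /= thinmx0 normr0 => /eqP; rewrite eq_sym oner_eq0.
  - by apply: (within_comp cK); [apply: continuous_subspaceT; cts|case=> z t []].
  - by move=> z _; rewrite /= K0 K1 [in h z]thinmx0.
  - by move=> z t; rewrite /csphere /= thinmx0 normr0 => /eqP; rewrite eq_sym oner_eq0.
have cu := @unsnocC R i; have cs := @snocC R i.
have [|||e' [ce' e'e]] := sphere_extension cf (inj i ik) (e := e \o @snoc R i) (h := h
  \o @snoc R i).
- by apply: (within_comp ce); [exact: continuous_subspaceT|exact: csphere_snoc].
- by apply: (within_comp ch); [exact: continuous_subspaceT|exact: cball_snoc].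
- by move=> z /csphere_snoc /he.
have [|||e2 [K [ce2 e2e cK K1 Ks]]] := homotopy_correction cf (surj _ ik) (e := e' \o
  @unsnoc R i) (h := h).
- by apply: (within_comp ce'); [exact: continuous_subspaceT|exact: cball_unsnoc].
- by [].
- by move=> z zs; rewrite /= e'e /= ?unsnocK ?he //; exact: csphere_unsnoc.
exists e2, K; split => // z zs; rewrite e2e //= e'e /= ?unsnocK //; exact: csphere_unsnoc.
Qed.

Lemma compact_cball (R : realType) d : compact (cball 'rV[R]_d).
Proof.
apply: bounded_closed_compact; last exact: closed_cball.
exists 1; split; first exact: num_real.
by move=> x x1 v /= vb; apply: le_trans vb _; exact: ltW.
Qed.

Lemma compact_cballR (R : realType) : compact (cball R).
Proof.
rewrite (_ : cball R = `[-1, 1]%classic); first exact: segment_compact.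
by apply/seteqP; split => t; rewrite /cball /= in_itv /= ler_norml.
Qed.

Lemma partial_continuous_within (T T' U : topologicalType) (D O : set T) (g : T -> U)
    (D' : set T') (u : T' -> T) :
  closed D' -> {within D', continuous u} -> (forall x, D' x -> D (u x)) ->
  partial_continuous D O g ->
  partial_continuous D' (fun x => O (u x)) (fun x => g (u x)).
Proof.
move=> cD' /continuous_closedP cu DD h C /h /cu /closed_subspaceP[Z cZ ZE].
rewrite [X in closed X](_ : _ = Z `&` D'); first exact: closedI.
rewrite ZE; apply/seteqP; split => x /=.
  by move=> [D'x k]; split => //; split => //; exact: DD.
by move=> [[_ k] D'x].
Qed.

Section cells.
Variables (R : realType) (B : topologicalType) (cell : Type) (dm : cell -> nat)
  (chi : forall a, 'rV[R]_(dm a) -> B).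
Hypothesis hausB : hausdorff_space B.
Hypothesis chiC : forall a, {within cball 'rV[R]_(dm a), continuous (@chi a)}.
Hypothesis chi_inj : forall a (u v : 'rV[R]_(dm a)), `|u| < 1 -> `|v| < 1 ->
  chi u = chi v -> u = v.
Hypothesis chi_cover : forall b, exists a (v : 'rV[R]_(dm a)), `|v| < 1 /\ chi v = b.
Hypothesis chi_disj : forall a a' (u : 'rV[R]_(dm a)) (v : 'rV[R]_(dm a')),
  `|u| < 1 -> `|v| < 1 -> chi u = chi v -> a = a'.
Hypothesis chi_bd : forall a, exists F : set cell,
  [/\ finite_set F, forall a', F a' -> (dm a' < dm a)%N &
    forall v : 'rV[R]_(dm a), csphere _ v -> exists a', F a' /\
      exists u : 'rV[R]_(dm a'), `|u| < 1 /\ chi u = chi v].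
Hypothesis chi_weak : forall A : set B,
  (forall a, closed (A `&` (@chi a) @` cball _)) -> closed A.

Definition skel m : set B :=
  [set b | exists a (v : 'rV[R]_(dm a)), [/\ (dm a < m)%N, `|v| < 1 & chi v = b]].

Lemma chi_skel a m (v : 'rV[R]_(dm a)) : (dm a < m)%N -> cball _ v -> skel m (chi v).
Proof.
move=> am vb; have [v1|v1] := ltP `|v| 1; first by exists a, v.
have vs : csphere _ v by apply/eqP; rewrite eq_le v1 andbT.
have [F [_ Fa Fv]] := chi_bd a; have [a' [Fa' [u [u1 ue]]]] := Fv v vs.
by exists a', u; split => //; apply: ltn_trans am; exact: Fa.
Qed.

Lemma chi_sphere_skel a (v : 'rV[R]_(dm a)) : csphere _ v -> skel (dm a) (chi v).
Proof.
move=> vs; have [F [_ Fa Fv]] := chi_bd a; have [a' [Fa' [u [u1 ue]]]] := Fv v vs.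
by exists a', u; split => //; exact: Fa.
Qed.

(** The trace of [A] on a closed cell of dimension at least [m] misses the open cell, because [A]
    lies in the skeleton. It is thus covered by finitely many traces on closed cells of dimension
    below [m]. *)
Lemma skel_closed_weak m (A : set B) : A `<=` skel m ->
  (forall a, (dm a < m)%N -> closed (A `&` (@chi a) @` cball _)) -> closed A.
Proof.
move=> Am cA; apply: chi_weak => a; have [|am] := ltnP (dm a) m; first exact: cA.
have [F [finF Fa Fv]] := chi_bd a.
have cE : closed ((@chi a) @` cball _).
  apply: compact_closed => //; apply: continuous_compact;
    [exact: chiC|exact: compact_cball].
rewrite [X in closed X](_ : _ = (\bigcup_(a' in (F `&` [set a' | (dm a' < m)%N] : set
  {classic cell}))
    (A `&` (@chi a') @` cball _)) `&` ((@chi a) @` cball _)); last first.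
  apply/seteqP; split => b; last by move=> [[a' _ [Ab _]] ?].
  move=> [Ab [v vb ve]]; split; last by exists v.
  have [a1 [v1 [a1m v11 v1e]]] := Am _ Ab.
  have [va|va] := ltP `|v| 1.
    have e : a = a1 by apply: (chi_disj va v11); rewrite ve v1e.
    by move: a1m; rewrite -e ltnNge am.
  have vs : csphere _ v by apply/eqP; rewrite eq_le va andbT.
  have [a' [Fa' [u [u1 ue]]]] := Fv v vs.
  have e : a' = a1 by apply: (chi_disj u1 v11); rewrite ue ve v1e.
  exists a'; first by split => //=; rewrite e.
  by split => //; exists u; [rewrite /cball /= ltW|rewrite ue].
apply: closedI => //; apply: closed_bigcup => [|a' [Fa' a'm]]; last exact: cA.
exact: finite_setIl.
Qed.

(** The product with a compact interval keeps the weak topology. Around a point (b, t) outside [A]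
    there is a compact interval [J] such that [A] misses {b} x [J]. The projection of the part of
    [A] over [J] is closed, since its trace on each cell is a compact image; its complement times
    [J] is the required neighbourhood. *)
Lemma skel_prod_closed_weak m (A : set (B * R)) : A `<=` skel m `*` cball R ->
  (forall a, (dm a < m)%N ->
    closed [set x : 'rV[R]_(dm a) * R | cball ('rV[R]_(dm a) * R)%type x /\ A (chi x.1,
      x.2)]) ->
  closed A.
Proof.
move=> Am cA; rewrite -[A]setCK; apply: open_closedC; rewrite openE => -[b t] nA.
have cAb : closed [set s | A (b, s)].
  have [[a [v [am v1 ve]]]|nb] := pselect (skel m b); last first.
    rewrite [X in closed X](_ : _ = set0); first exact: closed0.
    by apply/seteqP; split => // s /Am[/nb].
  rewrite [X in closed X](_ : _ = (fun s => (v, s)) @^-1`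
     [set x : 'rV[R]_(dm a) * R | cball ('rV[R]_(dm a) * R)%type x /\ A (chi x.1, x.2)]).
    by apply: closed_comp; [move=> s _; apply: ctspair; cts|exact: cA].
  apply/seteqP; split => s /=; rewrite ve; last by case.
  move=> As; split => //; rewrite cball_prod; split => /=; last by have [] := Am _ As.
  exact: ltW.
have /nbhs_ballP[e /= e0 eA] : nbhs t (~` [set s | A (b, s)]).
  by apply: open_nbhs_nbhs; split => //; exact: closed_openC.
pose J : set R := `[t - e / 2, t + e / 2]%classic.
have JE s : J s <-> `|t - s| <= e / 2.
  rewrite /J /= in_itv /= ler_norml; split => /andP[? ?]; apply/andP; split; lra.
have cJ : compact J by exact: segment_compact.
pose AJ := [set b' | exists2 s, J s & A (b', s)].
have cAJ : closed AJ.
  apply: (@skel_closed_weak m); first by move=> b' [s _ /Am[]].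
  move=> a am.
  pose K : set ('rV[R]_(dm a) * R) := [set x | cball ('rV[R]_(dm a) * R)%type x /\ A
    (chi x.1, x.2)] `&` (setT `*` J).
  rewrite [X in closed X](_ : _ = (fun x : 'rV[R]_(dm a) * R => chi x.1) @` K);
    last first.
    apply/seteqP; split => b'.
      move=> [[s Js As] [v vb ve]]; exists (v, s) => //; split => //=; split;
        last by rewrite ve.
      by rewrite cball_prod; split => //=; have [] := Am _ As.
    move=> [[v s] [[vb As] [_ Js]] <-]; split; first by exists s.
    by exists v => //; move: vb; rewrite cball_prod => -[].
  apply: compact_closed => //; apply: continuous_compact.
    apply: (within_comp (@chiC a)); first by apply: continuous_subspaceT; cts.
    by move=> [v s] [[]]; rewrite cball_prod => -[].
  apply: (@subclosed_compact _ _ (cball 'rV[R]_(dm a) `*` cball R)).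
  - apply: closedI; first exact: cA.
    by apply: closed_setX; [exact: closedT|apply: compact_closed => //;
      exact: Rhausdorff].
  - by apply: compact_setX; [exact: compact_cball|exact: compact_cballR].
  - by move=> x [[]]; rewrite cball_prod.
exists (~` AJ, ball t (e / 2)) => /=.
  split; last by apply: nbhsx_ballx; lra.
  apply: open_nbhs_nbhs; split; first exact: closed_openC.
  move=> [s /JE ts As]; apply: (eA s) => //=.
  by rewrite -ball_normE /=; lra.
move=> [b' s] [/= nAJ]; rewrite -ball_normE /= => ts As; apply: nAJ; exists s => //.
by apply/JE; exact: ltW.
Qed.

Variables (P : topologicalType) (p : P -> B) (k n : nat) (w : B -> P)
  (V : 'I_n.+1 -> set B) (sg : 'I_n.+1 -> B -> P).
Hypothesis lp : lifting R p.
Hypothesis ext : forall i, (i <= k)%N -> sphere_extensible R p i.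
Hypotheses (wC : continuous w) (pw : forall b, p (w b) = b).
Hypotheses (oV : forall i, open (V i)) (covV : forall b, exists i, V i b)
  (sgC : forall i, {within V i, continuous (sg i)})
  (psg : forall i b, V i b -> p (sg i b) = b).

(** Continuity is imposed cell by cell and only below dimension [m], and so is the covering
    property. Over the remaining cells the two ends of the cylinder are already prescribed, being
    part of the boundary data of later prisms. *)
Definition section_stage (m : nat) (W : 'I_n.+1 -> set (B * R)) (G : 'I_n.+1 -> B * R
  -> P) :=
  [/\ forall a, (dm a < m)%N -> forall i,
        partial_continuous (cball ('rV[R]_(dm a) * R)%type)
          (fun x => W i (chi x.1, x.2)) (fun x => G i (chi x.1, x.2)),
      forall i b t, cball R t -> W i (b, t) -> p (G i (b, t)) = b,
      forall b t, skel m b -> cball R t -> exists i, W i (b, t),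
      forall i b, (W i (b, -1) <-> V i b) /\ (V i b -> G i (b, -1) = sg i b) &
      forall i b, W i (b, 1) /\ G i (b, 1) = w b].

Lemma stage_continuous m W G : section_stage m W G ->
  forall i, partial_continuous (skel m `*` cball R) (W i) (G i).
Proof.
move=> [cW _ _ _ _] i C cC; apply: (@skel_prod_closed_weak m).
  by move=> [b t] /= [[]].
move=> a am.
rewrite [X in closed X](_ : _ = [set x : 'rV[R]_(dm a) * R | cball ('rV[R]_(dm a) *
  R)%type x /\
   (W i (chi x.1, x.2) -> C (G i (chi x.1, x.2)))]); first exact: cW.
apply/seteqP; split => -[v t] /=; first by move=> [? [_ ?]].
move=> [xb h]; split => //; split => //.
by move: xb; rewrite cball_prod => -[vb tb]; split => //=; exact: chi_skel.
Qed.

Lemma stage0 : exists W G, section_stage 0 W G.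
Proof.
exists (fun i => [set x | (x.2 = -1 /\ V i x.1) \/ x.2 = 1]),
  (fun i x => if x.2 == -1 then sg i x.1 else w x.1).
have n1 : (1 : R) == -1 = false by apply/eqP; lra.
split => //.
- move=> i b t _ /=; case=> [[-> Vb]|->]; first by rewrite eqxx psg.
  by rewrite n1 pw.
- by move=> b t [a [v []]].
- move=> i b /=; rewrite eqxx; split => //; split => [[[]//|/eqP]|Vb]; last by left.
  by rewrite eq_sym n1.
- by move=> i b /=; rewrite n1; split => //; right.
Qed.

Lemma csphere_prodE (Q : normedModType R) : csphere (Q * R)%type =
  (csphere Q `*` cball R) `|` ((cball Q `*` [set -1]) `|` (cball Q `*` [set 1])).
Proof.
apply/seteqP; split => -[v t].
  case/csphere_prod => [[? ?]|[? /csphereR[]?]]; first by left.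
    by right; left.
  by right; right.
move=> h; apply/csphere_prod; case: h => [[? ?]|[[? /= ->]|[? /= ->]]]; first by left.
  by right; split => //; apply/csphereR; left.
by right; split => //; apply/csphereR; right.
Qed.

(** The boundary of the prism over a cell of dimension [m] is the side, where the previous stage is
    continuous, the bottom, which carries [sg], and the top, which carries [w]. The three closed
    pieces give continuous boundary data for the extension over the prism. *)
Lemma stage_step m : (m.+1 < n.+1 * k.+1)%N ->
  (exists W G, section_stage m W G) -> exists W G, section_stage m.+1 W G.
Proof.
move=> dim [W [G st]]; have stc := stage_continuous st.
have [cW pG cov bot top] := st.
have step a : exists WG : ('I_n.+1 -> set ('rV[R]_(dm a) * R)) * ('I_n.+1 -> 'rV[R]_(dm
  a) * R -> P),
    dm a = m ->
    [/\ forall j, partial_continuous (cball ('rV[R]_(dm a) * R)%type) (WG.1 j) (WG.2 j),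
    forall j z, cball ('rV[R]_(dm a) * R)%type z -> WG.1 j z -> p (WG.2 j z) = chi z.1,
    forall z, cball ('rV[R]_(dm a) * R)%type z -> exists j, WG.1 j z &
    forall j z, csphere ('rV[R]_(dm a) * R)%type z ->
      (WG.1 j z <-> W j (chi z.1, z.2)) /\ (W j (chi z.1, z.2) -> WG.2 j z = G j (chi
        z.1, z.2))].
  have [am|] := pselect (dm a = m); last by exists (fun=> set0, fun _ _ => w (@chi a 0)).
  have dim' : ((dm a).+1 < n.+1 * k.+1)%N by rewrite am.
  have [||||Wa [Ga H]] := @cell_extension_prod R P B p k n (dm a) w (fun x => chi x.1)
    (fun i x => W i (chi x.1, x.2)) (fun i x => G i (chi x.1, x.2)) lp ext dim';
      last by exists (Wa, Ga).
  - apply: (within_comp (@chiC a)); first by apply: continuous_subspaceT; cts.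
    by move=> [v t]; rewrite cball_prod => -[].
  - move=> i; rewrite csphere_prodE.
    have cV1 : closed (cball 'rV[R]_(dm a)) by exact: closed_cball.
    have cfst D : D `<=` cball 'rV[R]_(dm a) `*` setT ->
        {within D, continuous (fun x : 'rV[R]_(dm a) * R => chi x.1)}.
      move=> Db; apply: (within_comp (@chiC a)); first by apply: continuous_subspaceT;
        cts.
      by move=> x /Db[].
    apply: partial_continuous_setU; last apply: partial_continuous_setU.
    + apply: (partial_continuous_within (u := fun x => (chi x.1, x.2)) _ _ _ (stc i)).
      * by apply: closed_setX; [exact: closed_csphere|exact: closed_cball].
      * apply: within_pair; last by apply: continuous_subspaceT; cts.
        by apply: cfst => -[v t] [/csphere_cball ? ?].
      * by move=> [v t] [/= vs ?]; split => //=; rewrite -am; exact: chi_sphere_skel.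
    + have pV : partial_continuous [set: B] (V i) (sg i).
        by apply: partial_continuous_open => //; rewrite setTI.
      apply: (@partial_continuous_eq _ _ _ (fun x => V i (chi x.1)) _ (fun x => sg i
        (chi x.1))).
      * by move=> [v t] [/= _ ->]; have [] := bot i (chi v) => -[].
      * by move=> [v t] [/= _ ->] Vv; have [_ ->] := bot i (chi v).
      apply: partial_continuous_within pV => //.
      * by apply: closed_setX => //; exact: closed_eq.
      * by apply: cfst => -[v t] [].
    + have pw' : partial_continuous [set: B] setT w.
        by apply: partial_continuous_open => //;
          [exact: openT|exact: continuous_subspaceT].
      apply: (@partial_continuous_eq _ _ _ setT _ (fun x => w (chi x.1))).
      * by move=> [v t] [/= _ ->]; have [] := top i (chi v).
      * by move=> [v t] [/= _ ->] _; have [_ ->] := top i (chi v).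
      apply: (partial_continuous_within (O := setT) _ _ _ pw') => //.
      * by apply: closed_setX => //; exact: closed_eq.
      * by apply: cfst => -[v t] [].
  - move=> i [v t]; move=> /csphere_cball; rewrite cball_prod => -[vb tb] Wv.
    exact: pG.
  - move=> [v t]; rewrite csphere_prodE => -[[vs tb]|[[vb /= ->]|[vb /= ->]]].
    + by apply: cov => //; rewrite -am; exact: chi_sphere_skel.
    + by have [i Vi] := covV (chi v); exists i; have [[_ h] _] := bot i (chi v); exact: h.
    + by exists ord0; have [] := top ord0 (chi v).
pose WG a := sval (cid (step a)).
have HWG a : dm a = m -> _ := svalP (cid (step a)).
(* Each point lies in exactly one open cell, and the new data are read in its coordinates there.
   Boundary points of a cell of dimension [m] belong to lower cells and keep the old data, with
   which the extension agrees on the sphere. *)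
have loc b : {av : {a & 'rV[R]_(dm a)} | `|projT2 av| < 1 /\ chi (projT2 av) = b}.
  by apply: cid; have [a [v h]] := chi_cover b; exists (existT _ a v).
have locE a (v : 'rV[R]_(dm a)) : `|v| < 1 -> sval (loc (chi v)) = existT _ a v.
  move=> v1; case: (loc (chi v)) => -[a' v'] /= [v'1 e].
  have ea := chi_disj v'1 v1 e; subst a'.
  by rewrite (chi_inj v'1 v1 e).
pose W' i : set (B * R) := [set x | let: existT a v := sval (loc x.1) in
  if dm a == m then (WG a).1 i (v, x.2) else W i x].
pose G' i (x : B * R) : P := let: existT a v := sval (loc x.1) in
  if dm a == m then (WG a).2 i (v, x.2) else G i x.
have W'E i a (v : 'rV[R]_(dm a)) t : `|v| < 1 ->
    W' i (chi v, t) = if dm a == m then (WG a).1 i (v, t) else W i (chi v, t).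
  by move=> v1; rewrite /W' /= locE.
have G'E i a (v : 'rV[R]_(dm a)) t : `|v| < 1 ->
    G' i (chi v, t) = if dm a == m then (WG a).2 i (v, t) else G i (chi v, t).
  by move=> v1; rewrite /G' /= locE.
have old i b t : skel m b -> W' i (b, t) = W i (b, t) /\ G' i (b, t) = G i (b, t).
  move=> [a [v [am v1 <-]]]; rewrite W'E // G'E //.
  by rewrite (ltn_eqF am).
exists W', G'; split.
- move=> a; rewrite ltnS leq_eqVlt => /orP[/eqP am|am] i; last first.
    apply: partial_continuous_eq (cW a am i).
      move=> [v t]; rewrite cball_prod => -[/= vb tb].
      by have [-> _] := old i (chi v) t (chi_skel am vb).
    move=> [v t]; rewrite cball_prod => -[/= vb tb] _.
    by have [_ ->] := old i (chi v) t (chi_skel am vb).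
  have [h1 _ _ h4] := HWG a am.
  have H x : cball ('rV[R]_(dm a) * R)%type x ->
      ((WG a).1 i x <-> W' i (chi x.1, x.2)) /\
      ((WG a).1 i x -> (WG a).2 i x = G' i (chi x.1, x.2)).
    case: x => v t xb; have := xb; rewrite cball_prod => -[/= vb tb].
    have [v1|v1] := ltP `|v| 1; first by rewrite W'E // G'E // (introT eqP am).
    have vs : csphere _ v by apply/eqP; rewrite eq_le v1 andbT.
    have sk : skel m (chi v) by rewrite -am; exact: chi_sphere_skel.
    have [-> ->] := old i _ t sk.
    have [e1 e2] := h4 i (v, t) ltac:(by apply/csphere_prod; left).
    by split => // /e1 /e2.
  apply: partial_continuous_eq (h1 i) => x xb; first by have [] := H x xb.
  by have [_] := H x xb.
- move=> i b t tb; have [a [v [v1 <-]]] := chi_cover b.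
  rewrite W'E // G'E //; case: eqP => [am|_]; last exact: pG.
  have [_ h2 _ _] := HWG a am; move=> /h2 -> //.
  by rewrite cball_prod; split => //=; exact: ltW.
- move=> b t [a [v [+ v1 <-]]] tb; rewrite ltnS leq_eqVlt => /orP[/eqP am|am].
    have [_ _ h3 _] := HWG a am.
    have [|i Wi] := h3 (v, t); first by rewrite cball_prod; split => //=; exact: ltW.
    by exists i; rewrite W'E // (introT eqP am).
  have [|i Wi] := cov (chi v) t _ tb; first by exists a, v.
  by exists i; rewrite W'E // (ltn_eqF am).
- move=> i b; have [a [v [v1 <-]]] := chi_cover b.
  rewrite W'E // G'E //; case: eqP => [am|_]; last exact: bot.
  have [_ _ _ h4] := HWG a am.
  have [|e1 e2] := h4 i (v, -1).
    by apply/csphere_prod; right; split; [exact: ltW|apply/csphereR; left].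
  have [e3 e4] := bot i (chi v); split; first by rewrite /= in e1; rewrite e1.
  by move=> Vv; rewrite e2 /= ?e4 //; apply/e3.
- move=> i b; have [a [v [v1 <-]]] := chi_cover b.
  rewrite W'E // G'E //; case: eqP => [am|_]; last exact: top.
  have [_ _ _ h4] := HWG a am.
  have [|e1 e2] := h4 i (v, 1).
    by apply/csphere_prod; right; split; [exact: ltW|apply/csphereR; right].
  have [e3 e4] := top i (chi v); rewrite e2 //=; split => //.
  by apply/e1.
Qed.

Lemma sections_over_cylinder (N : nat) : (forall a, (dm a < N)%N) ->
  (N < n.+1 * k.+1)%N ->
  exists (W : 'I_n.+1 -> set (B * R)) (G : 'I_n.+1 -> B * R -> P),
  [/\ forall i, partial_continuous ([set: B] `*` cball R) (W i) (G i),
      forall i b t, cball R t -> W i (b, t) -> p (G i (b, t)) = b,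
      forall b t, cball R t -> exists i, W i (b, t),
      forall i b, (W i (b, -1) <-> V i b) /\ (V i b -> G i (b, -1) = sg i b) &
      forall i b, W i (b, 1) /\ G i (b, 1) = w b].
Proof.
move=> dN NK.
have [W [G st]] : exists W G, section_stage N W G.
  elim: N NK {dN} => [_|m IH mK]; first exact: stage0.
  by apply: stage_step => //; apply: IH; exact: ltnW.
have skN b : skel N b by have [a [v [v1 ve]]] := chi_cover b; exists a, v.
have stc := stage_continuous st; have [_ h2 h3 h4 h5] := st.
exists W, G; split => //.
- have <- // : skel N = setT by apply/seteqP; split.
- by move=> b t; exact: h3.
Qed.

End cells.

(** * Fibrewise deformation of a neighbourhood of the section *)

Lemma sup_continuous (R : realType) (X T : topologicalType) (F : X * T -> R) (K : set T) :
  continuous F -> compact K -> K !=set0 ->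
  continuous (fun x => sup ((fun t => F (x, t)) @` K)).
Proof.
move=> cF cK [t0 Kt0].
have hs x : has_sup ((fun t => F (x, t)) @` K).
  apply: compact_has_sup; first by exists (F (x, t0)), t0.
  apply: continuous_compact => //; apply: continuous_subspaceT.
  by apply: (@ctscomp _ _ _ F (fun t => (x, t))) => //; cts.
move=> x; apply/cvgrPdist_le => e e0.
have near_all : \forall y \near x, K `<=` (fun t => `|F (x, t) - F (y, t)| <= e).
  move/compact_near_coveringP/near_covering_withinP : cK; apply => t Kt.
  have e2 : 0 < e / 2 by rewrite divr_gt0.
  have /cvgrPdist_le/(_ _ e2) [[P1 P2] /= [n1 n2] k] := cF (x, t).
  exists (P2, P1) => //= -[t' y] [/= h2 h1] _.
  have := k (y, t') (conj h1 h2); have := k (x, t') (conj (nbhs_singleton n1) h2).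
  rewrite /= => k1 k2.
  have -> : F (x, t') - F (y, t') = (F (x, t) - F (y, t')) - (F (x, t) - F (x, t')) by
    lra.
  by apply: le_trans (ler_normB _ _) _; lra.
have le_sup a b : (forall t, K t -> F (a, t) <= F (b, t) + e) ->
    sup ((fun t => F (a, t)) @` K) <= sup ((fun t => F (b, t)) @` K) + e.
  move=> h; apply: ge_sup; first by exists (F (a, t0)), t0.
  move=> _ [t Kt <-]; apply: le_trans (h t Kt) _; rewrite lerD2r.
  by apply: ub_le_sup; [have [] := hs b|exists t].
apply: filterS near_all => y h.
have k1 := @le_sup x y; have k2 := @le_sup y x.
rewrite ler_norml; apply/andP; split.
  have : sup ((fun t => F (y, t)) @` K) <= sup ((fun t => F (x, t)) @` K) + e.
    by apply: k2 => t Kt; have := h t Kt; rewrite ler_norml; lra.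
  lra.
have : sup ((fun t => F (x, t)) @` K) <= sup ((fun t => F (y, t)) @` K) + e.
  by apply: k1 => t Kt; have := h t Kt; rewrite ler_norml; lra.
lra.
Qed.

Definition homotopy_extension (R : realType) (B X : topologicalType) (s : B -> X) :=
  forall (Z : topologicalType) (g : X -> Z) (G : B * R -> Z),
  continuous g -> {within [set: B] `*` [set t : R | 0 <= t <= 1], continuous G} ->
  (forall b, G (b, 0) = g (s b)) ->
  exists H : X * R -> Z,
    [/\ {within [set: X] `*` [set t : R | 0 <= t <= 1], continuous H},
      forall x, H (x, 0) = g x &
      forall b t, 0 <= t <= 1 -> H (s b, t) = G (b, t)].
Arguments homotopy_extension R {B X} s.

Lemma unit_clampC (R : realType) : continuous (@unit_clamp R).
Proof. by rewrite /unit_clamp; cts. Qed.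
Lemma unit_clampI (R : realType) (t : R) : 0 <= unit_clamp t <= 1.
Proof. by rewrite /unit_clamp; mm; lra. Qed.
Lemma unit_clamp_id (R : realType) (t : R) : 0 <= t <= 1 -> unit_clamp t = t.
Proof. by rewrite /unit_clamp; mm; lra. Qed.

Section ndr.
Variables (R : realType) (B X : topologicalType) (s : B -> X).
Hypotheses (sC : continuous s) (sR : closed (range s)) (hep : homotopy_extension R s).

(** Extending homotopies into the mapping cylinder [M] yields a retraction [r] onto it. As in the
    construction of Strøm, [u x] is the supremum of t minus the second coordinate of [r (x, t)]. If
    [u x < t], that coordinate is positive, so the first one lies on the section. *)
Lemma ndr_pair : exists (u : X -> R) (c : X * R -> X),
  [/\ continuous u, continuous c, forall x, 0 <= u x, forall x, u x = 0 -> range s x &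
   [/\ forall x, c (x, 0) = x, forall b t, c (s b, t) = s b, forall b, u (s b) = 0 &
      forall x t, u x < t -> t <= 1 -> range s (c (x, t))]].
Proof.
pose M : set (X * R) := [set y | y.2 = 0 \/ range s y.1].
pose Z : topologicalType := set_type M.
have m0 x : M (x, 0) by left.
have ms b t : M (s b, t) by right; exists b.
have [|||H [cH H0 Hs]] := hep (Z := Z) (g := fun x => SigSub (mem_set (m0 x)))
  (G := fun y => SigSub (mem_set (ms y.1 y.2))).
- apply: (@continuous_comp_initial _ X _ (@set_val _ M)).
  rewrite (_ : _ \o _ = fun x => (x, 0)); last by apply/funext.
  by cts.
- apply: (@continuous_comp_initial _ _ _ (@set_val _ M)).
  apply: (@within_eq _ _ _ (fun y : B * R => (s y.1, y.2))) => //.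
  by apply: continuous_subspaceT; cts.
- by move=> b; apply: val_inj.
have cv : continuous (set_val : Z -> X * R) by exact: initial_continuous.
have cC := @unit_clampC R.
pose r (y : X * R) := set_val (H (y.1, unit_clamp y.2)).
have cr : continuous r.
  rewrite /r; apply: ctscomp => //.
  apply/continuous_subspace_setT; apply: (within_comp cH);
    first by apply: continuous_subspaceT; cts.
  by move=> y _; split => //=; exact: unit_clampI.
have r0 x : r (x, 0) = (x, 0) by rewrite /r /= unit_clamp_id ?lexx ?ler01 // H0.
have rs b t : r (s b, t) = (s b, unit_clamp t) by rewrite /r /= Hs //; exact: unit_clampI.
have rM y : M (r y) by exact: set_valP.
pose K : set R := `[0, 1]%classic.
have KE t : K t <-> 0 <= t <= 1 by rewrite /K /= in_itv.
have cK : compact K by exact: segment_compact.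
pose F (y : X * R) := y.2 - (r y).2.
have cF : continuous F by rewrite /F; cts.
have K0 : K 0 by apply/KE; rewrite lexx ler01.
pose u x := sup ((fun t => F (x, t)) @` K).
have cu : continuous u by apply: sup_continuous => //; exists 0.
have Fu x t : 0 <= t <= 1 -> F (x, t) <= u x.
  move=> tI; apply: ub_le_sup; last by exists t => //; apply/KE.
  have [] // : has_sup ((fun t => F (x, t)) @` K).
  apply: compact_has_sup; first by exists (F (x, 0)), 0.
  apply: continuous_compact => //; apply: continuous_subspaceT.
  by apply: (@ctscomp _ _ _ F (fun t => (x, t))) => //; cts.
have u0 x : 0 <= u x.
  have := Fu x 0; rewrite lexx ler01 => /(_ isT); rewrite /F r0 /=; lra.
have uc x t : u x < t -> t <= 1 -> range s (r (x, t)).1.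
  move=> ut t1; have := Fu x t; have := u0 x => h0 h.
  have : F (x, t) <= u x by apply: h; lra.
  by rewrite /F /=; case: (rM (x, t)) => //= ->; lra.
exists u, (fun y => (r y).1); split => //.
- by cts.
- move=> x ux; apply: contrapT => nx.
  have nb : nbhs x (~` range s) by apply: open_nbhs_nbhs; split => //;
    exact: closed_openC.
  have c1 : continuous (fun t => (r (x, t)).1).
    by apply: ctsfst; apply: (@ctscomp _ _ _ r (fun t => (x, t))) => //; cts.
  have : nbhs (0 : R) [set t | ~ range s (r (x, t)).1].
    by apply: (c1 0 (~` range s)); rewrite r0.
  move=> /nbhs_ballP[e /= e0 he].
  pose t := Num.min 1 (e / 2).
  have t0 : 0 < t by rewrite /t; mm; lra.
  apply: (he t) => /=; last by apply: uc; [rewrite ux|rewrite /t; mm; lra].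
  by rewrite -ball_normE /= sub0r normrN ger0_norm ?(ltW t0) // /t; mm; lra.
split => //.
- by move=> x; rewrite r0.
- by move=> b t; rewrite rs.
- move=> b; apply/eqP; rewrite eq_le u0 andbT; apply: ge_sup;
  first by exists (F (s b, 0)), 0.
  by move=> _ [t /KE tI <-]; rewrite /F rs /= unit_clamp_id // subrr.
Qed.

Variable p : X -> B.
Hypotheses (pC : continuous p) (lp : lifting R p) (ps : forall b, p (s b) = b).

(* The path followed by [x] runs into the section and back along it, so that its
   projection is a loop of the form c c^-1; the lifted contraction of this loop
   makes the path vertical. *)
Lemma fibrewise_ndr : exists (u : X -> R) (h : X * R -> X),
  [/\ continuous u, forall x, 0 <= u x,
    {within [set: X] `*` [set t : R | 0 <= t <= 1], continuous h},
    forall x t, 0 <= t <= 1 -> p (h (x, t)) = p x &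
    [/\ forall x, h (x, 0) = x, forall b t, 0 <= t <= 1 -> h (s b, t) = s b,
      forall b, u (s b) = 0 & forall x, u x <= 1 -> h (x, 1) = s (p x)]].
Proof.
have [u [c [cu cc u0 uA [c0 cs us cA]]]] := ndr_pair.
(* The factor 2 gives [u x < v x] off the section, so that [c (x, v x)] has reached the section once
   [v x <= 1]. *)
pose v x := 2 * u x.
have cv : continuous v by rewrite /v; cts.
have v0 x : 0 <= v x by have := u0 x; rewrite /v; lra.
have vA x : v x <= 1 -> s (p (c (x, v x))) = c (x, v x).
  move=> v1; suff [b _ <-] : range s (c (x, v x)) by rewrite ps.
  have := u0 x; rewrite le_eqVlt => /orP[/eqP e|lt]; last by apply: cA => //;
    rewrite /v; lra.
  by rewrite /v -e mulr0 c0; apply: uA.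
(* Up to time [v x] the path follows [c]; from then until [2 * v x] it returns along the section,
   above the same points of [B]. *)
pose D : set (X * R) := [set y | v y.1 <= 1] `&` ([set y | 0 <= y.2] `&` [set y | y.2
  <= 2 * v y.1]).
have cD : closed D by apply: closedI; [|apply: closedI]; apply: closed_le_fun; cts.
pose L : set (X * R) := [set y | y.2 <= v y.1].
pose L' : set (X * R) := [set y | v y.1 <= y.2].
have cL : closed L by apply: closed_le_fun; cts.
have cL' : closed L' by apply: closed_le_fun; cts.
pose w (y : X * R) := if `[< L y >] then c y else s (p (c (y.1, 2 * v y.1 - y.2))).
have wL' y : D y -> L' y -> w y = s (p (c (y.1, 2 * v y.1 - y.2))).
  case: y => x t [/= v1 _] h; rewrite /w; case: asboolP => // h'.
  have e : t = v x by apply/eqP; rewrite eq_le; apply/andP; split; [exact: h'|exact: h].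
  by rewrite /= e (_ : 2 * v x - v x = v x) ?vA //; lra.
have cw : {within D, continuous w}.
  have -> : D = (D `&` L) `|` (D `&` L').
    apply/seteqP; split => [y Dy|y [[]//|[]//]].
    by rewrite /L /L'; case: (leP y.2 (v y.1)) => h; [left|right; split => //=;
      exact: ltW].
  apply: withinU_continuous; [exact: closedI|exact: closedI| |].
    apply: (@within_eq (X * R)%type X (D `&` L) c); first by move=> y [_ h];
      rewrite /w asboolT.
    exact: continuous_subspaceT.
  apply: (@within_eq (X * R)%type X (D `&` L') (fun y => s (p (c (y.1, 2 * v y.1 -
    y.2))))).
    by move=> y [Dy h]; rewrite wL'.
  by apply: continuous_subspaceT; cts.
(* The loop in [B] is at the parameter [m] of the projected path [c], both on the way out and on the
   way back. Lifting for the time [m] brings every point of it back to [p x]. *)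
pose m (y : X * R) := v y.1 - `|y.2 - v y.1|.
have cm : continuous m by rewrite /m; cts.
have mI y : D y -> 0 <= m y <= 1.
  case: y => x t [/= v1 [/= t0 t2]]; rewrite /m /=.
  by case: (ger0P (t - v x)) => ?; have := v0 x; lra.
have [|||||h [ch ph hw]] := lp (D := D) (s := w)
  (G := fun y => p (c (y.1.1, Num.max 0 (m y.1 - y.2)))) (m := m).
- exact: cw.
- by apply: continuous_subspaceT; cts.
- exact: continuous_subspaceT.
- exact: mI.
- move=> [x t] Dy; have [/= v1 [/= t0 t2]] := Dy; rewrite /= subr0.
  have -> : Num.max 0 (m (x, t)) = m (x, t) by have := mI _ Dy; mm; lra.
  rewrite /w; case: asboolP => h; rewrite ?ps; rewrite /m /L /= in h *;
    congr (p (c (_, _))).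
    by rewrite ler0_norm; lra.
  by move/negP: h; rewrite -ltNge => h; rewrite ger0_norm; lra.
have {}ph y : D y -> p (h y) = p y.1.
  by move=> Dy; rewrite ph //= subrr maxxx c0.
have D0 x : v x <= 1 -> D (x, 0) by move=> v1; split => //=; split => //=;
  have := v0 x; lra.
have h0 x : v x <= 1 -> h (x, 0) = x.
  move=> v1; rewrite hw; [|exact: D0|];
    last by rewrite /m /= sub0r normrN ger0_norm ?subrr.
  by rewrite /w asboolT ?c0 //; exact: v0.
have h1 x : v x <= 1 -> h (x, 2 * v x) = s (p x).
  move=> v1; have D1 : D (x, 2 * v x) by split => //=; split => //=; have := v0 x; lra.
  rewrite hw //; last first.
    by rewrite /m /= (_ : 2 * v x - v x = v x) ?ger0_norm ?subrr //; lra.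
  by rewrite wL' //= ?subrr ?c0 //; rewrite /L' /=; have := v0 x; lra.
(* The factor is 1 where [v x <= 1/2] and 0 where [v x >= 1], so that the deformation dies out and
   continues as the identity. *)
pose x0 x := unit_clamp (2 - 2 * v x).
have cC := @unit_clampC R.
have cx0 : continuous x0 by rewrite /x0; cts.
have x0I x : 0 <= x0 x <= 1 by exact: unit_clampI.
have DI x t : v x <= 1 -> 0 <= t <= 1 -> D (x, 2 * v x * (t * x0 x)).
  move=> v1 /andP[t0 t1]; have /andP[a b] := x0I x; split => //=.
  have h2 : 0 <= t * x0 x <= 1 by rewrite mulr_ge0 //= mulr_ile1.
  by split => /=; have := v0 x => ?; nra.
(* The deformation reaches the section only where [v x <= 1/2]; the function [2 * v x] turns this
   into the bound 1. *)
exists (fun x => 2 * v x), (fun y => if `[< v y.1 <= 1 >] then h (y.1, 2 * v y.1 * (y.2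
  * x0 y.1)) else y.1).
split.
- by cts.
- by move=> x; have := v0 x; lra.
- have -> : [set: X] `*` [set t : R | 0 <= t <= 1] =
     (([set: X] `*` [set t : R | 0 <= t <= 1]) `&` [set y | v y.1 <= 1]) `|`
     (([set: X] `*` [set t : R | 0 <= t <= 1]) `&` [set y | 1 <= v y.1]).
    apply/seteqP; split => [y Dy|y [[]//|[]//]].
    by case: (leP (v y.1) 1) => h2; [left|right; split => //=; exact: ltW].
  have cI : closed ([set: X] `*` [set t : R | 0 <= t <= 1]).
    apply: closed_setX; first exact: closedT.
    rewrite (_ : [set t : R | 0 <= t <= 1] = `[0, 1]%classic);
      first exact: interval_closed.
    by apply/seteqP; split => t; rewrite /= in_itv.
  apply: withinU_continuous.
  + by apply: closedI => //; apply: closed_le_fun; cts.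
  + by apply: closedI => //; apply: closed_le_fun; cts.
  + apply: (@within_eq (X * R)%type X _ (fun y => h (y.1, 2 * v y.1 * (y.2 * x0 y.1)))).
      by move=> y [_ /= v1]; rewrite asboolT.
    apply: (within_comp ch); first by apply: continuous_subspaceT; cts.
    by move=> [x t] [[_ /= tI] v1]; exact: DI.
  + apply: (@within_eq (X * R)%type X _ fst); last by apply: continuous_subspaceT; cts.
    move=> [x t] [[_ /= tI] v1]; case: asboolP => // v2.
    have x00 : x0 x = 0 by rewrite /x0 /unit_clamp; mm; lra.
    by rewrite x00 !mulr0 h0.
- move=> x t tI; case: asboolP => //= v1; exact: (ph (x, _) (DI _ _ v1 tI)).
split.
- by move=> x /=; case: asboolP => // v1; rewrite mul0r mulr0 h0.
- move=> b t tI /=; have vb : v (s b) = 0 by rewrite /v us mulr0.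
  have v1 : v (s b) <= 1 by rewrite vb.
  by rewrite asboolT // [X in h (_, X)](_ : _ = 0) ?h0 // vb mulr0 mul0r.
- by move=> b; rewrite /v us !mulr0.
- move=> x u1 /=; have v1 : v x <= 1 by have := v0 x; lra.
  have x01 : x0 x = 1 by rewrite /x0 /unit_clamp; mm; lra.
  by rewrite asboolT // x01 !mulr1 h1.
Qed.

End ndr.

(** * From the unit cube and the Euclidean disk to the unit ball *)

Local Notation Rr := (Rdefinitions.R : realType).

Lemma unitIE : unitI = [set t : Rr | 0 <= t <= 1].
Proof. by apply/seteqP; split => t; rewrite /unitI /= in_itv. Qed.

Lemma hurewicz_lifting (P B : topologicalType) (p : P -> B) :
  hurewicz_fibration p -> lifting Rr p.
Proof.
move=> fp; apply: total_lifting_lifting => T s G m cs cG cm mI G0.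
have [||H [cH H0 pH]] := fp T s G cs.
- exact: continuous_subspaceT.
- exact: G0.
rewrite unitIE in cH pH.
exists (fun z => H (z, m z)); split.
- apply/continuous_subspace_setT; apply: (within_comp cH); last by move=> z _;
  split => //=.
  by apply: continuous_subspaceT; cts.
- by move=> z; rewrite pH //=; exact: mI.
- by move=> z ->; rewrite H0.
Qed.

Section cube_ball.
Variables (R : realType) (n : nat).
Notation V := 'rV[R]_n.
Definition to_ball (v : V) : V := \row_i (2 * v ord0 i - 1).
Definition to_cube (z : V) : V := \row_i ((z ord0 i + 1) / 2).

Lemma to_cubeK : cancel to_cube to_ball.
Proof. by move=> z; apply/rowP => i; rewrite !mxE (_ : ord0 = 0) //; lra. Qed.
Lemma to_ballC : continuous to_ball.
Proof.
apply: cts_rV => i.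
rewrite (_ : (fun x => _) = (fun x : V => 2 * x ord0 i - 1));
  last by apply/funext => x; rewrite mxE.
have h : continuous (fun x : V => x ord0 i) by exact/cts_coord/ctsid.
by cts.
Qed.
Lemma to_cubeC : continuous to_cube.
Proof.
apply: cts_rV => i.
rewrite (_ : (fun x => _) = (fun x : V => (x ord0 i + 1) / 2));
  last by apply/funext => x; rewrite mxE.
have h : continuous (fun x : V => x ord0 i) by exact/cts_coord/ctsid.
by cts.
Qed.

Lemma to_ball_cball (v : V) : (forall i, 0 <= v ord0 i <= 1) -> cball V (to_ball v).
Proof.
by move=> h; apply/rV_norm_le => // i; rewrite mxE ler_norml; have := h i; lra.
Qed.
Lemma to_cube_cball z : cball V z -> forall i, 0 <= to_cube z ord0 i <= 1.
Proof.
move=> zb i; have := le_trans (rV_coord_le z i) zb; rewrite mxE ler_norml; lra.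
Qed.
Lemma to_ball_csphere (v : V) : (forall i, 0 <= v ord0 i <= 1) ->
  (exists i, v ord0 i = 0 \/ v ord0 i = 1) -> csphere V (to_ball v).
Proof.
move=> h [i vi]; apply/eqP; rewrite eq_le to_ball_cball //=.
apply: le_trans (rV_coord_le _ i); rewrite mxE; case: vi => ->.
  by rewrite mulr0 sub0r normrN normr1.
by rewrite mulr1 (_ : 2 - 1 = 1 :> R) ?normr1 //; lra.
Qed.
Lemma to_cube_csphere z : csphere V z ->
  exists i, to_cube z ord0 i = 0 \/ to_cube z ord0 i = 1.
Proof.
move=> zs; have [|i] := @rV_norm_attained _ _ z; first by rewrite zs.
by rewrite zs => /csphereR h; exists i; rewrite mxE; case: h => ->; [left|right]; lra.
Qed.
End cube_ball.

Lemma to_unit (R : realType) (t : R) : cball R t -> 0 <= (1 + t) / 2 <= 1.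
Proof. by move=> /cballR; lra. Qed.
Lemma of_unit (R : realType) (t : R) : 0 <= t <= 1 -> cball R (2 * t - 1).
Proof. by move=> h; apply/cballR; lra. Qed.

Section k_equivalence.
Variables (E X : topologicalType) (f : E -> X) (k : nat).
Hypotheses (cf : continuous f) (kf : k_equivalence f k).

Lemma cube_cball n (v : 'rV[Rr]_n) : cube n v -> cball _ (to_ball v).
Proof. exact: to_ball_cball. Qed.
Lemma cball_cube n (z : 'rV[Rr]_n) : cball _ z -> cube n (to_cube z).
Proof. exact: to_cube_cball. Qed.
Lemma cube_bdry_csphere n (v : 'rV[Rr]_n) : cube_bdry n v -> csphere _ (to_ball v).
Proof. by case=> cv; exact: to_ball_csphere. Qed.
Lemma csphere_cube_bdry n (z : 'rV[Rr]_n) : csphere _ z -> cube_bdry n (to_cube z).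
Proof. by move=> zs; split; [exact/cball_cube/csphere_cball|exact: to_cube_csphere]. Qed.

Lemma ball_of_homotopy (U : topologicalType) n (G : 'rV[Rr]_n * Rr -> U) :
  {within cube n `*` unitI, continuous G} ->
  {within cball 'rV[Rr]_n `*` cball Rr, continuous (fun y => G (to_cube y.1, (1 + y.2)
    / 2))}.
Proof.
move=> cG; have cC := @to_cubeC Rr n; apply: (within_comp cG).
  by apply: continuous_subspaceT; cts.
move=> [z t] [/= zb tb]; split => /=; first exact: cball_cube.
by rewrite unitIE; exact: to_unit.
Qed.

Lemma k_equivalence_surjective i : (i <= k)%N -> sphere_surjective (R := Rr) f 'rV[Rr]_i.
Proof.
move=> ik e0 g cg ge0; have [surj _] := kf e0 ik.
have cB := @to_ballC Rr i; have cC := @to_cubeC Rr i.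
have [|h [[ch hb] [G [cG G01 Gb]]]] := surj (g \o @to_ball Rr i).
  split; last by move=> v /cube_bdry_csphere /ge0.
  by apply: (within_comp cg); [exact: continuous_subspaceT|exact: cube_cball].
exists (h \o @to_cube Rr i), (fun y => G (to_cube y.1, (1 + y.2) / 2)); split.
- by apply: (within_comp ch); [exact: continuous_subspaceT|exact: cball_cube].
- by move=> v /csphere_cube_bdry /hb.
- exact: ball_of_homotopy.
- move=> v /cball_cube vb; have [h1 h2] := G01 _ vb.
  rewrite /= (_ : (1 + -1) / 2 = 0 :> Rr); last by lra.
  by rewrite (_ : (1 + 1) / 2 = 1 :> Rr) ?h1 ?h2 /= ?to_cubeK //; lra.
- move=> v t /csphere_cube_bdry vs tb; apply: Gb => //.
  by rewrite unitIE; exact: to_unit.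
Qed.

Lemma k_equivalence_injective i : (i < k)%N -> sphere_injective (R := Rr) f 'rV[Rr]_i.
Proof.
move=> ik e0 g K cg ge0 cK K1 Ks; have [_ inj] := kf e0 (ltnW ik).
have cB := @to_ballC Rr i; have cC := @to_cubeC Rr i.
have [||| G [cG G01 Gb]] := inj ik (g \o @to_ball Rr i) (fun=> e0).
- split; last by move=> v /cube_bdry_csphere /ge0.
  by apply: (within_comp cg); [exact: continuous_subspaceT|exact: cube_cball].
- by split => //; apply: continuous_subspaceT; exact: ctsC.
- exists (fun y => K (to_ball y.1, 2 * y.2 - 1)); split.
  + apply: (within_comp cK); first by apply: continuous_subspaceT; cts.
    move=> [v t] [/= vb]; rewrite unitIE => tI; split => /=; first exact: cube_cball.
    exact: of_unit.
  + move=> v /cube_cball vb; have [h1 h2] := K1 _ vb => /=.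
    rewrite (_ : 2 * 0 - 1 = -1 :> Rr); last by lra.
    by rewrite (_ : 2 * 1 - 1 = 1 :> Rr) //; lra.
  + move=> v t /cube_bdry_csphere vs; rewrite unitIE => tI; apply: Ks => //.
    exact: of_unit.
exists (fun y => G (to_cube y.1, (1 + y.2) / 2)); split.
- exact: ball_of_homotopy.
- move=> v /cball_cube vb; have [h1 h2] := G01 _ vb.
  rewrite /= (_ : (1 + -1) / 2 = 0 :> Rr); last by lra.
  by rewrite (_ : (1 + 1) / 2 = 1 :> Rr) ?h1 ?h2 /= ?to_cubeK //; lra.
- move=> v t /csphere_cube_bdry vs tb; apply: Gb => //.
  by rewrite unitIE; exact: to_unit.
Qed.

(** Base points are taken in [E], and the function from [X] to [E] supplies one in dimension 0.
    There the boundary of the cube is empty, so surjectivity at this base point joins any point of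
    [X] to the image of [f]. *)
Lemma k_equivalence_compressible : (X -> E) ->
  forall i, (i <= k)%N -> compressible (R := Rr) f 'rV[Rr]_i.
Proof.
move=> XE; apply: compressible_rV => //.
- move=> x; have [|v|c [L [_ _ cL L1 _]]] := @k_equivalence_surjective 0 (leq0n _) (XE
  x) (fun=> x).
  + by apply: continuous_subspaceT; exact: ctsC.
  + by rewrite /csphere /= thinmx0 normr0 => /eqP; rewrite eq_sym oner_eq0.
  have b0 : cball 'rV[Rr]_0 0 by rewrite /cball /= normr0.
  exists (c 0), (fun t => L (0, t)); have [-> ->] := L1 0 b0; split => //.
  apply: (within_comp cL); last by move=> t tb; split.
  by apply: continuous_subspaceT; apply: ctspair; [exact: ctsC|exact: ctsid].
- exact: k_equivalence_surjective.
- exact: k_equivalence_injective.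
Qed.

End k_equivalence.

Lemma continuous_quotient_scale (R : realType) (W : normedModType R) (T : topologicalType)
    (a b : T -> R) (c : T -> W) (x : T) :
  continuous a -> continuous b -> continuous c -> b x != 0 ->
  {for x, continuous (fun y => (a y / b y) *: c y)}.
Proof.
by move=> ca cb cc bx; exact: cvgZ (cvgM (ca x) (cvgV bx (cb x))) (cc x).
Qed.

Section radial.
Variables (R : realType) (n : nat).
Notation V := 'rV[R]_n.
Implicit Types v : V.

Definition sqn v : R := \sum_(i < n) v ord0 i ^+ 2.
(* a homeomorphism from the cube [-1, 1]^n onto the Euclidean disk; at 0 the junk
   quotient 0 / 0 = 0 gives the right value *)
Definition to_disk v : V := (`|v| / Num.sqrt (sqn v)) *: v.
Definition of_disk v : V := (Num.sqrt (sqn v) / `|v|) *: v.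

Lemma sqn_ge0 v : 0 <= sqn v.
Proof. by apply: sumr_ge0 => i _; exact: sqr_ge0. Qed.

Lemma norm_le_sqn v : `|v| <= Num.sqrt (sqn v).
Proof.
apply/rV_norm_le => [|i]; first exact: sqrtr_ge0.
rewrite -sqrtr_sqr ler_wsqrtr // /sqn (bigD1 i) //= lerDl.
by apply: sumr_ge0 => j _; exact: sqr_ge0.
Qed.

Lemma sqnZ c v : sqn (c *: v) = c ^+ 2 * sqn v.
Proof. by rewrite /sqn mulr_sumr; apply: eq_bigr => i _; rewrite mxE exprMn. Qed.

Lemma sqrt_sqnZ c v : 0 <= c -> Num.sqrt (sqn (c *: v)) = c * Num.sqrt (sqn v).
Proof. by move=> c0; rewrite sqnZ sqrtrM ?sqr_ge0 // sqrtr_sqr ger0_norm. Qed.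

Lemma sqrt_sqn_gt0 v : v != 0 -> 0 < Num.sqrt (sqn v).
Proof. by move=> v0; apply: lt_le_trans (norm_le_sqn v); rewrite normr_gt0. Qed.

Lemma sqn0 : sqn 0 = 0.
Proof. by rewrite /sqn big1 // => i _; rewrite mxE expr0n. Qed.

Lemma sqrt_sqn_to_disk v : Num.sqrt (sqn (to_disk v)) = `|v|.
Proof.
have [->|v0] := eqVneq v 0; first by rewrite /to_disk scaler0 sqn0 sqrtr0 normr0.
rewrite sqrt_sqnZ; last by rewrite divr_ge0 // sqrtr_ge0.
by rewrite -mulrA mulVf ?mulr1 // lt0r_neq0 // sqrt_sqn_gt0.
Qed.

Lemma sqn_to_disk v : sqn (to_disk v) = `|v| ^+ 2.
Proof. by rewrite -sqrt_sqn_to_disk sqr_sqrtr // sqn_ge0. Qed.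

Lemma norm_of_disk v : `|of_disk v| = Num.sqrt (sqn v).
Proof.
have [->|v0] := eqVneq v 0; first by rewrite /of_disk scaler0 sqn0 sqrtr0 normr0.
rewrite normrZ ger0_norm ?divr_ge0 ?sqrtr_ge0 //.
by rewrite -mulrA mulVf ?mulr1 // normr_eq0.
Qed.

Lemma of_diskK : cancel of_disk to_disk.
Proof.
move=> v; have [->|v0] := eqVneq v 0; first by rewrite /of_disk /to_disk !scaler0.
have s0 := sqrt_sqn_gt0 v0; have n0 : 0 < `|v| by rewrite normr_gt0.
rewrite {1}/to_disk norm_of_disk {1 2}/of_disk sqrt_sqnZ; last by rewrite divr_ge0 // ltW.
rewrite scalerA; set s := Num.sqrt _ in s0 *; set m := `|v| in n0 *.
have -> : s / (s / m * s) * (s / m) = 1 by field; rewrite !lt0r_neq0.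
by rewrite scale1r.
Qed.

Lemma to_diskK : cancel to_disk of_disk.
Proof.
move=> v; have [->|v0] := eqVneq v 0; first by rewrite /to_disk /of_disk !scaler0.
have s0 := sqrt_sqn_gt0 v0; have n0 : 0 < `|v| by rewrite normr_gt0.
rewrite {1}/of_disk sqrt_sqn_to_disk {1 2}/to_disk normrZ ger0_norm;
  last by rewrite divr_ge0 // ltW.
rewrite scalerA; set s := Num.sqrt _ in s0 *; set m := `|v| in n0 *.
have -> : m / (m / s * m) * (m / s) = 1 by field; rewrite !lt0r_neq0.
by rewrite scale1r.
Qed.

Lemma norm_to_disk v : `|to_disk v| <= `|v|.
Proof. by apply: le_trans (norm_le_sqn _) _; rewrite sqrt_sqn_to_disk. Qed.

Lemma to_diskC : continuous to_disk.
Proof.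
move=> v; have [->|v0] := eqVneq v 0.
  move=> A /nbhs_ballP[e /= e0 eA]; apply/nbhs_ballP; exists e => //= u.
  rewrite -ball_normE /= sub0r normrN => ue; apply: eA.
  rewrite -ball_normE /= {1}/to_disk scaler0 sub0r normrN.
  exact: le_lt_trans (norm_to_disk _) ue.
have cs : continuous sqn.
  apply: (@cts_sum R V _ _ (fun (i : 'I_n) (x : V) => x ord0 i ^+ 2)) => i.
  have h : continuous (fun x : V => x ord0 i) by exact/cts_coord/ctsid.
  have -> : (fun x : V => x ord0 i ^+ 2) = (fun x => x ord0 i * x ord0 i) by
    apply/funext => x; rewrite expr2.
  by cts.
apply: (@continuous_quotient_scale _ _ _ (fun x : V => `|x|) (fun x => Num.sqrt (sqn
  x)) (fun x : V => x)).
- exact: norm_continuous.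
- by apply: (@ctscomp _ _ _ Num.sqrt sqn) => //; exact: sqrt_continuous.
- exact: ctsid.
- by rewrite lt0r_neq0 // sqrt_sqn_gt0.
Qed.
End radial.

Section cw.
Variables (B : topologicalType) (C : CWstructure B).

(** Characteristic maps are moved from Euclidean disks to balls of the maximum norm, for which the
    product with an interval is a ball again. *)
Definition cw_ball (a : cw_cell B C) (v : 'rV[Rr]_(cw_dim C a)) : B := cw_char C a
  (to_disk v).

Lemma odiskE n (v : 'rV[Rr]_n) : odisk n (to_disk v) <-> `|v| < 1.
Proof.
rewrite (_ : odisk n (to_disk v) = is_true (sqn (to_disk v) < 1)) // sqn_to_disk.
by rewrite expr_lt1.
Qed.

Lemma diskE n (v : 'rV[Rr]_n) : disk n (to_disk v) <-> `|v| <= 1.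
Proof.
rewrite (_ : disk n (to_disk v) = is_true (sqn (to_disk v) <= 1)) // sqn_to_disk.
by rewrite expr_le1.
Qed.

Lemma dsphereE n (v : 'rV[Rr]_n) : csphere _ v -> dsphere n (to_disk v).
Proof.
move=> vs; rewrite (_ : dsphere n (to_disk v) = (sqn (to_disk v) = 1)) // sqn_to_disk.
by rewrite vs expr1n.
Qed.

Lemma odisk_ball n (u : 'rV[Rr]_n) : odisk n u -> `|of_disk u| < 1.
Proof. by move=> h; apply/odiskE; rewrite of_diskK. Qed.

Lemma cw_ball_continuous a : {within cball _, continuous (@cw_ball a)}.
Proof.
apply: (within_comp (cw_cont B C a)); first exact/continuous_subspaceT/to_diskC.
by move=> v vb; apply/diskE.
Qed.

Lemma cw_ball_inj a (u v : 'rV[Rr]_(cw_dim C a)) : `|u| < 1 -> `|v| < 1 ->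
  cw_ball u = cw_ball v -> u = v.
Proof.
move=> /odiskE u1 /odiskE v1 e; apply: (can_inj (@to_diskK _ _)).
exact: (cw_inj B C a _ _ u1 v1 e).
Qed.

Lemma cw_ball_cover b : exists a (v : 'rV[Rr]_(cw_dim C a)), `|v| < 1 /\ cw_ball v = b.
Proof.
have [a [v [v1 ve]]] := cw_cover B C b; exists a, (of_disk v).
by rewrite /cw_ball of_diskK; split => //; exact: odisk_ball.
Qed.

Lemma cw_ball_disj a a' (u : 'rV[Rr]_(cw_dim C a)) (v : 'rV[Rr]_(cw_dim C a')) :
  `|u| < 1 -> `|v| < 1 -> cw_ball u = cw_ball v -> a = a'.
Proof. by move=> /odiskE u1 /odiskE v1 e; exact: (cw_disj B C a a' _ _ u1 v1 e). Qed.

Lemma cw_ball_bd a : exists F : set (cw_cell B C),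
  [/\ finite_set F, forall a', F a' -> (cw_dim C a' < cw_dim C a)%N &
    forall v : 'rV[Rr]_(cw_dim C a), csphere _ v -> exists a', F a' /\
      exists u : 'rV[Rr]_(cw_dim C a'), `|u| < 1 /\ cw_ball u = cw_ball v].
Proof.
have [F [h1 h2 h3]] := cw_cf B C a; exists F; split => // v /dsphereE vs.
have [a' [Fa' [u [u1 ue]]]] := h3 _ vs; exists a'; split => //; exists (of_disk u).
by rewrite /cw_ball of_diskK; split => //; exact: odisk_ball.
Qed.

Lemma cw_ball_weak (A : set B) :
  (forall a, closed (A `&` (@cw_ball a) @` cball _)) -> closed A.
Proof.
move=> h; apply: (cw_weak B C) => a.
rewrite (_ : cw_char C a @` disk (cw_dim C a) = (@cw_ball a) @` cball _); first exact: h.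
apply/seteqP; split => b [v vb <-].
  exists (of_disk v); last by rewrite /cw_ball of_diskK.
  by apply/diskE; rewrite of_diskK.
by exists (to_disk v) => //; apply/diskE.
Qed.

End cw.

(** * Pointed local sections *)

Lemma within_closedU (T U : topologicalType) (D C1 C2 : set T) (g : T -> U) :
  closed C1 -> closed C2 -> D `<=` C1 `|` C2 ->
  {within D `&` C1, continuous g} -> {within D `&` C2, continuous g} ->
  {within D, continuous g}.
Proof.
move=> cC1 cC2 DC h1 h2; apply/continuous_closedP => K cK.
case/continuous_closedP/(_ _ cK)/closed_subspaceP: h1 => V1 cV1 e1.
case/continuous_closedP/(_ _ cK)/closed_subspaceP: h2 => V2 cV2 e2.
apply/closed_subspaceP; exists ((V1 `&` C1) `|` (V2 `&` C2)).
  by apply: closedU; exact: closedI.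
apply/seteqP; split => x.
  case=> -[[Vx Cx]|[Vx Cx]] Dx; split => //.
    have : (V1 `&` (D `&` C1)) x by [].
    by rewrite e1 => -[].
  have : (V2 `&` (D `&` C2)) x by [].
  by rewrite e2 => -[].
case=> Kx Dx; split => //; case: (DC _ Dx) => Cx; [left|right]; split => //.
  have : ((from_subspace (D `&` C1) g @^-1` K) `&` (D `&` C1)) x by [].
  by rewrite -e1 => -[].
have : ((from_subspace (D `&` C2) g @^-1` K) `&` (D `&` C2)) x by [].
by rewrite -e2 => -[].
Qed.

Lemma cofibration_extension (B X : topologicalType) (s : B -> X) :
  cofibration s -> homotopy_extension Rr s.
Proof.
move=> cof Z g G cg cG G0; rewrite -unitIE in cG.
have [H [cH H0 Hs]] := cof Z g G cg cG G0; rewrite unitIE in cH Hs.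
by exists H.
Qed.

Section pointed_cover.
Variables (B E X : topologicalType) (C : CWstructure B)
  (pE : E -> B) (sE : B -> E) (pX : X -> B) (sX : B -> X) (f : E -> X) (k n N : nat).
Hypotheses (csE : continuous sE) (pEs : forall b, pE (sE b) = b)
  (cpX : continuous pX) (csX : continuous sX) (pXs : forall b, pX (sX b) = b)
  (cf : continuous f) (pXf : forall e, pX (f e) = pE e) (fsE : forall b, f (sE b) = sX b)
  (fibE : hurewicz_fibration pE) (fibX : hurewicz_fibration pX)
  (cofX : closed_cofibration sX) (kf : k_equivalence f k).
Hypotheses (dimC : forall a, (cw_dim C a < N)%N) (NK : (N < n.+1 * k.+1)%N).

Let Pt : topologicalType := set_type (path_space (R := Rr) pE pX sX f).

(** Where [u > 1/2] the old section is used at the end [r] of the deformation; where [u < 1] the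
    family over the cylinder is pulled back along [th]. For 1/2 < u < 1 the point [r x] lies on the
    section and [tau x] is -1, and at that end the cylinder carries the restricted old sections, so
    both recipes agree. *)
Lemma pointed_cover : open_cover_by (fw_local_section pE pX f) n ->
  open_cover_by (fwp_local_section pE pX sE sX f) n.
Proof.
move=> [U [oU covU secU]].
have lE := hurewicz_lifting fibE; have lX := hurewicz_lifting fibX.
have [clX /cofibration_extension hepX] := cofX.
have [u [h [cu u0 ch ph [h0 hs us h1]]]] := fibrewise_ndr csX clX hepX cpX lX pXs.
have [s Hs] := choice secU.
have homU i : exists K : X * Rr -> X,
    [/\ {within U i `*` [set t : Rr | 0 <= t <= 1], continuous K},
      forall x, U i x -> K (x, 0) = f (s i x) /\ K (x, 1) = x &
      forall x t, U i x -> 0 <= t <= 1 -> pX (K (x, t)) = pX x].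
  have [_ _ [K [cK K1 K2]]] := Hs i.
  by rewrite unitIE in cK K2; exists K.
have [H HH] := choice homU.
pose V i : set B := [set b | U i (sX b)].
have oV i : open (V i) by apply: open_preimage.
have cs i : {within U i, continuous (s i)} by have [] := Hs i.
have ps i x : U i x -> pE (s i x) = pX x by have [_ h' _] := Hs i; exact: h'.
have secV i : exists g : B -> Pt, {within V i, continuous g} /\ forall b, V i b ->
    path_start (g b) = s i (sX b) /\
    forall t, cball Rr t -> path_eval (g b) t = H i (sX b, (1 + t) / 2).
  have [cH H1 pH] := HH i.
  apply: (path_mk pEs pXs fsE (e := fun b => s i (sX b)) (H := fun y => H i (sX y.1, (1
    + y.2) / 2))).
  - by apply: (within_comp (cs i)); [exact: continuous_subspaceT|].
  - apply: (within_comp cH); first by apply: continuous_subspaceT; cts.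
    by move=> [b t] [/= Vb tb]; split => //=; exact: to_unit.
  - move=> b Vb; have [e1 e2] := H1 _ Vb.
    rewrite /= (_ : (1 + -1) / 2 = 0 :> Rr); last by lra.
    by rewrite (_ : (1 + 1) / 2 = 1 :> Rr) ?ps ?pXs //; lra.
  - by move=> b t Vb tb; rewrite /= pH ?ps //; exact: to_unit.
have [sg Hsg] := choice secV.
have comp := k_equivalence_compressible cf kf (fun x => sE (pX x)).
have lP := path_base_lifting csX cf lE lX pEs pXs pXf fsE.
have ext i : (i <= k)%N -> sphere_extensible Rr (@path_base Rr B E X pE pX sX f : Pt ->
  B) i.
  move=> ik q g cq cg pg.
  exact: (path_space_extension cpX csX cf lE lX pEs pXs pXf fsE (comp i ik) cq cg pg).
have [||||W [G [cW pG covW bot top]]] := @sections_over_cylinder Rr B (cw_cell B C)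
  (cw_dim C)
    (@cw_ball B C) (cw_hausdorff B C) (@cw_ball_continuous B C)
    (@cw_ball_inj B C) (@cw_ball_cover B C) (@cw_ball_disj B C) (@cw_ball_bd B C)
    (@cw_ball_weak B C) Pt (@path_base Rr B E X pE pX sX f) k n (const_path Rr pEs pXs
      fsE)
    V sg lP ext (@const_pathC Rr B E X pE sE pX sX f csE csX pEs pXs fsE) _ oV _ _ _ N
      dimC NK.
- by move=> b; exact: pEs.
- by move=> b; exact: covU.
- by move=> i; have [] := Hsg i.
- move=> i b Vb; have [_ h'] := Hsg i; have [e _] := h' b Vb.
  by rewrite /path_base e ps.
pose r x := h (x, 1).
have I1 : 0 <= (1 : Rr) <= 1 by rewrite ler01 lexx.
have cr : continuous r.
  apply/continuous_subspace_setT; apply: (within_comp ch);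
    first by apply: continuous_subspaceT; cts.
  by move=> x _; split.
have pr x : pX (r x) = pX x by exact: ph.
(* [tau] is 1 on the section, where the cylinder carries constant paths, and -1 as soon as [u x]
   reaches 1/2. *)
pose tau x : Rr := clamp (1 - 4 * u x).
have cC := @clamp_cts Rr.
have ctau : continuous tau by rewrite /tau; cts.
have taub x : cball Rr (tau x) by exact: clamp_cball.
have tau_lo x : 2^-1 <= u x -> tau x = -1 by move=> ux; apply: clamp_lo; lra.
pose th x := (pX x, tau x).
have cth : continuous th by rewrite /th; cts.
pose U' i : set X := [set x | (u x < 1 /\ W i (th x)) \/ (2^-1 < u x /\ U i (r x))].
have WU i x : 2^-1 < u x -> u x < 1 -> W i (th x) <-> U i (r x).
  move=> ux1 ux2; rewrite /th tau_lo ?(ltW ux1) // /r h1 ?(ltW ux2) //.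
  by have [] := bot i (pX x).
have F1 i x : U' i x -> u x < 1 -> W i (th x).
  by move=> [[]//|[ux1 Ux]] ux2; apply/WU.
have F2 i x : U' i x -> 2^-1 < u x -> U i (r x).
  by move=> [[ux2 Wx]|[]//] ux1; apply/WU.
(* This homotopy ends at [r x], not at [x]: the paths of [G] end on the section, which is where
   [r x] lies when [u x < 1]. Their parameter interval [-1, 1] is rescaled to [0, 1]. *)
pose A i (y : X * Rr) : X := if u y.1 < 1 then path_eval (G i (th y.1)) (2 * y.2 - 1)
  else H i (r y.1, y.2).
pose s' i x : E := if u x < 1 then path_start (G i (th x)) else s i (r x).
have F3 i x : U' i x -> 2^-1 < u x -> s' i x = s i (r x) /\
    forall t, 0 <= t <= 1 -> A i (x, t) = H i (r x, t).
  move=> Ux ux1; rewrite /s' /A /=; case: ifP => // ux2.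
  have Vx : V i (pX x) by have := F2 i x Ux ux1; rewrite /r h1 // ltW.
  have [_ h'] := Hsg i; have [e1 e2] := h' _ Vx; have [_ e3] := bot i (pX x).
  rewrite /th tau_lo ?(ltW ux1) // e3 // e1 /r h1 ?(ltW ux2) //; split => // t tI.
  have et : (1 + (2 * t - 1)) / 2 = t :> Rr by lra.
  by rewrite e2 ?et //; exact: of_unit.
have cdom : closed ([set: B] `*` cball Rr) by apply: closed_setX;
  [exact: closedT|exact: closed_cball].
have cG i : {within ([set: B] `*` cball Rr) `&` W i, continuous (G i)}.
  by have /(partial_continuousP _ _ cdom)[] := cW i.
have cS := @path_startC Rr B E X pE pX sX f.
have cM := @path_evalC Rr B E X pE pX sX f.
have cu1 : open [set x | u x < 1] by apply: open_lt_fun => //; exact: ctsC.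
have cu2 : open [set x | 2^-1 < u x] by apply: open_lt_fun => //; exact: ctsC.
have ucov x : u x < 1 \/ 2^-1 < u x.
  by case: (ltP (u x) 1) => ?; [left|right]; lra.
exists U'; split.
- move=> i; have /(partial_continuousP _ _ cdom)[clW _] := cW i.
  rewrite (_ : U' i = ([set x | u x < 1] `&` th @^-1` (~` (([set: B] `*` cball Rr) `\`
    W i))) `|`
      ([set x | 2^-1 < u x] `&` r @^-1` U i)).
    apply: openU; apply: openI => //; apply: open_preimage => //.
    exact: closed_openC.
  apply/seteqP; split => x /=; case=> -[ux Wx]; [left|right|left|right]; split => //.
    by case.
  by apply: contrapT => h2; apply: Wx; split => //; split => //=.
- move=> x; case: (ucov x) => ux.
    by have [i Wi] := covW (pX x) (tau x) (taub x); exists i; left.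
  by have [i Ui] := covU (r x); exists i; right.
move=> i; have [cH H1 pH] := HH i.
have cGth : {within U' i `&` [set x | u x < 1], continuous (fun x => G i (th x))}.
  apply: (within_comp (cG i)); first exact: continuous_subspaceT.
  by move=> x [Ux ux]; split; [split => //=|exact: F1].
split.
  move=> _ [b _ <-]; left; rewrite us /th /tau us mulr0 subr0 clamp_id // pXs.
  by split => //; have [] := top i b.
have thb b : th (sX b) = (b, 1) by rewrite /th /tau us mulr0 subr0 clamp_id // pXs.
have topb b : path_start (G i (th (sX b))) = sE b /\
    forall t, path_eval (G i (th (sX b))) t = sX b.
  by rewrite thb; have [_ ->] := top i b.
exists (s' i); split.
- rewrite -[U' i](_ : U' i `&` ([set x | u x < 1] `|` [set x | 2^-1 < u x]) = _);
  last first.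
    by apply/seteqP; split => [x []//|x Ux]; split => //; exact: ucov.
  apply: within_openU => //.
    apply: (@within_eq _ _ _ (fun x => path_start (G i (th x)))).
      by move=> x [_ /= ux]; rewrite /s' ux.
    exact: within_postcomp.
  apply: (@within_eq _ _ _ (fun x => s i (r x))).
    by move=> x [Ux /= ux]; have [-> _] := F3 i x Ux ux.
  apply: (within_comp (cs i)); first exact: continuous_subspaceT.
  by move=> x [Ux ux]; exact: F2.
- move=> x Ux; case: (ucov x) => ux.
    rewrite /s' ux -[pE _]/(path_base _) /th pG //; exact: (F1 i x Ux ux).
  by have [-> _] := F3 i x Ux ux; rewrite ps ?pr //; exact: F2.
- by move=> b; rewrite /s' us ltr01; have [] := topb b.
have cA : {within U' i `*` [set t : Rr | 0 <= t <= 1], continuous (A i)}.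
  pose D := U' i `*` [set t : Rr | 0 <= t <= 1].
  pose O1 : set (X * Rr) := [set y | u y.1 < 1].
  pose O2 : set (X * Rr) := [set y | 2^-1 < u y.1].
  have oO1 : open O1 by apply: (@open_preimage _ _ (@fst X Rr) [set x | u x < 1]) =>
    //; cts.
  have oO2 : open O2 by apply: (@open_preimage _ _ (@fst X Rr) [set x | 2^-1 < u x]) =>
    //; cts.
  rewrite -/D -[D](_ : D `&` (O1 `|` O2) = _); last first.
    by apply/seteqP; split => [x []//|x Ux]; split => //; exact: ucov.
  apply: within_openU => //.
    apply: (@within_eq (X * Rr)%type X _ (fun y => path_eval (G i (th y.1)) (2 * y.2 -
      1))).
      by move=> y [_ /= uy]; rewrite /A uy.
    apply: (@within_comp _ _ _ _ setT (fun y : Pt * Rr => path_eval y.1 y.2)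
      (fun y : X * Rr => (G i (th y.1), 2 * y.2 - 1))) => //.
      exact: continuous_subspaceT.
    apply: within_pair; last by apply: continuous_subspaceT; cts.
    apply: (within_comp cGth); first by apply: continuous_subspaceT; cts.
    by move=> [x t] [[]].
  apply: (@within_eq (X * Rr)%type X _ (fun y => H i (r y.1, y.2))).
    by move=> [x t] [[/= Ux tI] ux]; have [_ ->] := F3 i x Ux ux.
  apply: (within_comp cH); first by apply: continuous_subspaceT; cts.
  by move=> [x t] [[/= Ux tI] ux]; split => //=; exact: F2.
have A0 x : U' i x -> A i (x, 0) = f (s' i x) /\ A i (x, 1) = r x.
  move=> Ux; case: (ucov x) => ux.
    have Wx := F1 i x Ux ux; have [_ y1 y2] := path_evalP (G i (th x)).
    rewrite /A /s' /= ux y1; last by lra.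
    by rewrite y2 ?pG // /r ?h1 ?(ltW ux) //; lra.
  have I0 : 0 <= (0 : Rr) <= 1 by rewrite ler01 lexx.
  have [-> AE] := F3 i x Ux ux; rewrite !AE //.
  by have [-> ->] := H1 _ (F2 i x Ux ux).
have pA x t : U' i x -> 0 <= t <= 1 -> pX (A i (x, t)) = pX x.
  move=> Ux tI; case: (ucov x) => ux.
    have Wx := F1 i x Ux ux; have [y0 _ _] := path_evalP (G i (th x)).
    by rewrite /A /= ux y0 pG.
  have [_ AE] := F3 i x Ux ux; rewrite AE // pH ?pr //; exact: F2.
(* The second half runs [h] backwards from [r x] to [x]. Both halves are stationary on the section,
   which makes the homotopy pointed. *)
exists (fun y => if y.2 <= 2^-1 then A i (y.1, 2 * y.2) else h (y.1, 2 - 2 * y.2)); split.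
- rewrite unitIE.
  apply: (@within_closedU _ _ _ [set y : X * Rr | y.2 <= 2^-1] [set y : X * Rr | 2^-1
    <= y.2]).
  + by apply: closed_le_fun; cts.
  + by apply: closed_le_fun; cts.
  + by move=> y _; case: (leP y.2 2^-1) => h'; [left|right; exact: ltW].
  + apply: (@within_eq (X * Rr)%type X _ (fun y => A i (y.1, 2 * y.2)));
    first by move=> y [_ /= ->].
    apply: (within_comp cA); first by apply: continuous_subspaceT; cts.
    by move=> [x t] [[/= Ux /andP[t0 t1]] t2]; split => //=; rewrite /= in t2; lra.
  + apply: (@within_eq (X * Rr)%type X _ (fun y => h (y.1, 2 - 2 * y.2))).
      move=> [x t] [[/= Ux _] t2]; case: ifP => // t3.
      have -> : t = 2^-1 by apply/eqP; rewrite eq_le t3.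
      rewrite (_ : 2 - 2 * 2^-1 = 1 :> Rr); last by lra.
      rewrite (_ : 2 * 2^-1 = 1 :> Rr); last by lra.
      by have [_ ->] := A0 x Ux.
    apply: (within_comp ch); first by apply: continuous_subspaceT; cts.
    by move=> [x t] [[/= Ux /andP[t0 t1]] t2]; split => //=; rewrite /= in t2; lra.
- move=> x Ux /=; have n0 : (0 : Rr) <= 2^-1 by lra.
  have n1 : ((1 : Rr) <= 2^-1) = false by apply/negbTE; rewrite -ltNge; lra.
  rewrite n0 n1 mulr0 mulr1 subrr h0; have [-> _] := A0 x Ux; by split.
- move=> x t Ux; rewrite unitIE /= => /andP[t0 t1]; case: (leP t 2^-1) => t2.
    by apply: pA => //; lra.
  by apply: ph; lra.
- move=> b t; rewrite unitIE /= => /andP[t0 t1]; case: (leP t 2^-1) => t2.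
    by rewrite /A /= us ltr01; have [_ ->] := topb b.
  by apply: hs; lra.
Qed.

End pointed_cover.

(** * Comparison of the two least numbers *)

Lemma least_opt_some (P : nat -> Prop) n : least_opt P = Some n ->
  P n /\ forall m, P m -> (n <= m)%N.
Proof.
rewrite /least_opt; case: asboolP => // -[m0 Pm0] [<-].
apply: (@xgetPex _ 0%N [set n | P n /\ forall m, P m -> (n <= m)%N]).
have exP : exists m, `[< P m >] by exists m0; apply/asboolP.
exists (ex_minn exP); case: ex_minnP => m /asboolP Pm mmin.
by split => // m' Pm'; apply: mmin; apply/asboolP.
Qed.

Lemma least_opt_none (P : nat -> Prop) n : least_opt P = None -> ~ P n.
Proof. by rewrite /least_opt; case: asboolP => // h _ Pn; apply: h; exists n. Qed.

(** The passage from [P] to [Q] is required only at the least value of [P], the value that the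
    dimension hypothesis mentions. If [P] never holds, neither does [Q], and both sides are
    infinite. *)
Lemma least_opt_eq (P Q : nat -> Prop) : (forall n, Q n -> P n) ->
  (forall n, least_opt P = Some n -> Q n) -> least_opt P = least_opt Q.
Proof.
move=> QP PQ; case eP : (least_opt P) => [n|]; case eQ : (least_opt Q) => [m|] //.
- have [Pn nmin] := least_opt_some eP; have [Qm mmin] := least_opt_some eQ.
  by congr Some; apply/eqP; rewrite eqn_leq nmin ?mmin //; [exact: PQ|exact: QP].
- by case: (least_opt_none (n := n) eQ); exact: PQ.
- by have [Qm _] := least_opt_some eQ; case: (least_opt_none (n := m) eP); exact: QP.
Qed.

Lemma fwp_fw_cover (B E X : topologicalType) (pE : E -> B) (pX : X -> B)
    (sE : B -> E) (sX : B -> X) (f : E -> X) n :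
  open_cover_by (fwp_local_section pE pX sE sX f) n ->
  open_cover_by (fw_local_section pE pX f) n.
Proof.
move=> [U [oU covU secU]]; exists U; split => // i.
have [_ [s [cs ps _ [H [cH H1 pH _]]]]] := secU i.
by exists s; split => //; exists H.
Qed.

Theorem theorem4p4 (B E X : topologicalType) (C : CWstructure B)
    (pE : E -> B) (sE : B -> E) (pX : X -> B) (sX : B -> X) (f : E -> X)
    (k : nat) :
  (* E and X are fibrewise pointed spaces over B *)
  continuous pE -> continuous sE -> (forall b, pE (sE b) = b) ->
  continuous pX -> continuous sX -> (forall b, pX (sX b) = b) ->
  (* f is a fibrewise pointed map *)
  continuous f -> (forall e, pX (f e) = pE e) -> (forall b, f (sE b) = sX b) ->
  (* E and X are pointed fibrant and cofibrant *)
  hurewicz_fibration pE -> closed_cofibration sE ->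
  hurewicz_fibration pX -> closed_cofibration sX ->
  (* X is paracompact Hausdorff *)
  hausdorff_space X -> paracompact X ->
  (* (i) *)
  k_equivalence f k ->
  (* (ii) dim B < (secat_B(f) + 1)(k + 1) - 1 *)
  lt_enat (cw_dimension C) (secat_bound (secatB pE pX f) k) ->
  secatB pE pX f = secatBB pE pX sE sX f.
Proof.
move=> cpE csE pEs cpX csX pXs cf pXf fsE fibE _ fibX cofX _ _ kf.
(* An infinite dimension of [B] is excluded by the strict inequality, since [lt_enat None _] is
   false. *)
case eN : (cw_dimension C) => [N|//] dim.
apply: least_opt_eq => n; first exact: fwp_fw_cover.
move=> en; move: dim; rewrite [secatB _ _ _]en /= => dim.
have [dimC _] := least_opt_some eN; have [cov _] := least_opt_some en.
(* The cells have dimension at most [N], hence less than [N.+1]; the predecessor in [secat_bound]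
   turns the hypothesis into [N.+1 < n.+1 * k.+1]. *)
apply: (@pointed_cover B E X C pE sE pX sX f k n N.+1) => //.
Qed.
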